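(* Let $g$ satisfy (G1) and (G2), let $\alpha\in\mathbb{R}\setminus\{0\}$, $\sigma>0$, $c>0$, $K=\alpha^2/(c\sigma^2)$, and let $$V_*(\pi):=\inf_{\tau\in\mathcal{T}}\mathbb{E}_\pi\left[c\tau+g(\Pi_\tau)\right],\qquad \pi\in(0,1).$$ If $(\mathcal{A}g)(\pi_0)\ge -K^{-1}$, then $V_*\equiv g$. If $(\mathcal{A}g)(\pi_0)<-K^{-1}$, then the value function $V_*(\pi)$ coincides with $$V(\pi)=\begin{cases} 2K^{-1}\Psi(\pi)+H'(A^* )\pi+H(A^* )-A^*H'(A^* ), & \pi\in(A^*,B^* ),\\ g(\pi), & \pi\in[0,A^*]\cup[B^*,1].\end{cases}$$
   Context: Probabilistic setting: on a stochastic basis $(\Omega,\mathcal{F},\mathbb{F},\mathbb{P})$ there are a Brownian motion $W$ and an independent random variable $\theta\in\{0,1\}$ with $\mathbb{P}(\theta=1)=\pi\in(0,1)$; $\mathbb{E}_\pi$ denotes expectation under this prior. The observed signal is $X_t=\alpha\theta t+\sigma W_t$, with filtration $\mathbb{F}^X=(\mathcal{F}^X_t)_{t\ge0}$ generated by $X$. The posterior process is $\Pi_t:=\mathbb{P}(\theta=1\mid\mathcal{F}^X_t)$, which satisfies $d\Pi_t=\frac{\alpha}{\sigma}\Pi_t(1-\Pi_t)\,d\overline{W}_t$, $\Pi_0=\pi$, where $\overline{W}_t:=\sigma^{-1}\left(X_t-\alpha\int_0^t\Pi_s\,ds\right)$ is an $\mathbb{F}^X$-Brownian motion. $\mathcal{T}$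 is the set of a.s. finite stopping times of the filtration $\mathbb{F}^\Pi$ generated by $\Pi$. For $f\in C^2(0,1)$, $(\mathcal{A}f)(\pi):=\tfrac12\pi^2(1-\pi)^2f''(\pi)$. The function $g:[0,1]\to\mathbb{R}$ satisfies: (G1) $g\in C^2(0,1)$ is concave and $g(0)=g(1)=0$; (G2) there exists $\pi_0\in(0,1)$ such that $\mathcal{A}g$ is strictly decreasing on $(0,\pi_0)$ and strictly increasing on $(\pi_0,1)$. Set, for $\pi\in(0,1)$, $\Psi(\pi):=(1-2\pi)\log\left(\frac{\pi}{1-\pi}\right)$ and $H(\pi):=g(\pi)-2K^{-1}\Psi(\pi)$. When $(\mathcal{A}g)(\pi_0)<-K^{-1}$, the set $U:=\{\pi\in(0,1):(\mathcal{A}g)(\pi)<-K^{-1}\}$ is a nonempty open interval with endpoints $0<\pi_*<\pi^*<1$, and $(A^*,B^* )$ denotes the unique pair in $(0,1)^2$ with $A^*\le\pi_*$, $B^*\ge\pi^*$, satisfying $H(B^* )-H(A^* )=H'(A^* )(B^*-A^* )$ and $H'(A^* )=H'(B^* )$. *)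

(* Defs.v *)
From HB Require Import structures.
From mathcomp Require Import all_boot all_order all_algebra.
From mathcomp Require Import all_classical all_reals all_analysis.
Set Implicit Arguments.
Unset Strict Implicit.
Unset Printing Implicit Defensive.
Import Order.TTheory GRing.Theory Num.Theory.
Import numFieldNormedType.Exports.
Local Open Scope classical_set_scope.
Local Open Scope ring_scope.

(** Processes are indexed by [R]; only times [0 <= t] are meaningful. *)

Section sigma_algebras.
Context d (T : measurableType d) (R : realType).

Definition sigma_fun d' (T' : measurableType d') (X : T -> T') : set (set T) :=
  preimage_set_system setT X measurable.

Definition sigma_process (I : set R) (X : R -> T -> R) : set (set T) :=
  <<s \bigcup_(s in I) sigma_fun (X s) >>.

(** Raw filtration: neither completed nor made right-continuous. *)
Definition natural_filtration (X : R -> T -> R) (t : R) : set (set T) :=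
  sigma_process `[0, t] X.

Definition filtration (F : R -> set (set T)) : Prop :=
  [/\ forall t, 0 <= t -> sigma_algebra setT (F t),
      forall t, 0 <= t -> F t `<=` measurable
    & forall s t, 0 <= s -> s <= t -> F s `<=` F t].

Definition adapted (F : R -> set (set T)) (X : R -> T -> R) : Prop :=
  forall t, 0 <= t -> sigma_fun (X t) `<=` F t.

Definition continuous_paths (X : R -> T -> R) : Prop :=
  forall w, {within `[0, +oo[, continuous (fun t => X t w)}.

Definition independent (P : probability T R) (G H : set (set T)) : Prop :=
  forall A B, G A -> H B -> P (A `&` B) = (P A * P B)%E.

(** The second argument of [normal_prob] is the standard deviation. *)
Definition brownian_motion (P : probability T R) (F : R -> set (set T))
    (W : R -> T -> R) : Prop :=
  [/\ adapted F W,
      {ae P, forall w, W 0 w = 0},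
      continuous_paths W,
      forall s t, 0 <= s -> s < t ->
        independent P (F s) (sigma_fun (fun w => W t w - W s w))
    & forall s t, 0 <= s -> s < t -> forall A : set R, measurable A ->
        pushforward P (fun w => W t w - W s w) A =
        normal_prob 0 (Num.sqrt (t - s)) A].

(** [Y] is a version of the conditional probability P(E | G). *)
Definition is_cond_prob (P : probability T R) (G : set (set T)) (E : set T)
    (Y : T -> R) : Prop :=
  sigma_fun Y `<=` G /\
  forall A, G A -> (\int[P]_(w in A) (Y w)%:E)%E = P (A `&` E).

End sigma_algebras.

Section stopping_problem.
Context d (T : measurableType d) (R : realType).

Definition signal (alpha sigma : R) (theta : T -> bool) (W : R -> T -> R)
    (t : R) (w : T) : R :=
  alpha * (theta w)%:R * t + sigma * W t w.

(** The conditional probabilities determine [Pi t] only up to a null set for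
    each [t]; the process is the version with continuous [0,1]-valued paths,
    which the dynamics of the posterior and the domain of [g] presuppose. *)
Definition posterior_process (P : probability T R) (theta : T -> bool)
    (X : R -> T -> R) (Pi : R -> T -> R) : Prop :=
  [/\ forall t, 0 <= t ->
        is_cond_prob P (natural_filtration X t) (theta @^-1` [set true]) (Pi t),
      continuous_paths Pi
    & forall t w, 0 <= t -> 0 <= Pi t w <= 1].

Definition finite_stopping_time (P : probability T R) (F : R -> set (set T))
    (tau : T -> \bar R) : Prop :=
  [/\ forall w, (0 <= tau w)%E,
      forall t, 0 <= t -> F t [set w | (tau w <= t%:E)%E]
    & {ae P, forall w, (tau w < +oo)%E}].

(** [fine +oo = 0] is harmless here: [tau] is almost surely finite. *)
Definition expected_cost (P : probability T R) (c : R) (g : R -> R)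
    (Pi : R -> T -> R) (tau : T -> \bar R) : \bar R :=
  (\int[P]_w (c%:E * tau w + (g (Pi (fine (tau w)) w))%:E))%E.

Definition value (P : probability T R) (c : R) (g : R -> R)
    (Pi : R -> T -> R) : \bar R :=
  ereal_inf [set expected_cost P c g Pi tau |
             tau in finite_stopping_time P (natural_filtration Pi)].

End stopping_problem.

Section cost_function.
Context (R : realType).

Definition C2_01 (g : R -> R) : Prop :=
  [/\ forall x, x \in `]0, 1[ -> derivable g x 1,
      forall x, x \in `]0, 1[ -> derivable (derive1 g) x 1
    & forall x, x \in `]0, 1[ -> {for x, continuous (derive1n 2 g)}].

Definition concave_function (D : set R) (g : R -> R) : Prop :=
  convex_function (D : set (convex_lmodType R^o)) (fun x => - g x).

Definition genA (f : R -> R) (x : R) : R :=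
  2^-1 * x ^+ 2 * (1 - x) ^+ 2 * derive1n 2 f x.

(** [g : R -> R] stands for a function on [0,1]; its other values are never
    used. *)
Definition G1 (g : R -> R) : Prop :=
  [/\ C2_01 g, concave_function `[0, 1] g & g 0 = 0 /\ g 1 = 0].

Definition G2 (g : R -> R) (pi0 : R) : Prop :=
  [/\ 0 < pi0 < 1,
      {in `]0, pi0[ &, {homo genA g : x y / x < y >-> y < x}}
    & {in `]pi0, 1[ &, {homo genA g : x y / x < y}}].

Definition Psi (x : R) : R := (1 - 2 * x) * ln (x / (1 - x)).

Definition Hfun (g : R -> R) (K : R) (x : R) : R := g x - 2 * K^-1 * Psi x.

Definition Uset (g : R -> R) (K : R) : set R :=
  [set x | 0 < x < 1 /\ genA g x < - K^-1].

(** As [Uset g K] is an open interval, its endpoints are its infimum and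
    supremum. *)
Definition double_tangency (g : R -> R) (K A B : R) : Prop :=
  let H := Hfun g K in
  [/\ 0 < A < 1, 0 < B < 1,
      A <= inf (Uset g K) /\ sup (Uset g K) <= B,
      H B - H A = derive1 H A * (B - A)
    & derive1 H A = derive1 H B].

Definition Vcand (g : R -> R) (K A B : R) (x : R) : R :=
  let H := Hfun g K in
  if A < x < B then
    2 * K^-1 * Psi x + derive1 H A * x + H A - A * derive1 H A
  else g x.

End cost_function.

(* Main.v *)
(* Write a = alpha / sigma and let l_t be the posterior log-odds of theta, which
   is affine in (X_t, t).  Bayes' formula (a Cameron-Martin shift over one time
   step, extended to the whole signal filtration by the Markov property on
   cylinders) gives Pi_t = logistic (l_t), hence Psi (Pi_t) = (1 - 2 Pi_t) l_t.
   This replaces Ito calculus: up to terms with zero conditional mean,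
   (1 - 2 Pi_t) l_t may be replaced by (1 - 2 theta) l_t, whose drift is the
   constant - a^2 / 2.  Thus c t + phi (Pi_t) is a martingale whenever
   phi = 2 K^-1 Psi + (affine function), and optional stopping along time grids
   suffices.

   Lower bound: if phi <= g then every stopping time costs at least phi p.  The
   best such phi at p corresponds to an affine minorant of H touching it: the
   tangent at p, or the double tangent when A < p < B; the sign of H'' is that
   of genA g + K^-1.  Upper bound for A < p < B: stop when Pi leaves ]A, B[ on a
   fine grid; there phi = g at A and B, and the overshoot is controlled by the
   fourth moments of the increments of l. *)
Require Import Defs.
From HB Require Import structures.
From mathcomp Require Import all_boot all_order all_algebra.
From mathcomp Require Import all_classical all_reals all_analysis.
From mathcomp Require Import measurable_realfun.
From mathcomp Require Import ring lra.
Import Order.TTheory GRing.Theory Num.Theory.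
Import numFieldNormedType.Exports.
Local Open Scope classical_set_scope.
Local Open Scope ring_scope.

Set Implicit Arguments.
Unset Strict Implicit.
Unset Printing Implicit Defensive.

(** * Integration tools *)

(** [Pi] is known only through conditional probabilities at fixed times and through its continuous
    paths, so every computation is made for the explicit process [post]; the two agree almost surely
    at all times simultaneously, which is what evaluation at a random time requires. Events of the
    signal filtration mix [theta] with the noise; cutting them with [{theta = i}] turns them into
    noise events, to which independence applies. The obstacle in the upper bound is that the horizon
    must tend to infinity while overshoots are summed over all steps. With [n ^ 3] steps of length
    [1 / n ^ 2] the horizon is [n]; second moments of the increments would add up to order [n],
    fourth moments add up to order [1 / n]. The probability of no exit before the horizon requires
    no hitting-time law: the cost is at least [c * n] times that probability, so the cost itself
    bounds this error term, with a factor that vanishes as [n] grows. *)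

Section change_of_measure.
Local Open Scope ereal_scope.
Context d1 d2 d3 (T1 : measurableType d1) (T2 : measurableType d2)
  (S : measurableType d3) (R : realType).
Variables (mu1 : {measure set T1 -> \bar R}) (mu2 : {measure set T2 -> \bar R}).
Variables (D1 : set T1) (D2 : set T2) (mD1 : measurable D1) (mD2 : measurable D2).
Variables (X1 : T1 -> S) (X2 : T2 -> S) (f : T2 -> R).
Hypotheses (mX1 : measurable_fun setT X1) (mX2 : measurable_fun setT X2).
Hypotheses (mf : measurable_fun setT f) (f0 : forall x, (0 <= f x)%R).
Hypothesis H : forall C, measurable C ->
  mu1 (D1 `&` X1 @^-1` C) = \int[mu2]_(x in D2 `&` X2 @^-1` C) (f x)%:E.

Import HBNNSimple.

Let mfE D : measurable_fun D (fun x => (f x)%:E).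
Proof. by apply/measurable_EFinP; exact: measurable_funTS. Qed.

Let measurable_indic_comp d (T : measurableType d) (D : set T) (X : T -> S) C :
  measurable C -> measurable_fun setT X ->
  measurable_fun D (fun x => \1_C (X x) : R).
Proof.
move=> mC mX; apply: measurable_funTS.
exact: (measurableT_comp (measurable_indic mC) mX).
Qed.

Let change_of_measure_nnsfun (h : {nnsfun S >-> R}) :
  \int[mu1]_(x in D1) (h (X1 x))%:E = \int[mu2]_(x in D2) ((f x)%:E * (h (X2 x))%:E).
Proof.
have mh C : measurable (h @^-1` [set C]) by exact: measurable_funPTI.
under eq_integral do rewrite fimfunE -fsumEFin//.
rewrite ge0_integral_fsum//; last 2 first.
- move=> r; apply/measurable_EFinP; apply: measurable_funM => //.
  exact: measurable_indic_comp.
- by move=> r x _; rewrite EFinM nnfun_muleindic_ge0.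
under [RHS]eq_integral do rewrite fimfunE -fsumEFin//.
under [RHS]eq_integral => x _.
  rewrite ge0_mule_fsumr; last by move=> r; rewrite EFinM nnfun_muleindic_ge0.
  over.
have mr r : measurable_fun D2 (fun x => (r * \1_(h @^-1` [set r]) (X2 x))%:E).
  apply/measurable_EFinP; apply: measurable_funM => //.
  exact: measurable_indic_comp.
rewrite ge0_integral_fsum//; last 2 first.
- by move=> r; apply: emeasurable_funM => //; exact: measurable_funTS.
- move=> r x _; apply: mule_ge0; first by rewrite lee_fin.
  by rewrite EFinM nnfun_muleindic_ge0.
apply: eq_fsbigr => r; rewrite inE => -[z _ zr].
have r0 : (0 <= r)%R by rewrite -zr.
under eq_integral do rewrite EFinM.
rewrite ge0_integralZl; [|by []| |by move=> x _; rewrite lee_fin|by []]; last first.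
  by apply/measurable_EFinP; exact: measurable_indic_comp.
under [RHS]eq_integral do rewrite EFinM muleCA.
have mfi : measurable_fun D2 (fun x => (f x)%:E * (\1_(h @^-1` [set r]) (X2 x))%:E).
  apply: emeasurable_funM; first exact: measurable_funTS.
  apply/measurable_EFinP.
  exact: measurable_indic_comp.
rewrite ge0_integralZl; [|by []|by []| |by []]; last first.
  by move=> x _; apply: mule_ge0; rewrite lee_fin.
congr (_ * _).
rewrite -[LHS]/(\int[mu1]_(x in D1) (\1_(X1 @^-1` (h @^-1` [set r])) x)%:E).
rewrite integral_indic//; last by rewrite -[X in measurable X]setTI; exact: mX1.
rewrite setIC H// integral_mkcondr; apply: eq_integral => x _.
rewrite /patch indicE.
have [xr|xr] := boolP (x \in _).
  by rewrite (_ : (X2 x \in _) = true) ?mule1//; move: xr; rewrite !inE.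
rewrite (_ : (X2 x \in _) = false) ?mule0//.
by apply/negbTE; move: xr; rewrite !notin_setE.
Qed.

(** [H] says that the law of [X1] on [D1] is the law of [X2] on [D2] under the density [f];
    indicators pass to simple functions by linearity and to [h] by monotone convergence. With two
    unrelated source spaces it serves alike for densities, translations, image laws, Brownian
    increments and Bayes' formula. *)
Lemma change_of_measure (h : S -> \bar R) :
  measurable_fun setT h -> (forall x, 0 <= h x) ->
  \int[mu1]_(x in D1) h (X1 x) = \int[mu2]_(x in D2) ((f x)%:E * h (X2 x)).
Proof.
move=> mh h0; pose g := nnsfun_approx measurableT mh.
have gh x : (g n x)%:E @[n --> \oo] --> h x by exact: cvg_nnsfun_approx.
have ndg x : {homo (fun n => (g n x)%:E) : m n / (m <= n)%N >-> m <= n}.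
  by move=> m n mn; rewrite lee_fin; exact/lefP/nd_nnsfun_approx.
have mg d (T : measurableType d) (D : set T) (X : T -> S) n :
    measurable_fun setT X -> measurable_fun D (fun x => (g n (X x))%:E).
  move=> mX; apply/measurable_EFinP; apply: measurable_funTS.
  exact: measurableT_comp.
transitivity (limn (fun n => \int[mu1]_(x in D1) (g n (X1 x))%:E)).
  rewrite -monotone_convergence//.
  - by apply: eq_integral => x _; apply/esym/cvg_lim => //; exact: gh.
  - by move=> n; exact: mg.
  - by move=> n x _; rewrite lee_fin.
transitivity (limn (fun n => \int[mu2]_(x in D2) ((f x)%:E * (g n (X2 x))%:E))); last first.
  rewrite -monotone_convergence//.
  - apply: eq_integral => x _; apply/cvg_lim => //.
    by apply: cvgeZl => //; exact: gh.
  - by move=> n; apply: emeasurable_funM; [exact: mfE|exact: mg].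
  - by move=> n x _; apply: mule_ge0; rewrite lee_fin.
  - by move=> x _ m n mn; apply: lee_wpmul2l; [rewrite lee_fin|exact: ndg].
by congr (limn _); apply/funext => n; exact: change_of_measure_nnsfun.
Qed.

End change_of_measure.

(** * Gaussian integrals: Cameron-Martin shift and moment bounds *)

Section gaussian_integrals.
Context (R : realType).
Local Notation mu := (@lebesgue_measure R).
Implicit Types (h : R -> \bar R).

Lemma ge0_integral_normal_prob (m s : R) h :
  measurable_fun setT h -> (forall x, 0 <= h x)%E ->
  (\int[normal_prob m s]_x h x = \int[mu]_x ((normal_pdf m s x)%:E * h x))%E.
Proof.
move=> mh h0.
apply: (@change_of_measure _ _ _ _ _ _ _ (normal_prob m s) mu setT setT measurableT
  measurableT id id (normal_pdf m s) _ _ _ _ _ h mh h0) => //.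
- exact: measurable_normal_pdf.
- by move=> x; exact: normal_pdf_ge0.
Qed.

Lemma lebesgue_measure_shift (a : R) (A : set R) : measurable A ->
  pushforward mu (fun x : R => x + a : measurableTypeR R) A = mu A.
Proof.
move=> mA; apply/esym/lebesgue_measure_unique => //=.
  exact: measurable_funD.
move=> ms _ [[u v]] _ <-.
rewrite /pushforward (_ : _ @^-1` _ = `]u - a, v - a]%classic); last first.
  by apply/seteqP; split => x /=; rewrite !in_itv/= => /andP[? ?]; apply/andP; split; lra.
rewrite !lebesgue_measure_itv/= !lte_fin ltrD2r; case: ifP => // _.
by congr EFin; lra.
Qed.

Lemma ge0_integral_shift (a : R) h :
  measurable_fun setT h -> (forall x, 0 <= h x)%E ->
  (\int[mu]_x h (x + a)%R = \int[mu]_x h x)%E.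
Proof.
move=> mh h0.
transitivity (\int[mu]_(x in setT) (1%:E * h x))%E.
apply: (@change_of_measure _ _ _ _ _ _ _ mu mu setT setT measurableT
  measurableT (fun x => x + a) id (fun=> 1) _ _ _ _ _ h mh h0) => //.
- exact: measurable_funD.
- move=> C mC; rewrite !setTI integral_cst// mul1e.
  exact: lebesgue_measure_shift.
- by apply: eq_integral => x _; rewrite mul1e.
Qed.

Lemma ge0_integral_opp h :
  measurable_fun setT h -> (forall x, 0 <= h x)%E ->
  (\int[mu]_x h (- x)%R = \int[mu]_x h x)%E.
Proof.
move=> mh h0.
transitivity (\int[mu]_(x in setT) (1%:E * h x))%E.
apply: (@change_of_measure _ _ _ _ _ _ _ mu mu setT setT measurableT
  measurableT -%R id (fun=> 1) _ _ _ _ _ h mh h0) => //.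
- move=> C mC; rewrite !setTI integral_cst// mul1e.
  exact: lebesgue_measureN.
- by apply: eq_integral => x _; rewrite mul1e.
Qed.

(** Completing the square: expanding [(y - b * s ^+ 2) ^+ 2] produces the exponential weight. *)
Lemma normal_pdf_shift (s b y : R) : s != 0 ->
  normal_pdf 0 s (y - b * s ^+ 2) =
  normal_pdf 0 s y * expR (b * y - b ^+ 2 * s ^+ 2 / 2).
Proof.
move=> s0; rewrite !normal_pdfE// /normal_fun -[RHS]mulrA -expRD.
congr (_ * expR _); rewrite -mulr_natr; field; exact: s0.
Qed.

(** Translation invariance of Lebesgue measure moves the shift from [h] to the density, where
    [normal_pdf_shift] converts it into a weight. With [b = alpha / sigma] this is how a drift of
    the signal becomes a likelihood ratio. *)
Lemma normal_prob_shift (s b : R) h : s != 0 ->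
  measurable_fun setT h -> (forall x, 0 <= h x)%E ->
  (\int[normal_prob 0 s]_y h (y + b * s ^+ 2)%R =
   \int[normal_prob 0 s]_y ((expR (b * y - b ^+ 2 * s ^+ 2 / 2))%:E * h y))%E.
Proof.
move=> s0 mh h0.
have mpdf : measurable_fun setT (EFin \o normal_pdf 0 s).
  by apply/measurable_EFinP; exact: measurable_normal_pdf.
have mlin (u v : R) : measurable_fun setT (fun y : R => u * y + v).
  by apply: measurable_funD => //; exact: measurable_funM.
have mh1 : measurable_fun setT (fun y : R => h (y + b * s ^+ 2)).
  by apply: (measurableT_comp mh); exact: measurable_funD.
have mh2 : measurable_fun setT
    (fun y : R => (expR (b * y - b ^+ 2 * s ^+ 2 / 2))%:E * h y)%E.
  apply: emeasurable_funM => //; apply/measurable_EFinP.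
  by apply: measurableT_comp => //; exact: mlin.
have h2 y : (0 <= (expR (b * y - b ^+ 2 * s ^+ 2 / 2))%:E * h y)%E.
  by rewrite mule_ge0// lee_fin expR_ge0.
rewrite !ge0_integral_normal_prob//.
have E y : ((normal_pdf 0 s y)%:E * h (y + b * s ^+ 2)%R =
  (fun x => (normal_pdf 0 s (x - b * s ^+ 2))%:E * h x) (y + b * s ^+ 2)%R)%E.
  by rewrite /= addrK.
under eq_integral do rewrite E.
rewrite (ge0_integral_shift (b * s ^+ 2)
  (h := fun x => (normal_pdf 0 s (x - b * s ^+ 2))%:E * h x)%E).
- by apply: eq_integral => y _; rewrite normal_pdf_shift// EFinM muleA.
- apply: emeasurable_funM => //; apply/measurable_EFinP.
  by apply: measurableT_comp; [exact: measurable_normal_pdf|exact: measurable_funB].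
- by move=> y; rewrite mule_ge0// lee_fin normal_pdf_ge0.
Qed.

(** The weight of [normal_prob_shift] integrates to one (take [h = 1]); the moment generating
    function is read off from its normalising constant. *)
Lemma normal_prob_expR (s b : R) : s != 0 ->
  (\int[normal_prob 0 s]_y (expR (b * y)%R)%:E = (expR (b ^+ 2 * s ^+ 2 / 2))%:E)%E.
Proof.
move=> s0.
have mexp (f : R -> R) : measurable_fun setT f ->
    measurable_fun setT (EFin \o (expR \o f)).
  by move=> mf; apply/measurable_EFinP; exact: measurableT_comp.
have mlin : measurable_fun setT (fun y : R => b * y - b ^+ 2 * s ^+ 2 / 2).
  by apply: measurable_funD => //; exact: measurable_funM.
transitivity (\int[normal_prob 0 s]_y ((expR (b ^+ 2 * s ^+ 2 / 2))%:E *
    (expR (b * y - b ^+ 2 * s ^+ 2 / 2))%:E))%E.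
  by apply: eq_integral => y _; rewrite -EFinM -expRD addrC subrK.
rewrite ge0_integralZl_EFin ?expR_ge0//; last exact: (mexp _ mlin).
have := normal_prob_shift (h := cst 1%E) b s0 (measurable_cst _) (fun=> lee01).
rewrite integral_cst//= mul1e probability_setT => h.
under eq_integral do rewrite -[X in X%:E]mulr1 EFinM.
by rewrite -h mule1.
Qed.

Lemma power4_le_expR (y : R) : y ^+ 4 <= 24 * (expR y + expR (- y)).
Proof.
wlog y0 : y / 0 <= y => [H|].
  have [/H//|/ltW] := leP 0 y; rewrite -oppr_ge0 => /H.
  by rewrite exprNn opprK [expR _ + _]addrC mulrC; nra.
have := expR_ge1Dxn 3 y0; have := expR_gt0 (- y).
rewrite (_ : 4`! = 24)%N// => h1 h2; lra.
Qed.

(** Rescaling by [s^-1] makes both exponential moments equal to [expR (1 / 2)]; [48] is twice the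
    [24 = 4!] of [power4_le_expR]. What matters later is the order [s ^+ 4], that is [(t - s) ^+ 2]
    for a Brownian increment. *)
Lemma normal_prob_power4 (s : R) : s != 0 ->
  (\int[normal_prob 0 s]_y (y ^+ 4)%:E <= (48 * expR (1 / 2) * s ^+ 4)%:E)%E.
Proof.
move=> s0.
have mlin (u : R) : measurable_fun setT (fun y : R => (expR (u * y))%:E).
  by apply/measurable_EFinP; apply: measurableT_comp => //; exact: measurable_funM.
have k0 : 0 <= 24 * s ^+ 4 by rewrite mulr_ge0// exprn_even_ge0.
apply: (@le_trans _ _ (\int[normal_prob 0 s]_y ((24 * s ^+ 4)%:E *
    ((expR (s^-1 * y)%R)%:E + (expR (- s^-1 * y)%R)%:E)))%E).
  apply: ge0_le_integral => //.
  - by move=> y _; rewrite lee_fin exprn_even_ge0.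
  - by apply/measurable_EFinP; exact: measurable_funX.
  - by apply: measurable_funeM; apply: emeasurable_funD; exact: mlin.
  - move=> y _; rewrite -EFinD -EFinM lee_fin.
    have := power4_le_expR (s^-1 * y); rewrite mulNr exprMn => h.
    have s40 : 0 < s ^+ 4 by rewrite exprn_even_gt0.
    rewrite -(ler_pM2l s40) in h.
    rewrite (_ : y ^+ 4 = s ^+ 4 * (s^-1 ^+ 4 * y ^+ 4)); last by field.
    by apply: (le_trans h); rewrite mulrCA mulrA.
rewrite ge0_integralZl_EFin//; last 2 first.
- by move=> y _; rewrite adde_ge0// lee_fin expR_ge0.
- apply: emeasurable_funD; exact: mlin.
rewrite ge0_integralD//; [|exact: mlin..].
rewrite !normal_prob_expR// -EFinD -EFinM lee_fin sqrrN.
rewrite (_ : s^-1 ^+ 2 * s ^+ 2 = 1); last by field.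
by rewrite le_eqVlt; apply/orP; left; apply/eqP; ring.
Qed.

Lemma ge0_integral_normal_prob_opp (s : R) h : s != 0 ->
  measurable_fun setT h -> (forall x, 0 <= h x)%E ->
  (\int[normal_prob 0 s]_y h (- y)%R = \int[normal_prob 0 s]_y h y)%E.
Proof.
move=> s0 mh h0.
have mhN : measurable_fun setT (fun y : R => h (- y)).
  by apply: (measurableT_comp mh); exact: oppr_measurable.
rewrite !ge0_integral_normal_prob//.
rewrite -[RHS]ge0_integral_opp.
- apply: eq_integral => y _; congr (_%:E * _)%E.
  by rewrite normal_pdfE// /normal_fun !subr0 sqrrN.
- apply: emeasurable_funM => //; apply/measurable_EFinP.
  exact: measurable_normal_pdf.
- by move=> y; rewrite mule_ge0// lee_fin normal_pdf_ge0.
Qed.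

Lemma integrable_normal_prob_id (s : R) : s != 0 ->
  (normal_prob 0 s).-integrable setT EFin.
Proof.
move=> s0; apply: (@le_integrable _ _ _ (normal_prob 0 s) setT measurableT EFin
  (fun y => (expR (1 * y) + expR (- 1 * y))%:E)).
- exact/measurable_EFinP.
- move=> y _; rewrite lee_fin mul1r mulN1r.
  rewrite [leRHS]ger0_norm ?addr_ge0 ?expR_ge0// ler_norml.
  have := expR_ge1Dx y; have := expR_ge1Dx (- y).
  have := expR_gt0 y; have := expR_gt0 (- y); move=> *; apply/andP; split; lra.
have i1 (u : R) : (normal_prob 0 s).-integrable setT (fun y => (expR (u * y))%:E).
  apply/integrableP; split.
    by apply/measurable_EFinP; apply: measurableT_comp => //; exact: measurable_funM.
  under eq_integral do rewrite /= ger0_norm ?expR_ge0//.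
  by rewrite normal_prob_expR// ltry.
exact: (@integrableD _ _ _ (normal_prob 0 s) setT measurableT _ _ (i1 1) (i1 (-1))).
Qed.

End gaussian_integrals.

(** The image under [V] of [P] restricted to [B]. The measurability proofs are arguments so that the
    measure structure can be attached to the term. *)
Definition law_on d d' (T : measurableType d) (S : measurableType d') (R : realType)
    (P : probability T R) (B : set T) (V : T -> S)
    (mB : measurable B) (mV : measurable_fun setT V) (A : set S) : \bar R :=
  P (B `&` V @^-1` A).

Section law_on_measure.
Context d d' (T : measurableType d) (S : measurableType d') (R : realType).
Variables (P : probability T R) (B : set T) (V : T -> S).
Variables (mB : measurable B) (mV : measurable_fun setT V).
Local Notation law := (@law_on d d' T S R P B V mB mV).

Let mpre A : measurable A -> measurable (B `&` V @^-1` A).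
Proof.
move=> mA; apply: measurableI => //.
by rewrite -[X in measurable X]setTI; exact: mV.
Qed.

Let law0 : law set0 = 0%E.
Proof. by rewrite /law_on preimage_set0 setI0 measure0. Qed.

Let law_ge0 A : (0 <= law A)%E.
Proof. exact: measure_ge0. Qed.

Let law_sigma_additive : semi_sigma_additive law.
Proof.
move=> F mF tF mUF; rewrite /law_on preimage_bigcup setI_bigcupr.
apply: measure_semi_sigma_additive.
- by move=> n; exact: mpre.
- apply/trivIsetP => i j _ _ ij.
  rewrite setIACA setIid -preimage_setI.
  by move/trivIsetP : tF => /(_ _ _ _ _ ij) ->//; rewrite preimage_set0 setI0.
- by rewrite -setI_bigcupr -preimage_bigcup; exact: mpre.
Qed.

HB.instance Definition _ := isMeasure.Build _ _ _ law
  law0 law_ge0 law_sigma_additive.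

Let law_fin : fin_num_fun law.
Proof. by move=> A mA; apply: fin_num_measure; exact: mpre. Qed.

HB.instance Definition _ := Measure_isFinite.Build _ _ _ law law_fin.

Lemma ge0_integral_law_on (h : S -> \bar R) :
  measurable_fun setT h -> (forall x, 0 <= h x)%E ->
  (\int[law]_x h x = \int[P]_(w in B) h (V w))%E.
Proof.
move=> mh h0; apply/esym.
transitivity (\int[law]_(x in setT) (1%:E * h x))%E.
  apply: (@change_of_measure _ _ _ _ _ _ _ P law B setT mB
    measurableT V id (fun=> 1) _ _ _ _ _ h mh h0) => //.
  by move=> C mC; rewrite !setTI integral_cst// mul1e.
by apply: eq_integral => x _; rewrite mul1e.
Qed.

End law_on_measure.

Section independent_product.
Context d d1 d2 (T : measurableType d) (S1 : measurableType d1)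
  (S2 : measurableType d2) (R : realType).
Variables (P : probability T R) (B : set T) (V : T -> S1) (U : T -> S2).
Variables (nu : probability S2 R).
Hypotheses (mB : measurable B).
Hypotheses (mV : measurable_fun setT V) (mU : measurable_fun setT U).
Hypothesis VU : forall C D, measurable C -> measurable D ->
  P (B `&` V @^-1` C `&` U @^-1` D) = (P (B `&` V @^-1` C) * nu D)%E.
Variable h : S1 * S2 -> \bar R.
Hypotheses (mh : measurable_fun setT h) (h0 : forall x, (0 <= h x)%E).

Lemma measurable_integral_section :
  measurable_fun setT (fun y => \int[P]_(w in B) h (V w, y))%E.
Proof.
have := @measurable_fun_fubini_tonelli_G _ _ _ _ _ (law_on P mB mV) h mh h0.
apply: eq_measurable_fun => y _.
rewrite /fubini_G ge0_integral_law_on//.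
exact: measurableT_comp.
Qed.

(** [VU] factors the joint law of [(V, U)] on [B] over rectangles, so this law is the product of
    [law_on] and [nu], and Tonelli freezes [U]. The separate event [B] carries the past and [theta],
    while [V] is just the current signal. *)
Lemma integral_independent :
  (\int[P]_(w in B) h (V w, U w) = \int[nu]_y \int[P]_(w in B) h (V w, y))%E.
Proof.
have mVU : measurable_fun setT (fun w => (V w, U w)) by exact: measurable_fun_pair.
rewrite -(ge0_integral_law_on P mB mVU mh h0).
rewrite (eq_measure_integral (law_on P mB mV \x nu)%E); last first.
  move=> A mA _; apply/esym.
  apply: product_measure_unique => //.
  by move=> C D mC mD; rewrite -[RHS]VU// -setIA.
rewrite fubini_tonelli2//; apply: eq_integral => y _.
rewrite /fubini_G ge0_integral_law_on//.
exact: measurableT_comp.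
Qed.

End independent_product.

(** * The signal filtration and Bayes' formula *)

Section sigma_algebra_facts.
Context d (T : measurableType d) (R : realType).
Implicit Types (Y : R -> T -> R) (I : set R).

Lemma sigma_process_measurable_fun Y I t : I t ->
  measurable_fun [set: g_sigma_algebraType (\bigcup_(s in I) sigma_fun (Y s))] (Y t).
Proof.
move=> It _ B mB; apply: sub_sigma_algebra; exists t => //; exists B => //.
Qed.

Lemma sigma_process_sub Y I J : I `<=` J -> sigma_process I Y `<=` sigma_process J Y.
Proof. by move=> IJ; apply: sub_sigma_algebra2; apply: bigcup_subset. Qed.

Lemma sigma_process_min Y I (G : set (set T)) : sigma_algebra setT G ->
  (forall t, I t -> sigma_fun (Y t) `<=` G) -> sigma_process I Y `<=` G.
Proof. by move=> sG IG; apply: smallest_sub => // A [t It]; exact: IG. Qed.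

Lemma sigma_process_preimage Y I t B : I t -> measurable B ->
  sigma_process I Y (Y t @^-1` B).
Proof.
move=> It mB; rewrite -[X in sigma_process _ _ X]setTI.
exact: (sigma_process_measurable_fun It measurableT mB).
Qed.

Lemma sigma_processI Y I A B : sigma_process I Y A -> sigma_process I Y B ->
  sigma_process I Y (A `&` B).
Proof.
exact: (@measurableI _ (g_sigma_algebraType (\bigcup_(s in I) sigma_fun (Y s)))).
Qed.

Lemma sigma_processC Y I A : sigma_process I Y A -> sigma_process I Y (~` A).
Proof.
exact: (@measurableC _ (g_sigma_algebraType (\bigcup_(s in I) sigma_fun (Y s)))).
Qed.

End sigma_algebra_facts.

Section signal_filtration.
Context d (T : measurableType d) (R : realType) (P : probability T R).
Context (alpha sigma : R) (F : R -> set (set T)) (W : R -> T -> R).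
Context (theta : {RV P >-> bool}).
Hypotheses (hF : filtration F) (hW : brownian_motion P F W).
Hypothesis hindep : independent P (sigma_fun theta) (sigma_process `[0, +oo[ W).

Implicit Types (s t : R).
Local Notation X := (signal alpha sigma theta W).
Local Notation FX := (natural_filtration X).
Local Notation Th i := (theta @^-1` [set i]).

Lemma measurable_Th i : measurable (Th i).
Proof. exact: measurable_funPTI. Qed.

Lemma measurable_brownian t : 0 <= t -> measurable_fun setT (W t).
Proof.
move=> t0 _ B mB; have [_ Fm _] := hF; have [aW _ _ _ _] := hW.
by apply: (Fm t t0); apply: (aW t t0); exists B.
Qed.

Lemma measurable_theta : measurable_fun setT (fun w => (theta w)%:R : R).
Proof. exact: (@measurableT_comp _ _ _ _ _ _ (fun b : bool => b%:R : R)). Qed.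

Lemma measurable_signal t : 0 <= t -> measurable_fun setT (X t).
Proof.
move=> t0; apply: measurable_funD.
  by apply: measurable_funM => //; apply: measurable_funM => //; exact: measurable_theta.
by apply: measurable_funM => //; exact: measurable_brownian.
Qed.

Lemma natural_filtration_measurable (Y : R -> T -> R) t :
  (forall s, 0 <= s -> measurable_fun setT (Y s)) ->
  natural_filtration Y t `<=` measurable.
Proof.
move=> mY; apply: sigma_process_min => [|s]; first exact: sigma_algebra_measurable.
by rewrite /= in_itv/= => /andP[s0 _] _ [B mB <-]; exact: mY.
Qed.

Lemma natural_filtration_mono (Y : R -> T -> R) s t : s <= t ->
  natural_filtration Y s `<=` natural_filtration Y t.
Proof.
move=> st; apply: sigma_process_sub => u /=; rewrite !in_itv/= => /andP[-> us].
exact: le_trans us st.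
Qed.

Lemma signal_filtration_measurable t : FX t `<=` measurable.
Proof. by apply: natural_filtration_measurable => s; exact: measurable_signal. Qed.

Lemma brownian_filtration_sub t : 0 <= t -> natural_filtration W t `<=` F t.
Proof.
have [Fs _ Fmono] := hF; have [aW _ _ _ _] := hW.
move=> t0; apply: sigma_process_min => [|s]; first exact: Fs.
rewrite /= in_itv/= => /andP[s0 st] A /(aW _ s0); exact: Fmono.
Qed.

(* On {theta = i} the signal is an explicit function of the noise. *)
Lemma signal_filtration_trace s A i : 0 <= s -> FX s A ->
  exists2 A', natural_filtration W s A' & A `&` Th i = A' `&` Th i.
Proof.
move=> s0; pose G : set (set T) := [set A | exists2 A', natural_filtration W s A' &
  A `&` Th i = A' `&` Th i].
suff : FX s `<=` G by exact.
have sW := smallest_sigma_algebra setT (\bigcup_(u in `[0, s]) sigma_fun (W u)).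
apply: sigma_process_min.
  split.
  - by exists set0; [case: sW|].
  - move=> B [B' fB' BB']; exists (~` B'); first exact: sigma_processC.
    rewrite setTD; apply/seteqP; split => w [nB Tw]; split => // B'w; apply: nB.
      by have [] : (B `&` Th i) w by rewrite BB'.
    by have [] : (B' `&` Th i) w by rewrite -BB'.
  - move=> B hB; have [B' hB'] := choice (fun n => let: ex_intro2 x a b := hB n in
      ex_intro (fun x => natural_filtration W s x /\ B n `&` Th i = x `&` Th i) x (conj a b)).
    exists (\bigcup_k B' k); first by case: sW => _ _; apply => n; case: (hB' n).
    by rewrite !setI_bigcupl; apply: eq_bigcupr => n _; case: (hB' n).
move=> u Iu _ [C mC <-].
exists (W u @^-1` ((fun x => alpha * i%:R * u + sigma * x) @^-1` C)).
  apply: sigma_process_preimage => //; rewrite -[X in measurable X]setTI.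
  suff : measurable_fun setT (fun x : R => alpha * i%:R * u + sigma * x) by apply.
  by apply: measurable_funD => //; exact: measurable_funM.
apply/seteqP; split => w [/=]; rewrite /signal.
  by move=> [_ H] ti; rewrite ti in H; split.
by move=> H ti; rewrite ti; do ?split.
Qed.

(** The event [A] may depend on [theta], so independence of the increment from [F s] does not apply
    to it directly. Its trace on [Th i] is that of a noise event [A']; then [theta] splits off by
    independence from the whole path of [W], and the increment by independence from [F s]. *)
Lemma signal_increment_indep s t A i D : 0 <= s -> s < t -> FX s A -> measurable D ->
  P (A `&` Th i `&` (fun w => W t w - W s w) @^-1` D) =
  (P (A `&` Th i) * normal_prob 0 (Num.sqrt (t - s)) D)%E.
Proof.
move=> s0 st FA mD.
have t0 : 0 <= t by apply: ltW; exact: le_lt_trans s0 st.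
have [A' WA' ->] := signal_filtration_trace i s0 FA.
have [aW W0 cW iW nW] := hW.
have sub : natural_filtration W s `<=` sigma_process `[0, +oo[ W.
  by apply: sigma_process_sub => u /=; rewrite !in_itv/= andbT => /andP[].
have indT B : sigma_process `[0, +oo[ W B -> P (B `&` Th i) = (P (Th i) * P B)%E.
  move=> WB; rewrite setIC; apply: hindep => //.
  by exists [set i] => //; rewrite setTI.
have WD : sigma_process `[0, +oo[ W ((fun w => W t w - W s w) @^-1` D).
  rewrite -[X in sigma_process _ _ X]setTI.
  pose G := \bigcup_(u in `[0, +oo[) sigma_fun (W u).
  suff : measurable_fun [set: g_sigma_algebraType G] (fun w => W t w - W s w).
    by move=> /(_ measurableT _ mD).
  by apply: measurable_funB; apply: sigma_process_measurable_fun;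
    rewrite /= in_itv/= andbT.
rewrite setIAC indT; last by apply: sigma_processI => //; exact: sub.
rewrite indT; last exact: sub.
rewrite (iW s t s0 st A')//; [|exact: brownian_filtration_sub|by exists D => //; rewrite setTI].
by rewrite muleA; congr (_ * _)%E; exact: nW.
Qed.

Lemma integral_signal_increment s t A i (h : R * R -> \bar R) :
  0 <= s -> s < t -> FX s A ->
  measurable_fun setT h -> (forall x, 0 <= h x)%E ->
  (\int[P]_(w in A `&` Th i) h (X s w, W t w - W s w)%R =
   \int[normal_prob 0 (Num.sqrt (t - s))]_y \int[P]_(w in A `&` Th i) h (X s w, y))%E.
Proof.
move=> s0 st FA mh h0.
have t0 : 0 <= t by apply: ltW; exact: le_lt_trans s0 st.
apply: (integral_independent (nu := normal_prob 0 (Num.sqrt (t - s)))) => //.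
- apply: measurableI; [exact: signal_filtration_measurable FA|exact: measurable_Th].
- exact: measurable_signal.
- by apply: measurable_funB; exact: measurable_brownian.
move=> C D mC mD; rewrite (setIAC A) signal_increment_indep//.
by apply: sigma_processI => //; apply: sigma_process_preimage => //=; rewrite in_itv/= s0 lexx.
Qed.

End signal_filtration.

(** One of the two measures that the uniqueness theorem compares in [bayes_on_filtration]; as for
    [law_on], the proofs are arguments for the sake of the measure structure. *)
Definition density_on d (T : measurableType d) (R : realType) (P : {measure set T -> \bar R})
    (B : set T) (f : T -> R) (mB : measurable B) (mf : measurable_fun setT f)
    (f0 : forall x, 0 <= f x) (A : set T) : \bar R :=
  (\int[P]_(x in A `&` B) (f x)%:E)%E.

Section density_on_measure.
Context d (T : measurableType d) (R : realType) (P : {measure set T -> \bar R}).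
Variables (B : set T) (f : T -> R) (mB : measurable B).
Variables (mf : measurable_fun setT f) (f0 : forall x, 0 <= f x).
Local Notation dens := (density_on P mB mf f0).

Let dens0 : dens set0 = 0%E.
Proof. by rewrite /density_on set0I integral_set0. Qed.

Let dens_ge0 A : (0 <= dens A)%E.
Proof. by apply: integral_ge0 => x _; rewrite lee_fin. Qed.

Let dens_sigma_additive : semi_sigma_additive dens.
Proof.
move=> G mG tG mUG; rewrite /density_on setI_bigcupl ge0_integral_bigcup//.
- by apply: is_cvg_ereal_nneg_natsum_cond => n _ _; exact: dens_ge0.
- by move=> k; exact: measurableI.
- by apply/measurable_EFinP; exact: measurable_funTS.
- by move=> x _; rewrite lee_fin.
- apply/trivIsetP => i j _ _ ij; rewrite setIACA setIid.
  by move/trivIsetP : tG => /(_ _ _ _ _ ij) ->//; rewrite set0I.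
Qed.

HB.instance Definition _ := isMeasure.Build _ _ _ dens
  dens0 dens_ge0 dens_sigma_additive.

End density_on_measure.

(** * Log-odds coordinates and Bayes' formula over one time step *)

Section logistic.
Context (R : realType).
Implicit Types y : R.

Definition logistic y : R := (1 + expR (- y))^-1.

Lemma logistic_itv y : 0 < logistic y < 1.
Proof.
have e0 := expR_gt0 (- y); rewrite invr_gt0 invf_lt1 ?addr_gt0//.
by rewrite ltrDl.
Qed.

(** [expR y] is the odds of [logistic y]; in this form it clears the likelihood ratio from Bayes'
    formula. *)
Lemma expR_onem_logistic y : expR y * (1 - logistic y) = logistic y.
Proof.
have e0 := expR_gt0 (- y); rewrite -[y in expR y]opprK expRN /logistic.
by field; rewrite !gt_eqF// addr_gt0.
Qed.

Lemma ln_odds_logistic y : ln (logistic y / (1 - logistic y)) = y.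
Proof.
have /andP[_ l1] := logistic_itv y.
by rewrite -{1}expR_onem_logistic mulfK ?expRK// subr_eq0 gt_eqF.
Qed.

Lemma logistic_ln_odds x : 0 < x < 1 -> logistic (ln (x / (1 - x))) = x.
Proof.
move=> /andP[x0 x1]; rewrite /logistic expRN lnK; last first.
  by rewrite posrE divr_gt0// subr_gt0.
by rewrite invf_div; field; rewrite gt_eqF//= (_ : x + (1 - x) = 1)//; ring.
Qed.

Lemma continuous_logistic : continuous logistic.
Proof.
move=> y; apply: cvgV; first by rewrite gt_eqF// addr_gt0// expR_gt0.
apply: cvgD; first exact: cvg_cst.
by apply: continuous_comp; [exact: opp_continuous|exact: continuous_expR].
Qed.

Lemma Psi_logistic y : Psi (logistic y) = (1 - 2 * logistic y) * y.
Proof. by rewrite /Psi ln_odds_logistic. Qed.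

End logistic.

Section bayes_formula.
Context d (T : measurableType d) (R : realType) (P : probability T R).
Context (alpha sigma p : R) (F : R -> set (set T)) (W : R -> T -> R).
Context (theta : {RV P >-> bool}).
Hypotheses (hsigma : 0 < sigma) (hp : 0 < p < 1).
Hypotheses (hF : filtration F) (hW : brownian_motion P F W).
Hypothesis hindep : independent P (sigma_fun theta) (sigma_process `[0, +oo[ W).
Hypothesis hprior : P (theta @^-1` [set true]) = p%:E.

Implicit Types (s t : R).
Local Notation X := (signal alpha sigma theta W).
Local Notation FX := (natural_filtration X).
Local Notation Th i := (theta @^-1` [set i]).

(** Prior log-odds plus the log-likelihood ratio at [x] of the normal laws of variance
    [sigma ^+ 2 * t] with means [alpha * t] and [0]. *)
Definition logodds (t x : R) : R :=
  ln (p / (1 - p)) + alpha / sigma ^+ 2 * x - alpha ^+ 2 / (2 * sigma ^+ 2) * t.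

Lemma measurable_logodds t : measurable_fun setT (logodds t).
Proof.
apply: measurable_funB => //; apply: measurable_funD => //.
Qed.

Lemma measurable_expR_logodds t : measurable_fun setT (expR \o logodds t).
Proof. by apply: measurableT_comp => //; exact: measurable_logodds. Qed.

(* As [logodds] includes the prior odds, this is Bayes' formula on [E], tested
   against functions of the current signal. *)
Definition bayes_on (t : R) (E : set T) : Prop :=
  forall h : R -> \bar R, measurable_fun setT h -> (forall x, 0 <= h x)%E ->
  (\int[P]_(w in E `&` Th true) h (X t w) =
   \int[P]_(w in E `&` Th false) ((expR (logodds t (X t w)))%:E * h (X t w)))%E.

Lemma prior_false : P (Th false) = (1 - p)%:E.
Proof.
rewrite -[Th false](_ : ~` Th true = _); last first.
  by apply/seteqP; split => w /=; case: (theta w).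
by rewrite probability_setC ?hprior//; exact: measurable_Th.
Qed.

(** The signal vanishes almost surely at time 0, so only the prior remains: [p] is the prior odds
    times [1 - p]. *)
Lemma bayes_on_start : bayes_on 0 setT.
Proof.
have [p0 p1] := andP hp.
move=> h mh h0; have [_ W0 _ _ _] := hW.
have mX0 : measurable_fun setT (X 0) by exact: (measurable_signal _ _ _ hF hW).
have X0 : {ae P, forall w, X 0 w = 0}.
  by apply: filterS W0 => w; rewrite /signal mulr0 add0r => ->; rewrite mulr0.
rewrite !setTI.
transitivity (\int[P]_(w in Th true) cst (h 0%R) w)%E.
  apply: ge0_ae_eq_integral => //=; first exact: measurable_Th.
    by apply: measurable_funTS; exact: measurableT_comp.
  by apply: filterS X0 => w -> _.
transitivity (\int[P]_(w in Th false) cst ((expR (logodds 0 0))%:E * h 0%R)%E w)%E;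
    last first.
  apply: ge0_ae_eq_integral => //=; first exact: measurable_Th.
  - apply: emeasurable_funM; last by apply: measurable_funTS; exact: measurableT_comp.
    apply/measurable_EFinP; apply: measurable_funTS.
    exact: (measurableT_comp (measurable_expR_logodds 0) mX0).
  - by move=> w _; rewrite mule_ge0// lee_fin expR_ge0.
  - by move=> w _; rewrite mule_ge0// lee_fin expR_ge0.
  - by apply: filterS X0 => w -> _.
rewrite !integral_cst; [|exact: measurable_Th..].
transitivity (h 0%R * p%:E)%E; first by congr (_ * _)%E.
transitivity ((expR (logodds 0 0))%:E * h 0%R * (1 - p)%:E)%E; last first.
  by congr (_ * _)%E; rewrite -prior_false.
rewrite muleAC -EFinM muleC; congr (_ * _)%E; congr (_%:E).
rewrite /logodds !mulr0 subr0 addr0 lnK; last by rewrite posrE divr_gt0// subr_gt0.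
by rewrite divfK// subr_eq0 gt_eqF.
Qed.

(** Between [s] and [t] the signal drifts by [alpha * (t - s)] on [Th true] and not at all on
    [Th false]. Bayes' formula at [s] exchanges the two hypotheses for the past, the Gaussian shift
    exchanges them for the increment, and the two exponents add up to [logodds] at time [t]. *)
Lemma bayes_on_step s t E : 0 <= s -> s <= t -> FX s E ->
  bayes_on s E -> bayes_on t E.
Proof.
move=> s0; rewrite le_eqVlt => /predU1P[->//|st] FE bE h mh h0.
have t0 : 0 <= t by apply: ltW; exact: le_lt_trans s0 st.
have sg0 : sigma != 0 by rewrite gt_eqF.
set sd := Num.sqrt (t - s).
have sd2 : sd ^+ 2 = t - s by rewrite sqr_sqrtr// subr_ge0 ltW.
have sd0 : sd != 0 by rewrite gt_eqF// sqrtr_gt0 subr_gt0.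
have aff u v (k : R -> \bar R) : measurable_fun setT k ->
    measurable_fun setT (fun x : R => k (u * x + v)).
  by move=> mk; apply: (measurableT_comp mk);
    apply: measurable_funD => //; exact: measurable_funM.
pose k1 (z : R * R) := h (z.1 + alpha * (t - s) + sigma * z.2).
have mk1 : measurable_fun setT k1.
  apply: (measurableT_comp mh); apply: measurable_funD; last exact: measurable_funM.
  exact: measurable_funD.
pose k0 (z : R * R) := ((expR (logodds s z.1))%:E * h (z.1 + sigma * z.2)%R)%E.
have mk0 : measurable_fun setT k0.
  apply: emeasurable_funM.
    apply/measurable_EFinP.
    exact: (measurableT_comp (measurable_expR_logodds s)).
  by apply: (measurableT_comp mh); apply: measurable_funD => //; exact: measurable_funM.
have k00 z : (0 <= k0 z)%E by rewrite mule_ge0// lee_fin expR_ge0.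
(* Chosen so that [sigma * (b * sd ^+ 2) = alpha * (t - s)]: shifting the noise by [b * sd ^+ 2]
   adds exactly the drift. *)
pose b := alpha / sigma.
pose k2 (z : R * R) := ((expR (b * z.2 - b ^+ 2 * sd ^+ 2 / 2))%:E * k0 z)%E.
have mk2 : measurable_fun setT k2.
  apply: emeasurable_funM => //; apply/measurable_EFinP.
  apply: measurableT_comp => //; apply: measurable_funB => //.
  exact: measurable_funM.
have k20 z : (0 <= k2 z)%E by rewrite mule_ge0// lee_fin expR_ge0.
pose q z := (\int[P]_(w in E `&` Th false) k0 (X s w, z))%E.
have mq : measurable_fun setT q.
  apply: (@measurable_integral_section _ _ _ _ _ _ R P (E `&` Th false) (X s)) => //.
  - by apply: measurableI; [exact: (signal_filtration_measurable hF hW FE)|exact: measurable_Th].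
  - exact: (measurable_signal _ _ _ hF hW).
have q0 z : (0 <= q z)%E by apply: integral_ge0.
transitivity (\int[P]_(w in E `&` Th true) k1 (X s w, W t w - W s w)%R)%E.
  apply: eq_integral => w; rewrite inE => -[_ /= tw]; rewrite /k1/= /signal tw /=.
  by congr h; ring.
rewrite (integral_signal_increment hF hW hindep)//; last by move=> z; exact: h0.
transitivity (\int[normal_prob 0 sd]_y q (y + b * sd ^+ 2)%R)%E.
  apply: eq_integral => y _; rewrite /k1/= /q.
  under eq_integral do rewrite -addrA.
  rewrite (bE (fun x => h (x + (alpha * (t - s) + sigma * y))))//; last first.
    by apply: (measurableT_comp mh); exact: measurable_funD.
  apply: eq_integral => w _; rewrite /k0/=; congr (_ * h _)%E.
  by rewrite sd2 /b; field.
rewrite normal_prob_shift//.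
transitivity (\int[P]_(w in E `&` Th false) k2 (X s w, W t w - W s w)%R)%E.
  rewrite (integral_signal_increment hF hW hindep)//.
  apply: eq_integral => y _; rewrite /k2/= /q.
  rewrite ge0_integralZl_EFin//.
  - by apply: measurableI; [exact: (signal_filtration_measurable hF hW FE)|exact: measurable_Th].
  - apply: measurable_funTS; apply: (measurableT_comp mk0).
    by apply: measurable_fun_pair => //; exact: (measurable_signal _ _ _ hF hW).
apply: eq_integral => w; rewrite inE => -[_ /= tw]; rewrite /k2/k0/= /signal tw /=.
rewrite muleA -EFinM -expRD; congr ((expR _)%:E * h _)%E.
- by rewrite /logodds sd2 /b; field.
- by ring.
Qed.

End bayes_formula.

(** * Bayes' formula on the whole signal filtration *)

Section bayes_filtration.
Context d (T : measurableType d) (R : realType) (P : probability T R).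
Context (alpha sigma p : R) (F : R -> set (set T)) (W : R -> T -> R).
Context (theta : {RV P >-> bool}).
Hypotheses (hsigma : 0 < sigma) (hp : 0 < p < 1).
Hypotheses (hF : filtration F) (hW : brownian_motion P F W).
Hypothesis hindep : independent P (sigma_fun theta) (sigma_process `[0, +oo[ W).
Hypothesis hprior : P (theta @^-1` [set true]) = p%:E.

Implicit Types (s t : R).
Local Notation X := (signal alpha sigma theta W).
Local Notation FX := (natural_filtration X).
Local Notation Th i := (theta @^-1` [set i]).
Local Notation bayes_on := (bayes_on alpha sigma p W theta).
Local Notation L := (logodds alpha sigma p).

(** Each pair is a time with a constraint. Any order and repetitions are allowed, so intersection is
    concatenation and the cylinders form a pi-system. *)
Definition cylinder (Y : R -> T -> R) (l : seq (R * set R)) : set T :=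
  [set w | forall x, x \in l -> x.2 (Y x.1 w)].

Definition cylinder_upto (t : R) (l : seq (R * set R)) : Prop :=
  forall x, x \in l -> 0 <= x.1 <= t /\ measurable x.2.

Lemma cylinder_nil Y : cylinder Y [::] = setT.
Proof. by apply/seteqP; split => w. Qed.

Lemma cylinder_cons Y x l : cylinder Y (x :: l) = cylinder Y l `&` Y x.1 @^-1` x.2.
Proof.
apply/seteqP; split => w; rewrite /cylinder/=.
  by move=> H; split => [y yl|]; apply: H; rewrite inE ?yl ?orbT// eqxx.
by move=> [Hl Hx] y; rewrite inE => /predU1P[->//|]; exact: Hl.
Qed.

Lemma cylinder_cat Y l1 l2 : cylinder Y (l1 ++ l2) = cylinder Y l1 `&` cylinder Y l2.
Proof.
apply/seteqP; split => w; rewrite /cylinder/=.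
  by move=> H; split => y yl; apply: H; rewrite mem_cat yl ?orbT.
by move=> [H1 H2] y; rewrite mem_cat => /orP[/H1|/H2].
Qed.

Lemma cylinder_natural_filtration Y t l : cylinder_upto t l ->
  natural_filtration Y t (cylinder Y l).
Proof.
elim: l => [_|x l IHl lt].
  rewrite cylinder_nil.
  exact: (@measurableT _ (g_sigma_algebraType (\bigcup_(s in `[0, t]) sigma_fun (Y s)))).
rewrite cylinder_cons; apply: sigma_processI.
  by apply: IHl => y yl; apply: lt; rewrite inE yl orbT.
have [x0 mx] := lt x (mem_head _ _).
by apply: sigma_process_preimage => //=; rewrite in_itv.
Qed.

(** A constraint on the current signal is absorbed by the test function: [h] is replaced by its
    restriction to [C]. *)
Lemma bayes_onI t E C : 0 <= t -> bayes_on t E -> measurable E -> measurable C ->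
  bayes_on t (E `&` X t @^-1` C).
Proof.
move=> t0 bE mE mC h mh h0.
have mk : measurable_fun setT (h \_ C) by exact/(measurable_restrictT _ _).1/measurable_funTS.
have k0 x : (0 <= (h \_ C) x)%E by apply: erestrict_ge0.
have := bE _ mk k0.
have patchE (G : set T) (f : R -> \bar R) : (\int[P]_(w in G) (f \_ C) (X t w) =
    \int[P]_(w in G `&` X t @^-1` C) f (X t w))%E.
  rewrite integral_mkcondr; apply: eq_integral => w _.
  rewrite /patch; have [wC|wC] := boolP (X t w \in C).
    by rewrite (_ : (w \in _) = true)//; move: wC; rewrite !inE.
  by rewrite (_ : (w \in _) = false)//; apply/negbTE; move: wC; rewrite !notin_setE.
rewrite patchE setIAC => ->.
transitivity (\int[P]_(w in E `&` Th false)
    ((fun x => (expR (L t x))%:E * h x)%E \_ C) (X t w))%E.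
  by apply: eq_integral => w _; rewrite /patch; case: ifP => // _; rewrite mule0.
by rewrite patchE setIAC.
Qed.

(* Markov property: the times are visited in increasing order. *)
Lemma bayes_on_sorted_cylinder t l : 0 <= t -> cylinder_upto t l ->
  sorted (fun x y : R * set R => y.1 <= x.1) l -> bayes_on t (cylinder X l).
Proof.
elim: l t => [|x l IHl] t t0 lt.
  move=> _; rewrite cylinder_nil; apply: (bayes_on_step hsigma hF hW hindep (lexx _) t0).
    exact: (@measurableT _ (g_sigma_algebraType (\bigcup_(s in `[0, 0]) sigma_fun (X s)))).
  exact: (bayes_on_start _ _ hp hF hW hprior).
have [/andP[x0 xt] mx] := lt x (mem_head _ _).
(* The list is sorted by decreasing time: its head is the latest observation, and its tail is a
   cylinder up to [x.1]. *)
rewrite /= path_sortedE; last by move=> a b c ba cb; exact: le_trans cb ba.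
move=> /andP[/allP lx sl].
have lx1 : cylinder_upto x.1 l.
  move=> y yl; have [|/andP[y0 _] my] := lt y; first by rewrite inE yl orbT.
  by rewrite y0 lx.
have Fl := cylinder_natural_filtration (Y := X) lx1.
rewrite cylinder_cons; apply: (bayes_on_step hsigma hF hW hindep x0 xt).
  by apply: sigma_processI => //; apply: sigma_process_preimage => //=; rewrite in_itv/= x0 lexx.
apply: bayes_onI => //; first exact: IHl.
exact: (signal_filtration_measurable hF hW Fl).
Qed.

Lemma bayes_on_cylinder t l : 0 <= t -> cylinder_upto t l -> bayes_on t (cylinder X l).
Proof.
move=> t0 lt; pose r := fun x y : R * set R => y.1 <= x.1.
rewrite (_ : cylinder X l = cylinder X (sort r l)); last first.
  by apply/seteqP; split => w H x; move: (H x); rewrite mem_sort.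
apply: bayes_on_sorted_cylinder => //.
  by move=> x; rewrite mem_sort; exact: lt.
by apply: sort_sorted => x y; exact: le_total.
Qed.

(** For [h = 1] both sides are measures in [A], finite and equal on the pi-system of cylinders,
    hence equal on the sigma-algebra it generates. A general [h] follows by [change_of_measure],
    since [A] may be cut by any event of [X t]. *)
Lemma bayes_on_filtration t A : 0 <= t -> FX t A -> bayes_on t A.
Proof.
move=> t0 FA.
have FXm := signal_filtration_measurable hF hW
  (alpha := alpha) (sigma := sigma) (theta := theta).
have mX := measurable_signal alpha sigma theta hF hW t0.
have mf : measurable_fun setT (fun w => expR (L t (X t w))).
  exact: (measurableT_comp (measurable_expR_logodds alpha sigma p t) mX).
have f0 w : 0 <= expR (L t (X t w)) by exact: expR_ge0.
suff E B : FX t B -> P (B `&` Th true) =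
    (\int[P]_(w in B `&` Th false) (expR (L t (X t w)))%:E)%E.
  move=> h mh h0.
  apply: (@change_of_measure _ _ _ T T _ R P P (A `&` Th true) (A `&` Th false) _ _
    (X t) (X t) (fun w => expR (L t (X t w)))) => //.
  - by apply: measurableI; [exact: FXm FA|exact: measurable_Th].
  - by apply: measurableI; [exact: FXm FA|exact: measurable_Th].
  move=> C mC; rewrite setIAC [in RHS]setIAC; apply: E.
  apply: sigma_processI => //.
  by apply: sigma_process_preimage => //=; rewrite in_itv/= t0 lexx.
move=> FB; pose G := [set E | exists2 l, cylinder_upto t l & E = cylinder X l].
have mTh i : measurable (Th i) by exact: measurable_Th.
have GFX : G `<=` FX t by move=> _ [l lt ->]; exact: cylinder_natural_filtration.
have FXG : FX t `<=` <<s G >>.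
  apply: sub_sigma_algebra2 => _ [s st [C mC <-]].
  exists [:: (s, C)]; last by rewrite cylinder_cons cylinder_nil !setTI.
  by move=> x; rewrite inE => /eqP ->.
have := @g_sigma_algebra_measure_unique _ R T G (fun E GE => FXm t E (GFX E GE)) (fun=> setT).
move=> /(_ _ _ (mrestr P (mTh true)) (density_on P (mTh false) mf f0)).
apply => //.
- by move=> _; exists [::] => //; rewrite cylinder_nil.
- by apply/seteqP; split => // w _; exists 0%N.
- move=> _ _ [l1 l1t ->] [l2 l2t ->]; exists (l1 ++ l2); last by rewrite cylinder_cat.
  by move=> x; rewrite mem_cat => /orP[/l1t|/l2t].
- move=> _ [l lt ->]; rewrite /mrestr /density_on.
  have := bayes_on_cylinder t0 lt (measurable_cst 1%E) (fun=> lee01).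
  rewrite integral_cst ?mul1e; last first.
    by apply: measurableI => //; apply: (FXm t); exact: cylinder_natural_filtration.
  by move=> h; apply: (etrans h); apply: eq_integral => w _; rewrite mule1.
- move=> _; have E : P (setT `&` Th true) = p%:E by rewrite setTI.
  by apply: (@le_lt_trans _ _ p%:E); [rewrite -E|exact: ltry].
- exact: FXG.
Qed.

End bayes_filtration.

Section real_integrals.
Context d (T : measurableType d) (R : realType) (P : {measure set T -> \bar R}).
Implicit Types (f g : T -> R) (D : set T).

(** Valid without integrability, the integral being by definition the difference of the integrals of
    the positive and negative parts. *)
Lemma integral_max_sub D f :
  (\int[P]_(x in D) (f x)%:E = \int[P]_(x in D) (Num.max (f x) 0)%:E -
   \int[P]_(x in D) (Num.max (- f x) 0)%:E)%E.
Proof.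
rewrite integralE; congr (_ - _)%E; apply: eq_integral => x _.
  by rewrite funeposE EFin_max.
by rewrite funenegE -EFinN EFin_max.
Qed.

Lemma integrable_mul_bounded D f g M : measurable D -> measurable_fun D g ->
  (forall x, `|g x| <= M) -> P.-integrable D (EFin \o f) ->
  P.-integrable D (fun x => (g x * f x)%:E).
Proof.
move=> mD mg gM fi.
have mf : measurable_fun D f by apply/measurable_EFinP; exact: measurable_int fi.
apply: (@le_integrable _ _ _ P D mD _ (fun x => M%:E * (f x)%:E)%E).
- by apply/measurable_EFinP; exact: measurable_funM.
- move=> x _; rewrite -EFinM !abse_EFin lee_fin !normrM.
  by apply: ler_wpM2r => //; apply: le_trans (gM x) (ler_norm _).
- exact: integrableZl.
Qed.

End real_integrals.

(** * Conditional means given the signal *)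

Section martingales.
Context d (T : measurableType d) (R : realType) (P : probability T R).
Context (alpha sigma p : R) (F : R -> set (set T)) (W : R -> T -> R).
Context (theta : {RV P >-> bool}).
Hypotheses (hsigma : 0 < sigma) (hp : 0 < p < 1).
Hypotheses (hF : filtration F) (hW : brownian_motion P F W).
Hypothesis hindep : independent P (sigma_fun theta) (sigma_process `[0, +oo[ W).
Hypothesis hprior : P (theta @^-1` [set true]) = p%:E.
Implicit Types (s t : R) (A : set T) (i : bool).

Local Notation X := (signal alpha sigma theta W).
Local Notation FX := (natural_filtration X).
Local Notation Th i := (theta @^-1` [set i]).
Local Notation L := (logodds alpha sigma p).

Definition post t w : R := logistic (L t (X t w)).

Lemma measurable_logodds_signal t : 0 <= t ->
  measurable_fun setT (fun w => L t (X t w)).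
Proof.
move=> t0; apply: (measurableT_comp (measurable_logodds alpha sigma p t)).
exact: (measurable_signal _ _ _ hF hW).
Qed.

Lemma measurable_logistic : measurable_fun setT (@logistic R).
Proof. by apply: continuous_measurable_fun; exact: continuous_logistic. Qed.

Lemma measurable_post t : 0 <= t -> measurable_fun setT (post t).
Proof.
by move=> t0; exact: (measurableT_comp measurable_logistic (measurable_logodds_signal t0)).
Qed.

Lemma post_itv t w : 0 < post t w < 1.
Proof. exact: logistic_itv. Qed.

Lemma integral_split_theta A (f : T -> \bar R) : measurable A -> measurable_fun setT f ->
  (\int[P]_(w in A) f w =
   \int[P]_(w in A `&` Th true) f w + \int[P]_(w in A `&` Th false) f w)%E.
Proof.
move=> mA mf; rewrite -integral_setU.
- congr (integral _ _ _); rewrite -setIUr [X in _ `&` X](_ : _ = setT) ?setIT//.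
  by apply/seteqP; split => w //= _; case: (theta w); [left|right].
- by apply: measurableI => //; exact: measurable_Th.
- by apply: measurableI => //; exact: measurable_Th.
- exact: measurable_funTS.
- rewrite disj_set2E; apply/eqP/seteqP; split => w //= [[_ ->] []].
  by [].
Qed.

(** Bayes' formula tested against [(1 - post) * r]: by [expR_onem_logistic] the likelihood ratio
    times [1 - post] is [post]. Splitting [r] into its positive and negative parts removes the sign
    restriction. *)
Lemma integral_bayes t A (r : R -> R) : 0 <= t -> FX t A -> measurable_fun setT r ->
  (\int[P]_(w in A `&` Th true) ((1 - post t w) * r (X t w))%:E =
   \int[P]_(w in A `&` Th false) (post t w * r (X t w))%:E)%E.
Proof.
move=> t0 FA mr.
have B (q : R -> R) : measurable_fun setT q -> (forall x, 0 <= q x) ->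
  (\int[P]_(w in A `&` Th true) ((1 - post t w) * q (X t w))%:E =
   \int[P]_(w in A `&` Th false) (post t w * q (X t w))%:E)%E.
  move=> mq q0.
  rewrite (bayes_on_filtration hsigma hp hF hW hindep hprior t0 FA
    (h := fun x => ((1 - logistic (L t x)) * q x)%:E)).
  - apply: eq_integral => w _; rewrite -EFinM mulrA; congr ((_ * _)%:E).
    exact: expR_onem_logistic.
  - apply/measurable_EFinP; apply: measurable_funM => //; apply: measurable_funB => //.
    exact: (measurableT_comp measurable_logistic (measurable_logodds alpha sigma p t)).
  - move=> x; rewrite lee_fin mulr_ge0// subr_ge0.
    by case/andP: (logistic_itv (L t x)) => _ /ltW.
have maxM (u v : R) : 0 <= u -> Num.max (u * v) 0 = u * Num.max v 0.
  by move=> u0; rewrite maxr_pMr// mulr0.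
rewrite integral_max_sub [RHS]integral_max_sub.
under eq_integral.
  move=> w _; rewrite maxM; last by rewrite subr_ge0; case/andP: (post_itv t w) => _ /ltW.
  over.
under [X in (_ - X = _)%E]eq_integral.
  move=> w _; rewrite -mulrN maxM; last by rewrite subr_ge0; case/andP: (post_itv t w) => _ /ltW.
  over.
under [X in (_ = X - _)%E]eq_integral.
  move=> w _; rewrite maxM; last by case/andP: (post_itv t w) => /ltW.
  over.
under [X in (_ = _ - X)%E]eq_integral.
  move=> w _; rewrite -mulrN maxM; last by case/andP: (post_itv t w) => /ltW.
  over.
rewrite (B (fun x => Num.max (r x) 0)) ?(B (fun x => Num.max (- r x) 0))//.
- by apply: measurable_maxr => //; exact: measurableT_comp.
- by move=> x; rewrite le_max lexx orbT.
- exact: measurable_maxr.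
- by move=> x; rewrite le_max lexx orbT.
Qed.

(** The contributions of [Th true] and [Th false] are opposite by [integral_bayes], so [post t] is
    the conditional mean of [theta]. The weight [r] is allowed to be unbounded because it will be
    affine in the log-odds. *)
Lemma integral_post_sub_theta t A (r : R -> R) : 0 <= t -> FX t A ->
  measurable_fun setT r -> P.-integrable setT (fun w => (r (X t w))%:E) ->
  (\int[P]_(w in A) ((post t w - (theta w)%:R) * r (X t w))%:E = 0)%E.
Proof.
move=> t0 FA mr ri.
have mA : measurable A by exact: (signal_filtration_measurable hF hW FA).
have mX := measurable_signal alpha sigma theta hF hW t0.
have mrX : measurable_fun setT (fun w => r (X t w)) by exact: (measurableT_comp mr mX).
have mD i : measurable (A `&` Th i) by apply: measurableI => //; exact: measurable_Th.
rewrite integral_split_theta//; last first.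
  apply/measurable_EFinP; apply: measurable_funM => //; apply: measurable_funB.
    exact: measurable_post.
  exact: measurable_theta.
have bnd w : `|1 - post t w| <= 1.
  by have /andP[? ?] := post_itv t w; rewrite ger0_norm ?subr_ge0 ?gerBl ltW.
have iP : P.-integrable (A `&` Th true) (fun w => ((1 - post t w) * r (X t w))%:E).
  apply: (integrable_mul_bounded (M := 1)) => //.
    by apply: measurable_funTS; apply: measurable_funB => //; exact: measurable_post.
  exact: (integrableS measurableT (mD true) (@subsetT _ _) ri).
have -> : (\int[P]_(w in A `&` Th true) ((post t w - (theta w)%:R) * r (X t w))%:E =
    - \int[P]_(w in A `&` Th true) ((1 - post t w) * r (X t w))%:E)%E.
  rewrite -integralN; last exact: integrable_add_def iP.
  apply: eq_integral => w; rewrite inE => -[_ /= ->].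
  by rewrite -mulNr opprB.
have -> : (\int[P]_(w in A `&` Th false) ((post t w - (theta w)%:R) * r (X t w))%:E =
    \int[P]_(w in A `&` Th true) ((1 - post t w) * r (X t w))%:E)%E.
  rewrite integral_bayes//; apply: eq_integral => w; rewrite inE => -[_ /= ->].
  by rewrite subr0.
by rewrite addeC subee//; exact: integrable_fin_num iP.
Qed.

Lemma ge0_integral_brownian_increment s t (h : R -> \bar R) : 0 <= s -> s < t ->
  measurable_fun setT h -> (forall x, 0 <= h x)%E ->
  (\int[P]_w h (W t w - W s w)%R = \int[normal_prob 0 (Num.sqrt (t - s))]_y h y)%E.
Proof.
move=> s0 st mh h0; have t0 : 0 <= t by apply: ltW; exact: le_lt_trans s0 st.
have [_ _ _ _ nW] := hW; set N := normal_prob _ _.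
transitivity (\int[N]_y (1%:E * h y))%E; last by apply: eq_integral => y _; rewrite mul1e.
apply: (@change_of_measure _ _ _ _ _ _ _ P N setT setT measurableT
    measurableT (fun w => W t w - W s w) id (fun=> 1) _ _ _ _ _ h mh h0) => //.
  by apply: measurable_funB; exact: (measurable_brownian hF hW).
by move=> C mC; rewrite !setTI integral_cst// mul1e; exact: nW.
Qed.

Lemma integrable_brownian_increment s t : 0 <= s -> s < t ->
  P.-integrable setT (fun w => (W t w - W s w)%:E).
Proof.
move=> s0 st; have t0 : 0 <= t by apply: ltW; exact: le_lt_trans s0 st.
have sd0 : Num.sqrt (t - s) != 0 by rewrite gt_eqF// sqrtr_gt0 subr_gt0.
apply/integrableP; split.
  by apply/measurable_EFinP; apply: measurable_funB; exact: (measurable_brownian hF hW).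
rewrite (ge0_integral_brownian_increment (h := fun y => `|y%:E|%E))//; last first.
  by apply: measurableT_comp => //; exact/measurable_EFinP.
by have /integrableP[] := integrable_normal_prob_id sd0.
Qed.

Lemma integrable_brownian t : 0 <= t -> P.-integrable setT (fun w => (W t w)%:E).
Proof.
move=> t0; have [_ W0 _ _ _] := hW.
have mW u : 0 <= u -> measurable_fun setT (fun w => (W u w)%:E).
  by move=> u0; apply/measurable_EFinP; exact: (measurable_brownian hF hW).
apply/integrableP; split; first exact: mW.
move: (t0); rewrite le_eqVlt => /predU1P[<-|t_gt0].
  rewrite (_ : (\int[P]_x _)%E = 0%E)//.
  rewrite (ge0_ae_eq_integral (g := cst 0%E)) ?integral0//.
  - by apply: measurableT_comp => //; exact: mW.
  - by apply: filterS W0 => w -> _; rewrite /= normr0.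
have /integrableP[_] := integrable_brownian_increment (lexx 0) t_gt0.
congr (_ < _)%E; apply: ge0_ae_eq_integral => //.
- apply: measurableT_comp => //; apply/measurable_EFinP.
  by apply: measurable_funB; exact: (measurable_brownian hF hW).
- by apply: measurableT_comp => //; exact: mW.
- by apply: filterS W0 => w -> _; rewrite subr0.
Qed.

Lemma integrable_logodds t : 0 <= t ->
  P.-integrable setT (fun w => (L t (X t w))%:E).
Proof.
move=> t0.
have mth := measurable_theta theta.
pose k := alpha / sigma ^+ 2.
pose u w := ln (p / (1 - p)) - alpha ^+ 2 / (2 * sigma ^+ 2) * t +
  k * alpha * t * (theta w)%:R.
have ui : P.-integrable setT (EFin \o u).
  apply: (@le_integrable _ _ _ P setT measurableT _
    (cst (`|ln (p / (1 - p)) - alpha ^+ 2 / (2 * sigma ^+ 2) * t| + `|k * alpha * t|)%:E)).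
  - apply/measurable_EFinP; apply: measurable_funD => //; exact: measurable_funM.
  - move=> w _; rewrite !abse_EFin lee_fin [leRHS]ger0_norm ?addr_ge0//.
    apply: (le_trans (ler_normD _ _)); rewrite lerD2l normrM ler_piMr//.
    by case: (theta w); rewrite ?normr1 ?normr0.
  - exact: finite_measure_integrable_cst.
have := integrableD measurableT ui (integrableZl measurableT (k * sigma) (integrable_brownian t0)).
apply: eq_integrable => // w _; rewrite /= -EFinM -EFinD; congr EFin.
by rewrite /u /logodds /logodds /signal /k; ring.
Qed.

(** The increment is independent of the event and has a symmetric law, so its positive and negative
    parts have the same finite integral. *)
Lemma integral_brownian_increment s t A i : 0 <= s -> s < t -> FX s A ->
  (\int[P]_(w in A `&` Th i) (W t w - W s w)%:E = 0)%E.
Proof.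
move=> s0 st FA.
have sd0 : Num.sqrt (t - s) != 0 by rewrite gt_eqF// sqrtr_gt0 subr_gt0.
have mD : measurable (A `&` Th i).
  by apply: measurableI; [exact: (signal_filtration_measurable hF hW FA)|exact: measurable_Th].
have fin := integrableS measurableT mD (@subsetT _ _) (integrable_brownian_increment s0 st).
have mmax : measurable_fun setT (fun y : R => (Num.max y 0)%:E).
  by apply/measurable_EFinP; exact: measurable_maxr.
have mmaxN : measurable_fun setT (fun y : R => (Num.max (- y) 0)%:E).
  by apply/measurable_EFinP; apply: measurable_maxr => //; exact: measurableT_comp.
have max0 (y : R) : (0 <= (Num.max y 0)%:E)%E by rewrite lee_fin le_max lexx orbT.
have H (h : R -> \bar R) : measurable_fun setT h -> (forall y, 0 <= h y)%E ->
    (\int[P]_(w in A `&` Th i) h (W t w - W s w)%R =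
    \int[normal_prob 0 (Num.sqrt (t - s))]_y (P (A `&` Th i) * h y))%E.
  move=> mh h0.
  rewrite (integral_signal_increment hF hW hindep i (h := fun z => h z.2) s0 st FA)//.
    by apply: eq_integral => y _; rewrite /= integral_cst// muleC.
  exact: (measurableT_comp mh).
have E : (\int[P]_(w in A `&` Th i) (Num.max (- (W t w - W s w)) 0)%:E =
    \int[P]_(w in A `&` Th i) (Num.max (W t w - W s w) 0)%:E)%E.
  rewrite (H (fun y => (Num.max (- y) 0)%:E))// (H (fun y => (Num.max y 0)%:E))//.
  rewrite !ge0_integralZl//; congr (_ * _)%E.
  exact: (@ge0_integral_normal_prob_opp R _ (fun y => (Num.max y 0)%:E)).
rewrite integral_max_sub E subee//.
rewrite (_ : (\int[P]_(x in _) _)%E =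
    (\int[P]_(w in A `&` Th i) (fun w => (W t w - W s w)%:E)^\+ w)%E).
  exact: integrable_pos_fin_num fin.
by apply: eq_integral => w _; rewrite funeposE EFin_max.
Qed.

End martingales.

(** * Identification of [Pi] with the explicit posterior *)

Section identification.
Context d (T : measurableType d) (R : realType) (P : probability T R).
Context (alpha sigma p : R) (F : R -> set (set T)) (W : R -> T -> R).
Context (theta : {RV P >-> bool}).
Hypotheses (hsigma : 0 < sigma) (hp : 0 < p < 1).
Hypotheses (hF : filtration F) (hW : brownian_motion P F W).
Hypothesis hindep : independent P (sigma_fun theta) (sigma_process `[0, +oo[ W).
Hypothesis hprior : P (theta @^-1` [set true]) = p%:E.
Context (Pi : R -> T -> R).
Hypothesis hPi : posterior_process P theta (signal alpha sigma theta W) Pi.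
Implicit Types (s t : R) (A : set T) (i : bool).

Local Notation X := (signal alpha sigma theta W).
Local Notation FX := (natural_filtration X).
Local Notation FPi := (natural_filtration Pi).
Local Notation Th i := (theta @^-1` [set i]).
Local Notation Post := (post alpha sigma p W theta).

(** The event [g < f] lies in [FX t], and on it the positive function [f - g] has integral zero.
    Used in both directions, this gives almost sure uniqueness of the conditional probability. *)
Lemma integral_le_of_filtration t (f g : T -> R) M : 0 <= t ->
  measurable_fun [set: g_sigma_algebraType (\bigcup_(s in `[0, t]) sigma_fun (X s))] f ->
  measurable_fun [set: g_sigma_algebraType (\bigcup_(s in `[0, t]) sigma_fun (X s))] g ->
  (forall w, 0 <= f w <= M) -> (forall w, 0 <= g w <= M) ->
  (forall A, FX t A -> \int[P]_(w in A) (f w)%:E = \int[P]_(w in A) (g w)%:E)%E ->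
  {ae P, forall w, f w <= g w}.
Proof.
move=> t0 mf mg fM gM fg.
have mFX B : FX t B -> measurable B by exact: (signal_filtration_measurable hF hW).
have lift (h : T -> R) :
    measurable_fun [set: g_sigma_algebraType (\bigcup_(s in `[0, t]) sigma_fun (X s))] h ->
    measurable_fun setT h.
  by move=> mh _ B mB; apply: mFX; exact: mh.
have int (h : T -> R) A : measurable_fun setT h -> (forall w, 0 <= h w <= M) ->
    measurable A -> P.-integrable A (EFin \o h).
  move=> mh hM mA; apply: measurable_bounded_integrable => //.
  - by rewrite (le_lt_trans (probability_le1 P mA))// ltry.
  - exact: measurable_funTS.
  - exists M; split => [|x Mx]; first exact: num_real.
    move=> w _ /=.
    by have /andP[h0 hM'] := hM w; rewrite ger0_norm// (le_trans hM')// ltW.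
pose A := [set w | g w < f w].
have FA : FX t A.
  have mtrue : measurable [set true] by [].
  have := measurable_fun_ltr mg mf measurableT mtrue.
  by rewrite setTI; congr (FX t _); apply/seteqP; split => w.
have mA := mFX _ FA.
have fi := int f A (lift _ mf) fM mA; have gi := int g A (lift _ mg) gM mA.
have E0 : (\int[P]_(w in A) `|(f w - g w)%:E| = 0)%E.
  under eq_integral => w wA.
    rewrite gee0_abs; last by move: wA; rewrite inE /A/= lee_fin subr_ge0 => /ltW.
    over.
  rewrite integralB_EFin// fg// subee//; exact: integrable_fin_num gi.
have mfg : measurable_fun A (fun w => (f w - g w)%:E).
  by apply/measurable_EFinP; apply: measurable_funB; apply: measurable_funTS; exact: lift.
have := (ae_eq_integral_abs P mA mfg).1 E0.
apply: filterS => w /= H; rewrite leNgt; apply/negP => gf.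
by have /= [] := H gf; move/eqP; rewrite subr_eq0 gt_eqF.
Qed.

Lemma Pi_sub_filtration t : 0 <= t -> FPi t `<=` FX t.
Proof.
move=> t0; have [cP _ _] := hPi; apply: sigma_process_min.
  exact: smallest_sigma_algebra.
move=> s /=; rewrite in_itv/= => /andP[s0 st] A sA.
apply: (natural_filtration_mono st); by have [sub _] := cP s s0; exact: sub.
Qed.

Lemma measurable_Pi t : 0 <= t -> measurable_fun setT (Pi t).
Proof.
move=> t0 _ B mB; apply: (signal_filtration_measurable hF hW (t := t)).
by have [cP _ _] := hPi; have [sub _] := cP t t0; apply: sub; exists B.
Qed.

Lemma Pi_ae_post t : 0 <= t -> {ae P, forall w, Pi t w = Post t w}.
Proof.
move=> t0; have [cP _ P01] := hPi; have [sP iP] := cP t t0.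
have mPi :
    measurable_fun [set: g_sigma_algebraType (\bigcup_(s in `[0, t]) sigma_fun (X s))] (Pi t).
  by move=> _ B mB; apply: sP; exists B.
have mpost :
    measurable_fun [set: g_sigma_algebraType (\bigcup_(s in `[0, t]) sigma_fun (X s))] (Post t).
  have mX :
      measurable_fun [set: g_sigma_algebraType (\bigcup_(s in `[0, t]) sigma_fun (X s))] (X t).
    by apply: sigma_process_measurable_fun; rewrite /= in_itv/= t0 lexx.
  have ml := measurableT_comp (measurable_logodds alpha sigma p t) mX.
  exact: (measurableT_comp (@measurable_logistic R) ml).
have post01 w : 0 <= Post t w <= 1.
  by have /andP[/ltW -> /ltW ->] := post_itv alpha sigma p W theta t w.
have Pi01 w : 0 <= Pi t w <= 1 by exact: P01.
have ip A : FX t A -> (\int[P]_(w in A) (Post t w)%:E = P (A `&` Th true))%E.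
  move=> FA; have mA := signal_filtration_measurable hF hW FA.
  have mth := measurable_theta theta.
  (* With [r = 1], [Post t] and [theta] have the same integral over [A], which is the property
     defining [Pi t]. *)
  have := integral_post_sub_theta hsigma hp hF hW hindep hprior (r := cst 1) t0 FA
    (measurable_cst _) (finite_measure_integrable_cst P 1 measurableT).
  under eq_integral do rewrite /= mulr1.
  have i1 : P.-integrable A (EFin \o Post t).
    apply: measurable_bounded_integrable => //.
    - by rewrite (le_lt_trans (probability_le1 P mA))// ltry.
    - by apply: measurable_funTS; exact: (measurable_post alpha sigma p theta hF hW t0).
    - exists 1; split => [|x x1]; first exact: num_real.
      move=> w _ /=; have /andP[? ?] := post01 w.
      by rewrite ger0_norm// (le_trans _ (ltW x1)).
  have i2 : P.-integrable A (EFin \o (fun w => (theta w)%:R : R)).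
    apply: measurable_bounded_integrable => //.
    - by rewrite (le_lt_trans (probability_le1 P mA))// ltry.
    - exact: measurable_funTS.
    - exists 1; split => [|x x1]; first exact: num_real.
      move=> w _ /=.
      by case: (theta w); rewrite ?normr1 ?normr0 (le_trans _ (ltW x1)).
  rewrite integralB_EFin// => /eqP; rewrite sube_eq; last 2 first.
  - exact: integrable_fin_num i1.
  - by rewrite fin_num_adde_defl//; exact: integrable_fin_num i2.
  rewrite add0e => /eqP ->.
  rewrite -[in RHS]setIC -integral_indic//; last exact: measurable_Th.
  apply: eq_integral => w _; rewrite indicE; congr ((nat_of_bool _)%:R%:E).
  by apply/idP/idP; rewrite inE.
have ipi A : FX t A -> (\int[P]_(w in A) (Pi t w)%:E = \int[P]_(w in A) (Post t w)%:E)%E.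
  by move=> FA; rewrite iP// ip.
have le1 := integral_le_of_filtration t0 mPi mpost Pi01 post01 ipi.
have le2 := integral_le_of_filtration t0 mpost mPi post01 Pi01 (fun A FA => esym (ipi A FA)).
by apply: filterS2 le1 le2 => w /= h1 h2; apply/eqP; rewrite eq_le h1 h2.
Qed.

End identification.

(** * Optional stopping along time grids *)

Section first_entry.
Context d (T : measurableType d) (R : realType).
Implicit Types (E : nat -> set T) (Y : R -> T -> R).

(* Only [E 0, ..., E N.-1] are examined; the value is [N] if none occurs. *)
Definition first_entry E (N : nat) (w : T) : nat :=
  find (fun j => `[< E j w >]) (iota 0 N).

Lemma first_entry_le E N w : (first_entry E N w <= N)%N.
Proof. by rewrite -[leqRHS](size_iota 0 N); exact: find_size. Qed.

Lemma first_entry_mem E N w : (first_entry E N w < N)%N -> E (first_entry E N w) w.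
Proof.
move=> kN; have h : has (fun j => `[< E j w >]) (iota 0 N).
  by rewrite has_find size_iota.
by have /asboolP := nth_find 0 h; rewrite nth_iota.
Qed.

Lemma first_entry_before E N w j : (j < first_entry E N w)%N -> ~ E j w.
Proof.
move=> jk; have jN : (j < N)%N by exact: leq_trans jk (first_entry_le _ _ _).
by have /asboolPn := negbT (before_find 0 jk); rewrite nth_iota.
Qed.

Let not_before E k : set T := [set w | forall j, (j < k)%N -> ~ E j w].

Let first_entry_eqE E N k : (k <= N)%N -> [set w | first_entry E N w = k] =
  not_before E k `&` (if (k < N)%N then E k else setT).
Proof.
move=> kN; apply/seteqP; split => w /=.
  move=> <-; split; first by move=> j; exact: first_entry_before.
  by case: ifPn => // /first_entry_mem.
move=> [nb Ek]; have [kl|lk|//] := ltngtP (first_entry E N w) k.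
  have := first_entry_mem (leq_trans kl kN).
  by move/nb => /(_ kl).
case: ifPn Ek => [_|/negP nkN _]; first by move/(first_entry_before lk).
by case: nkN; exact: leq_trans lk (first_entry_le _ _ _).
Qed.

Variables (Y : R -> T -> R) (delta : R) (E : nat -> set T).
Hypothesis delta0 : 0 <= delta.
Hypothesis FE : forall j, natural_filtration Y (j%:R * delta) (E j).

Lemma natural_filtrationT t : natural_filtration Y t setT.
Proof.
exact: (@measurableT _ (g_sigma_algebraType (\bigcup_(s in `[0, t]) sigma_fun (Y s)))).
Qed.

(** The event is decided by [E 0], ..., [E k] at most. The process [Y] is left general because
    optional stopping uses the filtration of the signal, while admissibility of the exit time
    concerns that of [Pi]. *)
Lemma first_entry_filtration N k : (k <= N)%N ->
  natural_filtration Y (k%:R * delta) [set w | first_entry E N w = k].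
Proof.
have grid i j : (i <= j)%N -> i%:R * delta <= j%:R * delta.
  by move=> ij; rewrite ler_wpM2r// ler_nat.
have FB : natural_filtration Y (k%:R * delta) (not_before E k).
  elim: k => [|k IHk].
    rewrite (_ : not_before E 0 = setT); first exact: natural_filtrationT.
    by apply/seteqP; split.
  rewrite (_ : not_before E k.+1 = not_before E k `&` ~` E k).
    apply: sigma_processI; first exact: (natural_filtration_mono (grid _ _ (leqnSn k)) IHk).
    apply: sigma_processC; apply: (natural_filtration_mono (grid _ _ (leqnSn k))).
    exact: FE.
  apply/seteqP; split => w /=; rewrite /not_before/=.
    by move=> H; split => [j jk|]; apply: H => //; exact: leqW.
  by move=> [H1 H2] j; rewrite ltnS leq_eqVlt => /predU1P[->|/H1].
move=> kN; rewrite first_entry_eqE//; apply: sigma_processI => //.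
by case: ifP => _; [exact: FE|exact: natural_filtrationT].
Qed.

End first_entry.

Section optional_stopping.
Context d (T : measurableType d) (R : realType) (P : probability T R).
Context (alpha sigma p : R) (F : R -> set (set T)) (W : R -> T -> R).
Context (theta : {RV P >-> bool}).
Hypotheses (hsigma : 0 < sigma) (hp : 0 < p < 1).
Hypotheses (hF : filtration F) (hW : brownian_motion P F W).
Hypothesis hindep : independent P (sigma_fun theta) (sigma_process `[0, +oo[ W).
Hypothesis hprior : P (theta @^-1` [set true]) = p%:E.
Implicit Types (s t : R) (A : set T) (i : bool).

Local Notation X := (signal alpha sigma theta W).
Local Notation FX := (natural_filtration X).
Local Notation Th i := (theta @^-1` [set i]).
Local Notation L := (logodds alpha sigma p).
Local Notation Post := (post alpha sigma p W theta).

Context (c k b m : R).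
(** For [alpha != 0] this says [k = 2 * K^-1]. The drift of [k * ((1 - 2 * theta) * L)] is then
    exactly [- c], which compensates the running cost. *)
Hypothesis hk : k * alpha ^+ 2 = 2 * c * sigma ^+ 2.

(** Under [hk], the general solution on []0, 1[] of [a ^+ 2 * genA phi = - c] with
    [a = alpha / sigma]; [b] and [m] are the two free constants. *)
Definition Psi_affine (x : R) : R := k * Psi x + b + m * x.

Definition stopped_value t w : R := c * t + Psi_affine (Post t w).

(* The conditional expectation of [full_value t] given the signal up to [t] is
   [stopped_value t], since Psi (Post t) = (1 - 2 * Post t) * L t; the
   drift of (1 - 2 * theta) * L t is deterministic. *)
Definition full_value t w : R :=
  k * ((1 - 2 * (theta w)%:R) * L t (X t w)) + b + m * (theta w)%:R + c * t.

Lemma measurable_sign_theta : measurable_fun setT (fun w => 1 - 2 * (theta w)%:R : R).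
Proof.
by apply: measurable_funB => //; apply: measurable_funM => //; exact: measurable_theta.
Qed.

Lemma integrable_full_value t : 0 <= t -> P.-integrable setT (EFin \o full_value t).
Proof.
move=> t0; have mth := measurable_theta theta.
have i1 : P.-integrable setT
    (fun w => ((1 - 2 * (theta w)%:R) * L t (X t w))%:E).
  apply: (integrable_mul_bounded (M := 1)) => //.
  - exact: measurable_sign_theta.
  - by move=> w; case: (theta w) => /=; rewrite ler_norml; apply/andP; split; lra.
  - exact: (integrable_logodds alpha sigma p theta hF hW t0).
have i2 : P.-integrable setT (fun w => ((theta w)%:R * m)%:E).
  apply: (integrable_mul_bounded (M := 1)) => //.
  - by move=> w; case: (theta w); rewrite ?normr1 ?normr0.
  - exact: finite_measure_integrable_cst.
have i3 : P.-integrable setT (EFin \o cst (b + c * t)).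
  exact: finite_measure_integrable_cst.
have := integrableD measurableT (integrableD measurableT (integrableZl measurableT k i1) i2) i3.
apply: eq_integrable => // w _; rewrite /= -EFinM -!EFinD; congr EFin.
by rewrite /full_value; ring.
Qed.

(** For a fixed log-odds both values are the same affine function, taken at [Post t] and at [theta];
    the slope is the unbounded weight passed to [integral_post_sub_theta]. *)
Let stopped_sub_full t w : stopped_value t w - full_value t w =
  (Post t w - (theta w)%:R) * (m - 2 * k * L t (X t w)).
Proof.
rewrite /stopped_value /full_value /Psi_affine /post Psi_logistic; ring.
Qed.

Let integrable_weight t : 0 <= t ->
  P.-integrable setT (fun w => (m - 2 * k * L t (X t w))%:E).
Proof.
move=> t0; have il := integrable_logodds alpha sigma p theta hF hW t0.
have ic : P.-integrable setT (EFin \o cst m) by exact: finite_measure_integrable_cst.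
have := integrableB measurableT ic (integrableZl measurableT (2 * k) il).
by apply: eq_integrable => // w _; rewrite /= -EFinM -EFinB.
Qed.

Let integrable_stopped_sub_full t : 0 <= t ->
  P.-integrable setT (fun w => (stopped_value t w - full_value t w)%:E).
Proof.
move=> t0; under eq_fun do rewrite stopped_sub_full.
apply: (integrable_mul_bounded (M := 1)) => //.
- apply: measurable_funB; last exact: measurable_theta.
  exact: (measurable_post _ _ _ _ hF hW).
- move=> w; have /andP[? ?] := post_itv alpha sigma p W theta t w.
  by case: (theta w); rewrite ler_norml; apply/andP; split => /=; lra.
- exact: integrable_weight.
Qed.

Lemma integrable_stopped_value t : 0 <= t ->
  P.-integrable setT (EFin \o stopped_value t).
Proof.
move=> t0.
have := integrableD measurableT (integrable_stopped_sub_full t0) (integrable_full_value t0).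
by apply: eq_integrable => // w _; rewrite /= -EFinD subrK.
Qed.

(** Two conditional means given the signal up to [s] vanish: that of
    [stopped_value s - full_value s], by the posterior property, and that of the increment of
    [full_value], which [hk] frees of drift. The right-hand side depends on [t] alone, so all
    earlier times are compared with one variable. *)
Lemma integral_stopped_full s t A : 0 <= s -> s <= t -> FX s A ->
  (\int[P]_(w in A) (stopped_value s w)%:E = \int[P]_(w in A) (full_value t w)%:E)%E.
Proof.
move=> s0 st FA; have t0 := le_trans s0 st.
have mA : measurable A by exact: (signal_filtration_measurable hF hW FA).
have mX u : 0 <= u -> measurable_fun setT (X u).
  by move=> u0; exact: (measurable_signal _ _ _ hF hW u0).
have mW u : 0 <= u -> measurable_fun setT (W u).
  by move=> u0; exact: (measurable_brownian hF hW u0).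
have D0 : (\int[P]_(w in A) (stopped_value s w - full_value s w)%:E = 0)%E.
  under eq_integral do rewrite stopped_sub_full.
  apply: (integral_post_sub_theta hsigma hp hF hW hindep hprior
    (r := fun x => m - 2 * k * L s x) s0 FA); last exact: integrable_weight.
  apply: measurable_funB => //; apply: measurable_funM => //.
  exact: measurable_logodds.
have sg0 : sigma != 0 by rewrite gt_eqF.
have inc w : full_value t w - full_value s w =
    (1 - 2 * (theta w)%:R) * (k * (alpha / sigma) * (W t w - W s w)).
  have kE : k * alpha ^+ 2 / sigma ^+ 2 / 2 = c by rewrite hk; field.
  have th2 : (theta w)%:R ^+ 2 = (theta w)%:R :> R.
    by case: (theta w); rewrite ?expr1n ?expr0n.
  (* Besides the drift cancelled by [hk], the expansion leaves a multiple of [theta - theta ^+ 2],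
     which is zero because [theta] takes the values 0 and 1. *)
  have -> : full_value t w - full_value s w =
    (1 - 2 * (theta w)%:R) * (k * (alpha / sigma) * (W t w - W s w)) +
    (t - s) * (c - k * alpha ^+ 2 / sigma ^+ 2 / 2 +
      2 * (k * alpha ^+ 2 / sigma ^+ 2) * ((theta w)%:R - (theta w)%:R ^+ 2)).
    by rewrite /full_value /logodds /signal; field.
  by rewrite kE th2; ring.
have I0 : (\int[P]_(w in A) (full_value t w - full_value s w)%:E = 0)%E.
  under eq_integral do rewrite inc.
  move: (st); rewrite le_eqVlt => /predU1P[->|slt].
    by apply: integral0_eq => w _; rewrite subrr !mulr0.
  rewrite (integral_split_theta theta)//; last first.
    apply/measurable_EFinP; apply: measurable_funM; first exact: measurable_sign_theta.
    by apply: measurable_funM => //; apply: measurable_funB; exact: mW.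
  have H i : (\int[P]_(w in A `&` Th i)
      ((1 - 2 * (theta w)%:R) * (k * (alpha / sigma) * (W t w - W s w)))%:E = 0)%E.
    transitivity (\int[P]_(w in A `&` Th i)
        (((1 - 2 * i%:R) * k * (alpha / sigma))%:E * (W t w - W s w)%:E))%E.
      by apply: eq_integral => w; rewrite inE => -[_ /= ->]; rewrite -EFinM !mulrA.
    rewrite integralZl ?(integral_brownian_increment hF hW hindep i s0 slt FA) ?mule0//.
    - by apply: measurableI => //; exact: measurable_Th.
    - apply: (integrableS measurableT _ (@subsetT _ _));
        last exact: (integrable_brownian_increment hF hW s0 slt).
      by apply: measurableI => //; exact: measurable_Th.
  by rewrite !H adde0.
have iS := integrableS measurableT mA (@subsetT _ _) (integrable_stopped_value s0).
have iFs := integrableS measurableT mA (@subsetT _ _) (integrable_full_value s0).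
have iFt := integrableS measurableT mA (@subsetT _ _) (integrable_full_value t0).
transitivity (\int[P]_(w in A) (full_value s w)%:E)%E.
  move: D0; rewrite integralB_EFin// => /eqP; rewrite sube_eq ?add0e; last 2 first.
  - exact: integrable_fin_num iS.
  - by rewrite fin_num_adde_defl//; exact: integrable_fin_num iFs.
  by move=> /eqP.
move: I0; rewrite integralB_EFin// => /eqP; rewrite sube_eq ?add0e; last 2 first.
- exact: integrable_fin_num iFt.
- by rewrite fin_num_adde_defl//; exact: integrable_fin_num iFs.
by move=> /eqP.
Qed.

Lemma post_start : {ae P, forall w, Post 0 w = p}.
Proof.
have [_ W0 _ _ _] := hW; apply: filterS W0 => w w0.
rewrite /post /logodds /signal w0 !mulr0 !addr0 subr0 mulr0 addr0.
exact: logistic_ln_odds.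
Qed.

Section grid.
Context (delta : R) (E : nat -> set T).
Hypothesis delta0 : 0 <= delta.
Hypothesis FE : forall j, FX (j%:R * delta) (E j).
Local Notation kappa := (first_entry E).

Let measurable_entry N j : measurable [set w | kappa N w = j].
Proof.
have [jN|Nj] := leqP j N.
  exact: (signal_filtration_measurable hF hW (first_entry_filtration delta0 FE jN)).
rewrite (_ : [set _ | _] = set0)//; apply/seteqP; split => w //= wj.
by have := first_entry_le E N w; rewrite wj leqNgt Nj.
Qed.

Let entry_partition N :
  [set: T] = \big[setU/set0]_(j <- iota 0 N.+1) [set w | kappa N w = j].
Proof.
apply/seteqP; split => w // _; rewrite -bigcup_seq.
have kN : kappa N w \in iota 0 N.+1 by rewrite mem_iota add0n ltnS first_entry_le.
by exists (kappa N w).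
Qed.

Let entry_trivIset N D : trivIset D (fun j => [set w | kappa N w = j]).
Proof. by move=> i j _ _ [w [<-]]. Qed.

Lemma measurable_at_entry (f : R -> T -> R) N :
  (forall t, 0 <= t -> measurable_fun setT (f t)) ->
  measurable_fun setT (fun w => f ((kappa N w)%:R * delta) w).
Proof.
move=> mf; have <- : \bigcup_j [set w | kappa N w = j] = setT.
  by apply/seteqP; split => w // _; exists (kappa N w).
apply/measurable_fun_bigcup => // j.
apply: (eq_measurable_fun (f (j%:R * delta))); first by move=> w; rewrite inE /= => ->.
by apply: measurable_funTS; apply: mf; rewrite mulr_ge0.
Qed.

Lemma integrable_stopped_value_entry N :
  P.-integrable setT (fun w => (stopped_value ((kappa N w)%:R * delta) w)%:E).
Proof.
have mS t : 0 <= t -> measurable_fun setT (stopped_value t).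
  by move=> t0; apply/measurable_EFinP; exact: measurable_int (integrable_stopped_value t0).
apply: (@le_integrable _ _ _ P setT measurableT _
  (fun w => \sum_(j <- iota 0 N.+1) `|(stopped_value (j%:R * delta) w)%:E|)%E).
- by apply/measurable_EFinP; exact: measurable_at_entry.
- move=> w _; have kN : kappa N w \in iota 0 N.+1 by rewrite mem_iota add0n ltnS first_entry_le.
  rewrite [leRHS]gee0_abs ?sume_ge0//.
  by rewrite (bigD1_seq (kappa N w)) ?iota_uniq//= leeDl// sume_ge0.
- apply: integrable_sum => // j _; apply: integrable_abse.
  by apply: integrable_stopped_value; rewrite mulr_ge0.
Qed.

(** On each event [kappa = j] the stopped value is exchanged for [full_value] at the horizon
    [N%:R * delta]. The pieces add up to one integral, which is exchanged back at time 0, where the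
    posterior is [p]. *)
Lemma integral_stopped_value_entry N :
  (\int[P]_w (stopped_value ((kappa N w)%:R * delta) w)%:E = (Psi_affine p)%:E)%E.
Proof.
have mS t : 0 <= t -> measurable_fun setT (stopped_value t).
  by move=> t0; apply/measurable_EFinP; exact: measurable_int (integrable_stopped_value t0).
have N0 : 0 <= N%:R * delta by rewrite mulr_ge0.
have mF : measurable_fun setT (full_value (N%:R * delta)).
  by apply/measurable_EFinP; exact: measurable_int (integrable_full_value N0).
have mSk := measurable_at_entry N mS.
transitivity (\int[P]_w (full_value (N%:R * delta) w)%:E)%E.
  rewrite (entry_partition N).
  rewrite integral_bigsetU_EFin ?iota_uniq//; last first.
    by apply/measurable_EFinP; exact: measurable_funTS.
  rewrite integral_bigsetU_EFin ?iota_uniq//; last first.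
    by apply/measurable_EFinP; exact: measurable_funTS.
  apply: eq_big_seq => j; rewrite mem_iota add0n ltnS => jN.
  have jNd : j%:R * delta <= N%:R * delta by rewrite ler_wpM2r// ler_nat.
  have Fj := first_entry_filtration delta0 FE jN.
  apply: (etrans _ (integral_stopped_full (mulr_ge0 (ler0n R j) delta0) jNd Fj)).
  by apply: eq_integral => w; rewrite inE /= => ->.
apply: (etrans (esym (integral_stopped_full (lexx 0) N0 (@natural_filtrationT _ _ _ X 0)))).
rewrite (ae_eq_integral (cst (Psi_affine p)%:E))//.
- by rewrite integral_cst//= probability_setT mule1.
- by apply/measurable_EFinP; exact: mS.
- by apply: filterS post_start => w pw _; rewrite /stopped_value mulr0 add0r pw.
Qed.

End grid.

End optional_stopping.

(** * Continuous paths at random times *)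

Section time_grid.
Context (R : realType).
Implicit Types (t : R) (n : nat).

Definition grid_floor n t : R := (Num.truncn (t * n.+1%:R))%:R * n.+1%:R^-1.

Lemma grid_floor_ge0 n t : 0 <= grid_floor n t.
Proof. by rewrite mulr_ge0. Qed.

Lemma grid_floor_itv n t : 0 <= t -> t - n.+1%:R^-1 <= grid_floor n t <= t.
Proof.
move=> t0; have n0 : 0 < n.+1%:R :> R by rewrite ltr0n.
have /truncn_itv/andP[h1 h2] : 0 <= t * n.+1%:R by rewrite mulr_ge0.
rewrite /grid_floor ler_pdivrMr// h1 andbT lerBlDr.
by rewrite -[X in _ + X]mul1r -mulrDl natr1 ler_pdivlMr// ltW.
Qed.

Lemma grid_floor_cvg t : 0 <= t -> grid_floor ^~ t @ \oo --> t.
Proof.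
move=> t0; apply: (@squeeze_cvgr _ _ _ _ (fun n => t - n.+1%:R^-1) (cst t)).
- by apply: nearW => n; exact: grid_floor_itv.
- rewrite -[X in _ --> X]subr0; apply: cvgB; first exact: cvg_cst.
  exact: cvg_harmonic.
- exact: cvg_cst.
Qed.

End time_grid.

Section path_regularity.
Context d (T : measurableType d) (R : realType).
Implicit Types (Y : R -> T -> R) (u : R^nat) (t : R) (w : T).

Lemma continuous_paths_cvg Y w t u : continuous_paths Y -> 0 <= t ->
  (forall n, 0 <= u n) -> u @ \oo --> t -> (fun n => Y (u n) w) @ \oo --> Y t w.
Proof.
move=> /(_ w)/subspace_continuousP cY t0 u0 ut.
have := cY t; rewrite /= in_itv/= t0 => /(_ isT) cYt.
apply: (cvg_comp u (Y ^~ w) _ cYt) => A /= [e e0 eA].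
near=> n; apply: eA => /=; last by rewrite in_itv/= u0.
by near: n; move/cvgrPdist_lt : ut; exact.
Unshelve. all: by end_near. Qed.

(** Rounding [rho] down to a grid leaves countably many times, on each of which measurability is
    immediate; path continuity passes to the limit. *)
Lemma measurable_path_at Y (rho : T -> R) : continuous_paths Y ->
  (forall t, 0 <= t -> measurable_fun setT (Y t)) ->
  measurable_fun setT rho -> (forall w, 0 <= rho w) ->
  measurable_fun setT (fun w => Y (rho w) w).
Proof.
move=> cY mY mrho rho0.
apply: (@measurable_fun_cvg _ _ _ setT (fun n w => Y (grid_floor n (rho w)) w)); last first.
  move=> w _; apply: continuous_paths_cvg => //.
    by move=> n; exact: grid_floor_ge0.
  exact: grid_floor_cvg.
move=> n; pose B j : set T := [set w | Num.truncn (rho w * n.+1%:R) = j].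
have <- : \bigcup_j B j = setT.
  by apply/seteqP; split => w // _; exists (Num.truncn (rho w * n.+1%:R)).
have mB j : measurable (B j).
  have m1 : measurable_fun setT (fun w => rho w * n.+1%:R) by exact: measurable_funM.
  rewrite (_ : B j = (fun w => rho w * n.+1%:R) @^-1` `[j%:R, j.+1%:R[); last first.
    apply/seteqP; split => w; rewrite /B/= in_itv/=.
      by move=> <-; apply: truncn_itv; rewrite mulr_ge0.
    exact: truncn_def.
  by rewrite -[X in measurable X]setTI; exact: m1.
apply/measurable_fun_bigcup => // j.
apply: (eq_measurable_fun (Y (j%:R * n.+1%:R^-1))).
  by move=> w; rewrite inE /B/grid_floor/= => ->.
by apply: measurable_funTS; apply: mY; rewrite mulr_ge0.
Qed.

(** Continuity of [g] is available only inside the interval, as a concave function may jump at the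
    endpoints; adding two points preserves measurability. *)
Lemma measurable_comp_itv01 (g : R -> R) (h : T -> R) :
  (forall x : R, 0 < x < 1 -> {for x, continuous g}) ->
  measurable_fun setT h -> (forall w, 0 <= h w <= 1) -> measurable_fun setT (g \o h).
Proof.
move=> cg mh h01.
have mg : measurable_fun (`[0, 1]%classic : set R) g.
  apply: (@measurable_fun_itv_cc _ _ _ false true).
  apply: open_continuous_measurable_fun; first exact: interval_open.
  by move=> x; rewrite inE/= in_itv/=; exact: cg.
apply: (measurable_comp _ _ mg mh) => //.
by move=> _ [w _ <-]; rewrite /= in_itv h01.
Qed.

End path_regularity.

Section posterior_paths.
Context d (T : measurableType d) (R : realType) (P : probability T R).
Context (alpha sigma p : R) (F : R -> set (set T)) (W : R -> T -> R).
Context (theta : {RV P >-> bool}).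
Hypotheses (hsigma : 0 < sigma) (hp : 0 < p < 1).
Hypotheses (hF : filtration F) (hW : brownian_motion P F W).
Hypothesis hindep : independent P (sigma_fun theta) (sigma_process `[0, +oo[ W).
Hypothesis hprior : P (theta @^-1` [set true]) = p%:E.
Context (Pi : R -> T -> R).
Hypothesis hPi : posterior_process P theta (signal alpha sigma theta W) Pi.
Implicit Types (s t : R) (A : set T) (i : bool).

Local Notation X := (signal alpha sigma theta W).
Local Notation L := (logodds alpha sigma p).
Local Notation Post := (post alpha sigma p W theta).

Lemma post_cvg w t (u : R^nat) : 0 <= t -> (forall n, 0 <= u n) -> u @ \oo --> t ->
  (fun n => Post (u n) w) @ \oo --> Post t w.
Proof.
move=> t0 u0 ut; have [_ _ cW _ _] := hW.
have Wu := continuous_paths_cvg (w := w) cW t0 u0 ut.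
apply: (cvg_comp (fun n => L (u n) (X (u n) w)) (@logistic R)); last first.
  exact: continuous_logistic.
rewrite /logodds /signal; apply: cvgB; last by apply: cvgM => //; exact: cvg_cst.
apply: cvgD; first exact: cvg_cst.
apply: cvgM; first exact: cvg_cst.
apply: cvgD; first by apply: cvgM => //; exact: cvg_cst.
by apply: cvgM => //; exact: cvg_cst.
Qed.

(** A countable union of null sets handles all grid times; continuity of both paths handles the
    others. *)
Lemma Pi_ae_post_all : {ae P, forall w, forall t, 0 <= t -> Pi t w = Post t w}.
Proof.
have [_ cPi _] := hPi.
have H : {ae P, forall w, forall n j : nat, Pi (j%:R * n.+1%:R^-1) w = Post (j%:R * n.+1%:R^-1) w}.
  apply: ae_foralln => n; apply: ae_foralln => j.
  by apply: (Pi_ae_post hsigma hp hF hW hindep hprior hPi); rewrite mulr_ge0.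
apply: filterS H => w H t t0.
have g0 n := grid_floor_ge0 n t.
have c1 := continuous_paths_cvg (w := w) cPi t0 g0 (grid_floor_cvg t0).
have c2 := post_cvg (w := w) t0 g0 (grid_floor_cvg t0).
have E : (fun n => Pi (grid_floor n t) w) = (fun n => Post (grid_floor n t) w).
  by apply/funext => n; rewrite /grid_floor H.
by rewrite -(cvg_lim _ c1)// -(cvg_lim _ c2)// E.
Qed.

End posterior_paths.

(** * Lower bound *)

Section lower_bound.
Context d (T : measurableType d) (R : realType) (P : probability T R).
Context (alpha sigma p : R) (F : R -> set (set T)) (W : R -> T -> R).
Context (theta : {RV P >-> bool}).
Hypotheses (hsigma : 0 < sigma) (hp : 0 < p < 1).
Hypotheses (hF : filtration F) (hW : brownian_motion P F W).
Hypothesis hindep : independent P (sigma_fun theta) (sigma_process `[0, +oo[ W).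
Hypothesis hprior : P (theta @^-1` [set true]) = p%:E.
Context (Pi : R -> T -> R).
Hypothesis hPi : posterior_process P theta (signal alpha sigma theta W) Pi.
Context (c k b m : R) (g : R -> R) (M : R).
Hypothesis hc : 0 < c.
Hypothesis hk : k * alpha ^+ 2 = 2 * c * sigma ^+ 2.
Hypothesis hg01 : forall x, 0 <= x <= 1 -> 0 <= g x <= M.
Hypothesis hgc : forall x : R, 0 < x < 1 -> {for x, continuous g}.
Implicit Types (s t : R) (A : set T) (i : bool) (w : T).

Local Notation X := (signal alpha sigma theta W).
Local Notation FX := (natural_filtration X).
Local Notation FPi := (natural_filtration Pi).
Local Notation Post := (post alpha sigma p W theta).
Local Notation Psi_affine := (Psi_affine k b m).

Let Pi01 t w : 0 <= t -> 0 <= Pi t w <= 1.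
Proof. by move=> t0; have [_ _ ->] := hPi. Qed.

Let gPi t w : 0 <= t -> 0 <= g (Pi t w) <= M.
Proof. by move=> t0; apply: hg01; exact: Pi01. Qed.

Lemma measurable_g_Pi_at (rho : T -> R) : measurable_fun setT rho ->
  (forall w, 0 <= rho w) -> measurable_fun setT (fun w => g (Pi (rho w) w)).
Proof.
move=> mrho rho0; have [_ cPi _] := hPi.
apply: (measurable_comp_itv01 (h := fun w => Pi (rho w) w) hgc).
  apply: measurable_path_at => // t t0.
  exact: (measurable_Pi hF hW hPi).
by move=> w; exact: Pi01.
Qed.

Section grid.
Context (delta : R) (E : nat -> set T).
Hypothesis delta0 : 0 <= delta.
Hypothesis FE : forall j, FX (j%:R * delta) (E j).
Local Notation sigma_ N w := ((first_entry E N w)%:R * delta).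

Let at_ge0 N w : 0 <= sigma_ N w.
Proof. by rewrite mulr_ge0. Qed.

Lemma measurable_entry_time N : measurable_fun setT (fun w => sigma_ N w).
Proof.
exact: (measurable_at_entry hF hW delta0 FE (f := fun t _ => t)).
Qed.

(** The comparison with [g] holds on the open interval only, so [Pi], which may touch 0 or 1 on a
    null set, is first replaced by [Post]; optional stopping does the rest. *)
Lemma entry_cost_ge N : (forall x, 0 < x < 1 -> Psi_affine x <= g x) ->
  ((Psi_affine p)%:E <= \int[P]_w (c * sigma_ N w + g (Pi (sigma_ N w) w))%:E)%E.
Proof.
move=> Psig.
have mst := measurable_entry_time N.
have i_cost (q : T -> R) : measurable_fun setT q -> (forall w, 0 <= q w <= M) ->
    P.-integrable setT (fun w => (c * sigma_ N w + q w)%:E).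
  move=> mq q0M.
  apply: (@le_integrable _ _ _ P setT measurableT _ (EFin \o cst (c * (N%:R * delta) + M))).
  - by apply/measurable_EFinP; apply: measurable_funD => //; exact: measurable_funM.
  - move=> w _; have /andP[q0 qM] := q0M w.
    rewrite !abse_EFin lee_fin [leLHS]ger0_norm; last first.
      by rewrite addr_ge0// mulr_ge0// ltW.
    rewrite (le_trans _ (ler_norm _))// lerD// ler_pM2l// ler_wpM2r// ler_nat.
    exact: first_entry_le.
  - exact: finite_measure_integrable_cst.
have post01 t w : 0 <= Post t w <= 1.
  by have /andP[/ltW -> /ltW ->] := post_itv alpha sigma p W theta t w.
have mgpost : measurable_fun setT (fun w => g (Post (sigma_ N w) w)).
  apply: (measurable_at_entry hF hW delta0 FE (f := fun t w => g (Post t w))) => t t0.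
  apply: (measurable_comp_itv01 (h := Post t) hgc) => //.
  exact: (measurable_post alpha sigma p theta hF hW t0).
have ipost := i_cost _ mgpost (fun w => hg01 (post01 _ w)).
have iPi := i_cost _ (measurable_g_Pi_at mst (at_ge0 N)) (fun w => gPi w (at_ge0 N w)).
rewrite -(integral_stopped_value_entry hsigma hp hF hW hindep hprior b m hk delta0 FE N).
rewrite (ae_eq_integral (fun w => (c * sigma_ N w + g (Post (sigma_ N w) w))%:E) _ _
  (measurable_int _ iPi) (measurable_int _ ipost))//; last first.
  apply: filterS (Pi_ae_post_all hsigma hp hF hW hindep hprior hPi) => w H _.
  by rewrite H.
apply: le_integral => //.
  exact: (integrable_stopped_value_entry p hF hW c k b m delta0 FE N).
by move=> w _; rewrite lee_fin lerD2l Psig// post_itv.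
Qed.

End grid.

(** [tau] is rounded up to a grid and truncated at a growing horizon. For the running cost the
    inequality [st n <= tau + delta n] is enough; the terminal cost is bounded and converges by path
    continuity, hence in mean by dominated convergence. *)
Lemma expected_cost_ge (tau : T -> \bar R) :
  (forall x, 0 < x < 1 -> Psi_affine x <= g x) ->
  finite_stopping_time P FPi tau ->
  ((Psi_affine p)%:E <= expected_cost P c g Pi tau)%E.
Proof.
move=> Psig [tau0 Ftau tauoo].
have mtau : measurable_fun setT tau.
  apply: (@measurability _ _ _ _ _ tau _ (ErealGenOInfty.measurableE R)) => _ [_ [r ->] <-].
  rewrite setTI (_ : _ @^-1` _ = ~` [set w | (tau w <= r%:E)%E]); last first.
    apply/seteqP; split => w; rewrite /= in_itv/= andbT ltNge; first by move/negP.
    by move/negP.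
  apply: measurableC; have [r0|r0] := leP 0 r.
    apply: (signal_filtration_measurable hF hW (t := r)).
    by apply: (Pi_sub_filtration hPi r0); exact: Ftau.
  rewrite (_ : [set _ | _] = set0)//; apply/seteqP; split => w //=.
  by apply/negP; rewrite -ltNge (lt_le_trans _ (tau0 w))// lte_fin.
pose delta n : R := n.+1%:R^-1.
(* These [N n] steps of length [delta n] reach the time [n.+1], so the truncation disappears in the
   limit. *)
pose N n := (n.+1 * n.+1)%N.
pose E n j : set T := [set w | (tau w <= (j%:R * delta n)%:E)%E].
have delta0 n : 0 <= delta n by rewrite invr_ge0.
have FE n j : FX (j%:R * delta n) (E n j).
  apply: (Pi_sub_filtration hPi); first by rewrite mulr_ge0.
  by apply: Ftau; rewrite mulr_ge0.
pose st n w := (first_entry (E n) (N n) w)%:R * delta n.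
have st0 n w : 0 <= st n w by rewrite mulr_ge0.
have stub n w : ((st n w)%:E <= tau w + (delta n)%:E)%E.
  rewrite /st; case fE : (first_entry (E n) (N n) w) => [|j].
    by rewrite mul0r adde_ge0// lee_fin.
  have : ~ E n j w by apply: (first_entry_before (N := N n)); rewrite fE.
  rewrite /E/= => /negP; rewrite -ltNge => /ltW jtau.
  by rewrite -natr1 mulrDl mul1r EFinD leeD2r.
have st_cvg w : (tau w < +oo)%E -> st ^~ w @ \oo --> fine (tau w).
  move=> tau_fin; have /fineK tauE : tau w \is a fin_num by rewrite ge0_fin_numE.
  set r := fine (tau w) in tauE *.
  apply: (@squeeze_cvgr _ _ _ _ (cst r) (fun n => r + delta n)).
  - near=> n; apply/andP; split; last first.
      by have := stub n w; rewrite -tauE -EFinD lee_fin.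
    have := first_entry_le (E n) (N n) w; rewrite leq_eqVlt => /predU1P[fN|fN].
      rewrite /st fN /N /delta natrM mulfK ?pnatr_eq0//.
      near: n; exists (Num.truncn r) => // n /= rn.
      by rewrite (le_trans (ltW (Num.Theory.truncnS_gt r)))// ler_nat ltnS.
    by have := first_entry_mem fN; rewrite /E/= -tauE lee_fin.
  - exact: cvg_cst.
  - rewrite -[X in _ --> X]addr0; apply: cvgD; first exact: cvg_cst.
    exact: cvg_harmonic.
have mst n : measurable_fun setT (st n) by exact: (measurable_entry_time (delta0 n) (FE n)).
have fine0 w : 0 <= fine (tau w) by rewrite fine_ge0.
have mfine : measurable_fun setT (fine \o tau) by exact: measurableT_comp.
have mG := measurable_g_Pi_at mfine fine0.
have mGn n := measurable_g_Pi_at (mst n) (st0 n).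
have [_ cPi _] := hPi.
have tauoo_ae :
    {ae P, forall w, (tau w < +oo)%E /\ forall t, 0 <= t -> Pi t w = Post t w}.
  apply: filterS2 tauoo (Pi_ae_post_all hsigma hp hF hW hindep hprior hPi).
  by [].
have [iG _ cG] : [/\ P.-integrable setT (fun w => (g (Pi (fine (tau w)) w))%:E),
    (\int[P]_w `|(g (Pi (st n w) w))%:E - (g (Pi (fine (tau w)) w))%:E| @[n --> \oo] --> 0)%E
    & (\int[P]_w (g (Pi (st n w) w))%:E @[n --> \oo] -->
       \int[P]_w (g (Pi (fine (tau w)) w))%:E)%E].
  apply: (@dominated_convergence _ _ _ P setT measurableT
    (fun n w => (g (Pi (st n w) w))%:E) (fun w => (g (Pi (fine (tau w)) w))%:E) (EFin \o cst M)).
  - by move=> n; exact/measurable_EFinP.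
  - exact/measurable_EFinP.
  - apply: filterS tauoo_ae => w [wfin Hw] _.
    apply: cvg_EFin; first by apply: nearW.
    apply: (cvg_comp (fun n => Pi (st n w) w) g).
      exact: (continuous_paths_cvg cPi (fine0 w) (st0 ^~ w) (st_cvg _ wfin)).
    (* Almost surely the limit point is a value of [Post], hence interior, and [g] is continuous
       there. *)
    by rewrite Hw//; apply: hgc; exact: post_itv.
  - exact: finite_measure_integrable_cst.
  - apply: aeW => w n _; have /andP[g0 gM] := gPi w (st0 n w).
    by rewrite abse_EFin lee_fin ger0_norm.
have Gfin := integrable_fin_num measurableT iG.
have g0 w : (0 <= (g (Pi (fine (tau w)) w))%:E)%E.
  by rewrite lee_fin; have /andP[] := gPi w (fine0 w).
have ctau0 w : (0 <= c%:E * tau w)%E by rewrite mule_ge0// lee_fin ltW.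
have mctau : measurable_fun setT (fun w => c%:E * tau w)%E by exact: measurable_funeM.
rewrite /expected_cost ge0_integralD//; last exact/measurable_EFinP.
set I := (\int[P]_w (c%:E * tau w))%E.
have I0 : (0 <= I)%E by exact: integral_ge0.
have bnd n : ((Psi_affine p)%:E <= I + (c * delta n)%:E + \int[P]_w (g (Pi (st n w) w))%:E)%E.
  have gn0 w : (0 <= (g (Pi (st n w) w))%:E)%E.
    by rewrite lee_fin; have /andP[] := gPi w (st0 n w).
  have mgn : measurable_fun setT (fun w => (g (Pi (st n w) w))%:E) by exact/measurable_EFinP.
  have cd0 : (0 <= (c * delta n)%:E)%E by rewrite lee_fin mulr_ge0// ltW.
  apply: (le_trans (entry_cost_ge (delta0 n) (FE n) (N n) Psig)).
  apply: (@le_trans _ _ (\int[P]_w (c%:E * tau w + (c * delta n)%:E + (g (Pi (st n w) w))%:E))%E).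
    apply: ge0_le_integral => //.
    - move=> w _; rewrite lee_fin addr_ge0//; last by have /andP[] := gPi w (st0 n w).
      by apply: mulr_ge0; [exact: ltW|exact: (st0 n w)].
    - apply/measurable_EFinP; apply: measurable_funD; last exact: mGn.
      by apply: measurable_funM => //; exact: mst.
    - by apply: emeasurable_funD => //; apply: emeasurable_funD.
    - move=> w _; rewrite EFinD; apply: leeD => //.
      by rewrite !EFinM -ge0_muleDr ?lee_fin// lee_pmul2l ?lte_fin//; exact: stub.
  rewrite ge0_integralD//; [|by move=> w _; rewrite adde_ge0|exact: emeasurable_funD].
  by rewrite ge0_integralD// integral_cst//= probability_setT mule1.
(* If the expected running cost is infinite the bound is trivial, the terminal part being finite. *)
have [Ifin|] := boolP (I \is a fin_num); last first.
  rewrite ge0_fin_numE// -leNgt leye_eq => /eqP ->.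
  by rewrite addye ?leey// -ltNye; move: Gfin; rewrite fin_numE => /andP[]; rewrite ltNye.
have cd : (fun n => I + (c * delta n)%:E + \int[P]_w (g (Pi (st n w) w))%:E)%E @ \oo -->
    (I + 0%:E + \int[P]_w (g (Pi (fine (tau w)) w))%:E)%E.
  apply: cvgeD => //; first by rewrite fin_num_adde_defl.
  apply: cvgeD; first by rewrite fin_num_adde_defl.
    exact: cvg_cst.
  apply: cvg_EFin; first exact: nearW.
  rewrite -[X in _ --> X](mulr0 c); apply: cvgM; [exact: cvg_cst|exact: cvg_harmonic].
rewrite -[I]adde0 -(cvg_lim _ cd)//; apply: lime_ge; first by apply/cvg_ex; eexists; exact: cd.
by apply: nearW => n; exact: bnd.
Unshelve. all: by end_near. Qed.

End lower_bound.

(** * Upper bound *)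

Section overshoot.
Context (R : realType).
Implicit Types x y eps : R.

Lemma ltr_logistic x y : (logistic x < logistic y) = (x < y).
Proof.
have e0 z := expR_gt0 (- z : R).
rewrite /logistic ltf_pV2 ?posrE ?addr_gt0// ltrD2l ltr_expR.
by rewrite ltrN2.
Qed.

Context (k b m M : R) (g : R -> R).
Hypothesis hg01 : forall x, 0 <= x <= 1 -> 0 <= g x <= M.
Hypothesis hgc : forall x : R, 0 < x < 1 -> {for x, continuous g}.

(** Terminal cost minus the function of the martingale, in log-odds coordinates: there the
    increments are Gaussian given [theta], and [Psi] grows at most linearly. *)
Definition gap (y : R) : R := g (logistic y) - Psi_affine k b m (logistic y).

Lemma continuous_gap : continuous gap.
Proof.
move=> y; have lgc := @continuous_logistic R y.
have -> : gap = (fun z => g (logistic z) -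
    (k * ((1 - 2 * logistic z) * z) + b + m * logistic z)).
  by apply/funext => z; rewrite /gap /Psi_affine Psi_logistic.
apply: cvgB.
  by apply: continuous_comp; [exact: lgc|apply: hgc; exact: logistic_itv].
apply: cvgD; last by apply: cvgM; [exact: cvg_cst|exact: lgc].
apply: cvgD; last exact: cvg_cst.
apply: cvgM; first exact: cvg_cst.
apply: cvgM; last exact: cvg_id.
apply: cvgB; first exact: cvg_cst.
by apply: cvgM; [exact: cvg_cst|exact: lgc].
Qed.

Lemma gap_le y : gap y <= M + `|b| + `|m| + `|k| * `|y|.
Proof.
have /andP[l0 l1] := logistic_itv y.
have /andP[_ gM] : 0 <= g (logistic y) <= M by apply: hg01; rewrite !ltW.
rewrite /gap /Psi_affine Psi_logistic.
have h1 : `|k * ((1 - 2 * logistic y) * y)| <= `|k| * `|y|.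
  rewrite !normrM ler_wpM2l// ler_piMl// ler_norml; apply/andP; split; lra.
have h2 : `|m * logistic y| <= `|m|.
  by rewrite normrM ler_piMr// ger0_norm ltW.
move: h1 h2 (ler_norm (- b)); rewrite normrN !ler_norml => /andP[h1 _] /andP[h2 _] h3.
lra.
Qed.

(** A step out of []la, lb[] either lands close to the crossed endpoint, where the gap is small by
    continuity, or is at least some [eta] long, and then its fourth power dominates the linear
    growth of the gap. *)
Lemma overshoot_le la lb eps : gap la = 0 -> gap lb = 0 -> 0 < eps ->
  exists2 C, 0 <= C & forall x y, la < x < lb -> ~ (la < y < lb) ->
    gap y <= eps + C * (y - x) ^+ 4.
Proof.
move=> ga gb eps0.
have near0 l : gap l = 0 -> exists2 eta, 0 < eta & forall y, `|y - l| < eta -> gap y <= eps.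
  move=> gl; have /cvgrPdist_lt/(_ _ eps0) := @continuous_gap l.
  move=> [/= eta eta0 H]; exists eta => // y yl.
  have := H y; rewrite /ball/= distrC => /(_ yl).
  by rewrite gl sub0r normrN => /ltW; exact: le_trans (ler_norm _).
have [e1 e10 H1] := near0 _ ga; have [e2 e20 H2] := near0 _ gb.
pose eta := Num.min e1 e2.
have eta0 : 0 < eta by rewrite lt_min e10.
pose Q := M + `|b| + `|m| + `|k| * (`|la| + `|lb|).
have M0 : 0 <= M.
  have /andP[] : 0 <= g 0 <= M by apply: hg01; rewrite lexx ler01.
  exact: le_trans.
have Q0 : 0 <= Q by rewrite !addr_ge0// mulr_ge0// addr_ge0.
(* For a step of length [D >= eta] the gap is at most [Q + |k| * D]; multiplying the summands by
   [(D / eta) ^+ 4 >= 1] and [(D / eta) ^+ 3 >= 1] gives [C * D ^+ 4]. *)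
pose C := Q / eta ^+ 4 + `|k| / eta ^+ 3.
have C0 : 0 <= C by rewrite addr_ge0// divr_ge0// exprn_ge0// ltW.
exists C => // x y /andP[lax xlb] ny.
have D4 : 0 <= C * (y - x) ^+ 4 by rewrite mulr_ge0// exprn_even_ge0.
(* it suffices to compare with the crossed endpoint l *)
have key l : `|y - l| <= `|y - x| -> `|l| <= `|la| + `|lb| ->
    (forall y, `|y - l| < eta -> gap y <= eps) -> gap y <= eps + C * (y - x) ^+ 4.
  move=> lx ll Hl; have [/Hl h|h] := ltP `|y - l| eta; first by rewrite (le_trans h)// lerDl.
  apply: (le_trans (gap_le y)); apply: (@le_trans _ _ (C * (y - x) ^+ 4));
    last by rewrite lerDr ltW.
  set D := `|y - x|; have De : eta <= D by exact: le_trans h lx.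
  have -> : (y - x) ^+ 4 = D ^+ 4 by rewrite /D -normrX ger0_norm// exprn_even_ge0.
  have y_le : `|y| <= `|la| + `|lb| + D.
    have -> : y = l + (y - l) by ring.
    by apply: (le_trans (ler_normD _ _)); apply: lerD.
  have D0 : 0 <= D by rewrite normr_ge0.
  have h4 : Q <= Q / eta ^+ 4 * D ^+ 4.
    rewrite -mulrA ler_peMr// mulrC ler_pdivlMr ?exprn_gt0// mul1r.
    by apply: lerXn2r => //; rewrite nnegrE ltW.
  have h3 : `|k| * D <= `|k| / eta ^+ 3 * D ^+ 4.
    rewrite -mulrA ler_wpM2l// ler_pdivlMl ?exprn_gt0// [D ^+ 4]exprSr ler_wpM2r//.
    by apply: lerXn2r => //; rewrite nnegrE ltW.
  apply: (@le_trans _ _ (Q + `|k| * D)); last by rewrite mulrDl lerD.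
  have ky := ler_wpM2l (normr_ge0 k) y_le; rewrite /Q; rewrite !mulrDr in ky *; lra.
have [yla|lay] := leP y la.
  apply: (key la).
  - rewrite ler0_norm ?subr_le0// ler0_norm; first by lra.
    by rewrite subr_le0 ltW// (le_lt_trans yla).
  - by rewrite lerDl.
  - by move=> z zl; apply: H1; rewrite (lt_le_trans zl)// ge_min lexx.
have lby : lb <= y by rewrite leNgt; apply/negP => ylb; apply: ny; rewrite lay ylb.
apply: (key lb).
- rewrite ger0_norm ?subr_ge0// ger0_norm; first by lra.
  by rewrite subr_ge0 ltW// (lt_le_trans xlb).
- by rewrite lerDr.
- by move=> z zl; apply: H2; rewrite (lt_le_trans zl)// ge_min lexx orbT.
Qed.

End overshoot.

Section fourth_moment.
Context d (T : measurableType d) (R : realType) (P : probability T R).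
Context (alpha sigma p : R) (F : R -> set (set T)) (W : R -> T -> R).
Context (theta : {RV P >-> bool}).
Hypotheses (hsigma : 0 < sigma) (hp : 0 < p < 1).
Hypotheses (hF : filtration F) (hW : brownian_motion P F W).
Hypothesis hindep : independent P (sigma_fun theta) (sigma_process `[0, +oo[ W).
Hypothesis hprior : P (theta @^-1` [set true]) = p%:E.
Implicit Types (s t : R) (i : bool) (w : T).

Local Notation X := (signal alpha sigma theta W).
Local Notation L := (logodds alpha sigma p).

(** With [a = alpha / sigma], an increment of log-odds is [u + v] with noise [u = a * dW] and drift
    [v = a ^+ 2 * (theta - 1 / 2) * dt]. The factor [8] comes from
    [(u + v) ^+ 4 <= 8 * (u ^+ 4 + v ^+ 4)], and [48 * expR (1 / 2)] from [normal_prob_power4]. The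
    drift contributes [dt ^+ 4], at most [dt ^+ 2] when [dt <= 1]. *)
Definition increment4_bound : R :=
  8 * (alpha / sigma) ^+ 4 * (48 * expR (1 / 2)) + 8 * (alpha / sigma) ^+ 8.

Lemma increment4_bound_ge0 : 0 <= increment4_bound.
Proof.
have a4 : 0 <= (alpha / sigma) ^+ 4 by rewrite exprn_even_ge0.
have a8 : 0 <= (alpha / sigma) ^+ 8 by rewrite exprn_even_ge0.
have e0 : 0 <= expR (1 / 2 : R) by exact: expR_ge0.
by apply: addr_ge0; apply: mulr_ge0 => //; apply: mulr_ge0 => //; apply: mulr_ge0.
Qed.

Lemma integral_logodds_increment4 s t : 0 <= s -> s < t -> t - s <= 1 ->
  (\int[P]_w ((L t (X t w) - L s (X s w)) ^+ 4)%:E <=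
   (increment4_bound * (t - s) ^+ 2)%:E)%E.
Proof.
move=> s0 st ts1; have t0 : 0 <= t by apply: ltW; exact: le_lt_trans s0 st.
have sg0 : sigma != 0 by rewrite gt_eqF.
have ts0 : 0 < t - s by rewrite subr_gt0.
have sd0 : Num.sqrt (t - s) != 0 by rewrite gt_eqF// sqrtr_gt0.
set a := alpha / sigma.
have m4 : measurable_fun setT (fun y : R => (y ^+ 4)%:E).
  by apply/measurable_EFinP; exact: measurable_funX.
have mdW : measurable_fun setT (fun w => ((W t w - W s w) ^+ 4)%:E).
  apply/measurable_EFinP; apply: measurable_funX; apply: measurable_funB;
  exact: (measurable_brownian hF hW).
have mlo u : 0 <= u -> measurable_fun setT (fun w => L u (X u w)).
  by move=> u0; exact: (measurable_logodds_signal alpha sigma p theta hF hW u0).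
have k0 : 0 <= 8 * a ^+ 4 by rewrite mulr_ge0// exprn_even_ge0.
have k1 : 0 <= 8 * a ^+ 8 * (t - s) ^+ 2.
  by apply: mulr_ge0; [apply: mulr_ge0 => //|]; rewrite exprn_even_ge0.
apply: (@le_trans _ _ (\int[P]_w ((8 * a ^+ 4)%:E * ((W t w - W s w) ^+ 4)%:E +
    (8 * a ^+ 8 * (t - s) ^+ 2)%:E))%E).
  apply: ge0_le_integral => //.
  - by move=> w _; rewrite lee_fin exprn_even_ge0.
  - by apply/measurable_EFinP; apply: measurable_funX; apply: measurable_funB; exact: mlo.
  - by apply: emeasurable_funD => //; exact: measurable_funeM.
  - move=> w _; rewrite -EFinM -EFinD lee_fin.
    have -> : L t (X t w) - L s (X s w) =
        a * (W t w - W s w) + a ^+ 2 * ((theta w)%:R - 2^-1) * (t - s).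
      by rewrite /logodds /signal /a; field.
    set u := a * _; set v := a ^+ 2 * _ * _.
    have uv : (u + v) ^+ 4 <= 8 * u ^+ 4 + 8 * v ^+ 4.
      have h1 : (u + v) ^+ 2 <= 2 * (u ^+ 2 + v ^+ 2).
        rewrite -subr_ge0 (_ : _ - _ = (u - v) ^+ 2); last by ring.
        exact: sqr_ge0.
      have h2 : ((u + v) ^+ 2) ^+ 2 <= (2 * (u ^+ 2 + v ^+ 2)) ^+ 2.
        by apply: lerXn2r => //; rewrite nnegrE ?sqr_ge0// mulr_ge0// addr_ge0// sqr_ge0.
      rewrite -exprM in h2; apply: (le_trans h2); rewrite -subr_ge0.
      rewrite (_ : _ - _ = 4 * (u ^+ 2 - v ^+ 2) ^+ 2); last by ring.
      by rewrite mulr_ge0// sqr_ge0.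
    apply: (le_trans uv); rewrite /u exprMn mulrA lerD2l /v.
    rewrite (_ : 8 * _ ^+ 4 = 8 * a ^+ 8 * (((theta w)%:R - 2^-1) ^+ 4 * (t - s) ^+ 4));
      last by ring.
    apply: ler_wpM2l; first by rewrite mulr_ge0// exprn_even_ge0.
    have th4 : ((theta w)%:R - 2^-1) ^+ 4 <= 1 :> R.
      have -> : ((theta w)%:R - 2^-1) ^+ 4 = 2^-1 ^+ 4 :> R.
        by case: (theta w) => /=; field.
      by rewrite exprn_ile1// invf_le1// ler1n.
    have ts4 : (t - s) ^+ 4 <= (t - s) ^+ 2.
      rewrite -[4%N]/(2 + 2)%N exprD -[leRHS]mulr1 ler_wpM2l ?sqr_ge0//.
      by rewrite exprn_ile1// ltW.
    by rewrite -[leRHS]mul1r ler_pM// exprn_even_ge0.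
rewrite ge0_integralD//; last 2 first.
- by move=> w _; rewrite mule_ge0// lee_fin exprn_even_ge0.
- exact: measurable_funeM.
rewrite ge0_integralZl_EFin//; last by move=> w _; rewrite lee_fin exprn_even_ge0.
rewrite integral_cst//= probability_setT mule1.
rewrite (ge0_integral_brownian_increment hF hW (h := fun y => (y ^+ 4)%:E) s0 st)//; last first.
  by move=> y; rewrite lee_fin exprn_even_ge0.
have -> : increment4_bound * (t - s) ^+ 2 =
    8 * a ^+ 4 * (48 * expR (1 / 2) * (t - s) ^+ 2) + 8 * a ^+ 8 * (t - s) ^+ 2.
  by rewrite /increment4_bound -/a; ring.
rewrite EFinD; apply: leeD => //.
rewrite [leRHS]EFinM; apply: lee_wpmul2l; first by rewrite lee_fin.
apply: (le_trans (normal_prob_power4 sd0)); rewrite lee_fin.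
by rewrite (exprM _ 2 2) sqr_sqrtr// ltW.
Qed.

End fourth_moment.

(** Replacing [f] by the minimum of [f] and [h], almost everywhere equal to it, makes the inequality
    hold everywhere. *)
Lemma ae_le_integral d (T : measurableType d) (R : realType) (P : {measure set T -> \bar R})
    (f h : T -> R) : P.-integrable setT (EFin \o f) -> P.-integrable setT (EFin \o h) ->
  {ae P, forall w, f w <= h w} -> (\int[P]_w (f w)%:E <= \int[P]_w (h w)%:E)%E.
Proof.
move=> fi hi fh.
have mf : measurable_fun setT f by apply/measurable_EFinP; exact: measurable_int fi.
have mh : measurable_fun setT h by apply/measurable_EFinP; exact: measurable_int hi.
have mmin : measurable_fun setT (fun w => Num.min (f w) (h w)) by exact: measurable_minr.
have imin : P.-integrable setT (fun w => (Num.min (f w) (h w))%:E).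
  apply: (@le_integrable _ _ _ P setT measurableT _ (fun w => `|(f w)%:E| + `|(h w)%:E|)%E).
  - exact/measurable_EFinP.
  - move=> w _; rewrite [leRHS]gee0_abs ?adde_ge0//.
    by rewrite minEle; case: ifP => _; rewrite ?leeDl ?leeDr.
  - by apply: integrableD => //; exact: integrable_abse.
rewrite (ae_eq_integral (fun w => (Num.min (f w) (h w))%:E))//.
- by apply: le_integral => // w _; rewrite lee_fin ge_min lexx orbT.
- exact/measurable_EFinP.
- exact/measurable_EFinP.
- by apply: filterS fh => w fhw _; rewrite min_l.
Qed.

Section upper_bound.
Context d (T : measurableType d) (R : realType) (P : probability T R).
Context (alpha sigma p : R) (F : R -> set (set T)) (W : R -> T -> R).
Context (theta : {RV P >-> bool}).
Hypotheses (hsigma : 0 < sigma) (hp : 0 < p < 1).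
Hypotheses (hF : filtration F) (hW : brownian_motion P F W).
Hypothesis hindep : independent P (sigma_fun theta) (sigma_process `[0, +oo[ W).
Hypothesis hprior : P (theta @^-1` [set true]) = p%:E.
Context (Pi : R -> T -> R).
Hypothesis hPi : posterior_process P theta (signal alpha sigma theta W) Pi.
Context (c k b m : R) (g : R -> R) (M : R).
Hypothesis hc : 0 < c.
Hypothesis hk : k * alpha ^+ 2 = 2 * c * sigma ^+ 2.
Hypothesis hg01 : forall x, 0 <= x <= 1 -> 0 <= g x <= M.
Hypothesis hgc : forall x : R, 0 < x < 1 -> {for x, continuous g}.
Implicit Types (s t : R) (i : bool) (w : T).

Local Notation X := (signal alpha sigma theta W).
Local Notation FX := (natural_filtration X).
Local Notation FPi := (natural_filtration Pi).
Local Notation L := (logodds alpha sigma p).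
Local Notation Post := (post alpha sigma p W theta).
Local Notation Psi_affine := (Psi_affine k b m).
Local Notation SV := (stopped_value alpha sigma p W theta c k b m).
Local Notation Gap := (gap k b m g).
Local Notation C2 := (increment4_bound alpha sigma).

Let Pi01 t w : 0 <= t -> 0 <= Pi t w <= 1.
Proof. by move=> t0; have [_ _ ->] := hPi. Qed.

Let gPi t w : 0 <= t -> 0 <= g (Pi t w) <= M.
Proof. by move=> t0; apply: hg01; exact: Pi01. Qed.

Context (A B : R).
Hypotheses (A0 : 0 < A) (B1 : B < 1) (ApB : A < p < B).

Let la := ln (A / (1 - A)).
Let lb := ln (B / (1 - B)).

Let A1 : A < 1.
Proof. by case/andP: ApB => Ap pB; exact: lt_trans (lt_trans Ap pB) B1. Qed.

Let B0 : 0 < B.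
Proof. by case/andP: ApB => Ap pB; exact: lt_trans A0 (lt_trans Ap pB). Qed.

Let laE : logistic la = A. Proof. by apply: logistic_ln_odds; rewrite A0. Qed.
Let lbE : logistic lb = B. Proof. by apply: logistic_ln_odds; rewrite B0. Qed.

Let Q : R := M + `|b| + `|m| + `|k| * (`|la| + `|lb|).

Let M0 : 0 <= M.
Proof.
have /andP[] : 0 <= g 0 <= M by apply: hg01; rewrite lexx ler01.
exact: le_trans.
Qed.

Let Q0 : 0 <= Q. Proof. by rewrite !addr_ge0// mulr_ge0// addr_ge0. Qed.

Let gap_inside y : la < y < lb -> Gap y <= Q.
Proof.
move=> /andP[lay ylb]; apply: (le_trans (gap_le _ _ _ hg01 y)).
rewrite lerD2l ler_wpM2l// ler_norml; apply/andP; split.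
  by have := ler_norm (- la); have := normr_ge0 lb; rewrite normrN; lra.
by have := ler_norm lb; have := normr_ge0 la; lra.
Qed.

Section exit_time.
Context (delta : R) (N : nat).
Hypotheses (delta0 : 0 < delta) (delta1 : delta <= 1).

(** Defined through [Pi] rather than [Post], because the exit time must be a stopping time of the
    raw filtration of [Pi]. *)
Let E (j : nat) : set T := Pi (j%:R * delta) @^-1` (~` `]A, B[).
Let st w : R := (first_entry E N w)%:R * delta.
Let D (j : nat) w : R :=
  L (j.+1%:R * delta) (X (j.+1%:R * delta) w) - L (j%:R * delta) (X (j%:R * delta) w).

Let grid0 (j : nat) : 0 <= j%:R * delta. Proof. by rewrite mulr_ge0// ltW. Qed.
Let st0 w : 0 <= st w. Proof. exact: grid0. Qed.

Let EFPi j : FPi (j%:R * delta) (E j).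
Proof.
apply: sigma_process_preimage; first by rewrite /= in_itv/= lexx andbT grid0.
by apply: measurableC; exact: measurable_itv.
Qed.

Let EFX j : FX (j%:R * delta) (E j).
Proof. by apply: (Pi_sub_filtration hPi (grid0 j)); exact: EFPi. Qed.

Let mst : measurable_fun setT st.
Proof. exact: (measurable_entry_time hF hW (ltW delta0) EFX). Qed.

Let mgst : measurable_fun setT (fun w => g (Pi (st w) w)).
Proof. exact: (measurable_g_Pi_at hF hW hPi hgc mst st0). Qed.

Definition exit_time w : \bar R := (st w)%:E.

Lemma exit_time_stopping : finite_stopping_time P FPi exit_time.
Proof.
split.
- by move=> w; rewrite lee_fin.
- move=> t t0; rewrite (_ : [set w | _] = \bigcup_(j in [set j | (j <= N)%N /\ j%:R * delta <= t])
      [set w | first_entry E N w = j]); last first.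
    apply/seteqP; split => w; rewrite /exit_time/= lee_fin.
      by move=> stt; exists (first_entry E N w) => //; split => //; exact: first_entry_le.
    by move=> [j [jN jt] /= fj]; rewrite /st fj.
  set GG := \bigcup_(u in `[0, t]) sigma_fun (Pi u).
  apply: (@bigcup_measurable _ (g_sigma_algebraType GG)) => j [jN jt].
  apply: (natural_filtration_mono jt).
  exact: (first_entry_filtration (ltW delta0) EFPi jN).
- by apply: aeW => w; rewrite ltry.
Qed.

Let q : R := fine (P [set w | first_entry E N w = N]).

Let mN : measurable [set w | first_entry E N w = N].
Proof.
apply: (signal_filtration_measurable hF hW (t := N%:R * delta)).
exact: (first_entry_filtration (ltW delta0) EFX (leqnn N)).
Qed.

Let qE : P [set w | first_entry E N w = N] = q%:E.
Proof. by rewrite /q fineK// fin_num_measure. Qed.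

(** Paths that stay inside up to the horizon pay the full running cost. Read backwards, this bounds
    [q] by the cost itself, and the term [Q * q] of [exit_cost_le] can be absorbed. *)
Lemma exit_cost_ge : ((c * (N%:R * delta) * q)%:E <= expected_cost P c g Pi exit_time)%E.
Proof.
have cN0 : 0 <= c * (N%:R * delta) by rewrite mulr_ge0// ltW.
rewrite EFinM -qE -[X in (_ * P X)%E]setIT -integral_indic//.
rewrite -ge0_integralZl_EFin//; last by apply/measurable_EFinP; exact: measurable_indic.
rewrite /expected_cost; apply: ge0_le_integral => //.
- by move=> w _; rewrite mule_ge0// lee_fin.
- by apply: measurable_funeM; apply/measurable_EFinP; exact: measurable_indic.
- apply: emeasurable_funD; last exact/measurable_EFinP.
  by apply: measurable_funeM; exact/measurable_EFinP.
- move=> w _; rewrite /exit_time/= -!EFinM -EFinD lee_fin.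
  have /andP[g0 _] := gPi w (st0 w).
  rewrite indicE; case: (boolP (w \in _)) => [|_].
    by rewrite inE /= => fN; rewrite mulr1 /st fN lerDl -fN.
  by rewrite mulr0 addr_ge0// mulr_ge0// ltW.
Qed.

(** The cost exceeds the stopped martingale, of mean [Psi_affine p], by the gap at the stopping
    time. In the proof [f2] covers the tolerance [eps] and the paths still inside at the horizon,
    [f3] the overshoot. *)
Lemma exit_cost_le eps C : 0 <= eps -> 0 <= C ->
  (forall x y, la < x < lb -> ~ (la < y < lb) -> Gap y <= eps + C * (y - x) ^+ 4) ->
  (expected_cost P c g Pi exit_time <=
   (Psi_affine p + (eps + Q * q) + C * (N%:R * (C2 * delta ^+ 2)))%:E)%E.
Proof.
move=> eps0 C0 HC.
have mlo u : 0 <= u -> measurable_fun setT (fun w => L u (X u w)).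
  by move=> u0; exact: (measurable_logodds_signal alpha sigma p theta hF hW u0).
have mD4 j : measurable_fun setT (fun w => (D j w ^+ 4)%:E).
  by apply/measurable_EFinP; apply: measurable_funX; apply: measurable_funB; exact: mlo.
have D40 j w : (0 <= (D j w ^+ 4)%:E)%E by rewrite lee_fin exprn_even_ge0.
have iD4 j : (\int[P]_w (D j w ^+ 4)%:E <= (C2 * delta ^+ 2)%:E)%E.
  have step : j.+1%:R * delta - j%:R * delta = delta by rewrite -natr1; ring.
  rewrite -[in leRHS]step.
  apply: (integral_logodds_increment4 alpha p theta hsigma hF hW (grid0 j)).
    by rewrite -subr_gt0 step.
  by rewrite step.
(* The index of the exiting step is random; summing over all steps removes it at the price of a
   factor [N] in the mean. *)
pose f3 w := C * \sum_(j <- iota 0 N) D j w ^+ 4.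
pose f2 w := eps + Q * \1_[set w | first_entry E N w = N] w.
have mf3 : measurable_fun setT (fun w => \sum_(j <- iota 0 N) D j w ^+ 4).
  apply: measurable_sum => j; by apply/measurable_EFinP; exact: mD4.
have f30 w : 0 <= f3 w.
  by rewrite mulr_ge0// sumr_ge0// => j _; rewrite exprn_even_ge0.
have if3 : (\int[P]_w (f3 w)%:E <= (C * (N%:R * (C2 * delta ^+ 2)))%:E)%E.
  rewrite /f3; under eq_integral do rewrite EFinM -sumEFin.
  rewrite ge0_integralZl_EFin//; last 2 first.
  - by move=> w _; exact: sume_ge0.
  - exact: emeasurable_sum.
  rewrite [leRHS]EFinM; apply: lee_wpmul2l; first by rewrite lee_fin.
  rewrite ge0_integral_sum//.
  apply: (@le_trans _ _ (\sum_(j <- iota 0 N) (C2 * delta ^+ 2)%:E)%E).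
    by apply: lee_sum => j _; exact: iD4.
  by rewrite sumEFin big_const_seq count_predT size_iota iter_addr_0 lee_fin mulr_natl.
have i3 : P.-integrable setT (EFin \o f3).
  apply/integrableP; split; first by apply/measurable_EFinP; exact: measurable_funM.
  under eq_integral do rewrite /= ger0_norm//.
  by apply: (le_lt_trans if3); rewrite ltry.
have ind_i : P.-integrable setT (EFin \o \1_[set w | first_entry E N w = N]).
  exact: integrable_indic.
have i2 : P.-integrable setT (EFin \o f2).
  have ie : P.-integrable setT (EFin \o cst eps) by exact: finite_measure_integrable_cst.
  have := integrableD measurableT ie (integrableZl measurableT Q ind_i).
  by apply: eq_integrable => // w _; rewrite /= -EFinM -EFinD.
have if2 : (\int[P]_w (f2 w)%:E = (eps + Q * q)%:E)%E.
  rewrite /f2; under eq_integral do rewrite EFinD EFinM.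
  rewrite ge0_integralD//; last 2 first.
  - by move=> w _; rewrite mule_ge0// lee_fin.
  - by apply: measurable_funeM; apply/measurable_EFinP; exact: measurable_indic.
  rewrite integral_cst//= probability_setT mule1 ge0_integralZl_EFin//; last first.
    by apply/measurable_EFinP; exact: measurable_indic.
  have qi : (\int[P]_w (\1_[set w | first_entry E N w = N] w)%:E = q%:E)%E.
    by rewrite integral_indic// setIT; exact: qE.
  by rewrite qi -EFinM -EFinD.
have isv := integrable_stopped_value_entry p hF hW c k b m (ltW delta0) EFX N.
have i12 : P.-integrable setT (EFin \o (fun w => SV (st w) w + f2 w)).
  exact: (integrableD measurableT isv i2).
have i123 : P.-integrable setT (EFin \o (fun w => SV (st w) w + f2 w + f3 w)).
  exact: (integrableD measurableT i12 i3).
have icost : P.-integrable setT (EFin \o (fun w => c * st w + g (Pi (st w) w))).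
  apply: (@le_integrable _ _ _ P setT measurableT _ (EFin \o cst (c * (N%:R * delta) + M))).
  - by apply/measurable_EFinP; apply: measurable_funD => //; exact: measurable_funM.
  - move=> w _; have /andP[g0 gM] := gPi w (st0 w).
    rewrite !abse_EFin lee_fin [leLHS]ger0_norm; last first.
      by rewrite addr_ge0// mulr_ge0// ltW.
    rewrite (le_trans _ (ler_norm _))// lerD// ler_pM2l// ler_wpM2r ?(ltW delta0)// ler_nat.
    exact: first_entry_le.
  - exact: finite_measure_integrable_cst.
rewrite /expected_cost.
rewrite [leLHS](_ : _ = \int[P]_w (c * st w + g (Pi (st w) w))%:E)%E; last first.
  by apply: eq_integral => w _; rewrite /exit_time EFinD EFinM.
apply: (@le_trans _ _ (\int[P]_w (SV (st w) w + f2 w + f3 w)%:E)%E); last first.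
  rewrite (integralD_EFin measurableT i12 i3) (integralD_EFin measurableT isv i2).
  rewrite (integral_stopped_value_entry hsigma hp hF hW hindep hprior b m hk (ltW delta0) EFX N).
  by rewrite if2 -EFinD [leRHS]EFinD; apply: leeD.
apply: ae_le_integral => //.
have start := post_start alpha sigma theta hp hW.
apply: filterS2 (Pi_ae_post_all hsigma hp hF hW hindep hprior hPi) start => w Piw pw.
rewrite Piw// /stopped_value -addrA -addrA lerD2l.
suff : Gap (L (st w) (X (st w) w)) <= f2 w + f3 w.
  by rewrite /gap -/(Post (st w) w) lerBlDl.
set kap := first_entry E N w.
have insideE j : (A < Pi (j%:R * delta) w < B) =
    (la < L (j%:R * delta) (X (j%:R * delta) w) < lb).
  by rewrite Piw// /post -{1}laE -{1}lbE !ltr_logistic.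
have [ins|out] := boolP (la < L (st w) (X (st w) w) < lb).
  apply: (le_trans (gap_inside ins)).
  have -> : f2 w = eps + Q.
    rewrite /f2 indicE mem_set ?mulr1//=.
    move: (first_entry_le E N w); rewrite leq_eqVlt => /predU1P[//|/first_entry_mem].
    by rewrite /E/= in_itv/= insideE => /negP/negP/negP; rewrite ins.
  by rewrite (@le_trans _ _ (eps + Q)) ?lerDl// lerDr.
(* Being outside at index 0 would contradict the start at [p] in []A, B[]; otherwise step [j] starts
   inside and ends outside. *)
case kE : kap => [|j].
  by move: out; rewrite /st -/kap kE -insideE mul0r Piw// pw ApB.
have jN : (j < N)%N by rewrite -kE; exact: first_entry_le.
have insj : la < L (j%:R * delta) (X (j%:R * delta) w) < lb.
  rewrite -insideE; apply: contrapT => nj.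
  by apply: (@first_entry_before _ _ E N w j); rewrite -/kap ?kE// /E/= in_itv/=.
apply: (le_trans (HC _ _ insj (elimN idP out))).
rewrite lerD//; first by rewrite lerDl mulr_ge0// indicE ler0n.
rewrite /f3 ler_wpM2l// /st -/kap kE -/(D j w).
rewrite (bigD1_seq j) ?iota_uniq ?mem_iota//= lerDl sumr_ge0// => i _.
by rewrite exprn_even_ge0.
Qed.

End exit_time.
End upper_bound.

Section value_upper_bound.
Context d (T : measurableType d) (R : realType) (P : probability T R).
Context (alpha sigma p : R) (F : R -> set (set T)) (W : R -> T -> R).
Context (theta : {RV P >-> bool}).
Hypotheses (hsigma : 0 < sigma) (hp : 0 < p < 1).
Hypotheses (hF : filtration F) (hW : brownian_motion P F W).
Hypothesis hindep : independent P (sigma_fun theta) (sigma_process `[0, +oo[ W).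
Hypothesis hprior : P (theta @^-1` [set true]) = p%:E.
Context (Pi : R -> T -> R).
Hypothesis hPi : posterior_process P theta (signal alpha sigma theta W) Pi.
Context (c k b m : R) (g : R -> R) (M : R).
Hypothesis hc : 0 < c.
Hypothesis hk : k * alpha ^+ 2 = 2 * c * sigma ^+ 2.
Hypothesis hg01 : forall x, 0 <= x <= 1 -> 0 <= g x <= M.
Hypothesis hgc : forall x : R, 0 < x < 1 -> {for x, continuous g}.

Local Notation FPi := (natural_filtration Pi).
Local Notation Psi_affine := (Psi_affine k b m).

Lemma expected_cost_ge0 tau : finite_stopping_time P FPi tau ->
  (0 <= expected_cost P c g Pi tau)%E.
Proof.
move=> [tau0 _ _]; apply: integral_ge0 => w _; apply: adde_ge0.
  by apply: mule_ge0 => //; rewrite lee_fin ltW.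
have [_ _ P01] := hPi; rewrite lee_fin.
by have /hg01/andP[] := P01 (fine (tau w)) w (fine_ge0 (tau0 w)).
Qed.

Lemma value_le tau : finite_stopping_time P FPi tau ->
  (value P c g Pi <= expected_cost P c g Pi tau)%E.
Proof. by move=> tauP; apply: ereal_inf_lbound; exists tau. Qed.

Lemma value_ge (v : \bar R) : (forall tau, finite_stopping_time P FPi tau ->
  (v <= expected_cost P c g Pi tau)%E) -> (v <= value P c g Pi)%E.
Proof. by move=> H; apply: le_ereal_inf_tmp => _ [tau tauP <-]; exact: H. Qed.

Lemma value_le_now : (value P c g Pi <= (g p)%:E)%E.
Proof.
apply: (le_trans (value_le (tau := cst 0%E) _)).
  split => //; last by apply: aeW => w; rewrite ltry.
  move=> t t0; rewrite (_ : [set _ | _] = setT); last first.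
    by apply/seteqP; split => w //= _; rewrite lee_fin.
  exact: natural_filtrationT.
rewrite /expected_cost.
under eq_integral do rewrite /cst/= mule0 add0e.
rewrite (ae_eq_integral (cst (g p)%:E))//.
- by rewrite integral_cst//= probability_setT mule1.
- apply/measurable_EFinP.
  exact: (measurable_g_Pi_at hF hW hPi hgc (rho := fun=> 0)).
- have start := post_start alpha sigma theta hp hW.
  apply: filterS2 (Pi_ae_post_all hsigma hp hF hW hindep hprior hPi) start => w Piw pw _.
  by rewrite Piw// pw.
Qed.

(** For a suitable grid exit time of cost [J], the overshoot costs at most [2 * eps] and
    [Q * q <= eps * J], so [J * (1 - eps) <= Psi_affine p + 2 * eps]; then [eps] tends to 0. *)
Lemma value_le_Psi_affine A B : 0 < A -> B < 1 -> A < p < B ->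
  Psi_affine A = g A -> Psi_affine B = g B ->
  (value P c g Pi <= (Psi_affine p)%:E)%E.
Proof.
move=> A0 B1 ApB gA gB.
have [Ap pB] := andP ApB.
have A01 : 0 < A < 1 by rewrite A0 (lt_trans Ap (lt_trans pB B1)).
have B01 : 0 < B < 1 by rewrite B1 (lt_trans A0 (lt_trans Ap pB)).
have gapA : gap k b m g (ln (A / (1 - A))) = 0.
  by rewrite /gap logistic_ln_odds// gA subrr.
have gapB : gap k b m g (ln (B / (1 - B))) = 0.
  by rewrite /gap logistic_ln_odds// gB subrr.
have C20 := increment4_bound_ge0 alpha sigma.
set C2 := increment4_bound alpha sigma in C20.
set Q := M + `|b| + `|m| + `|k| * (`|ln (A / (1 - A))| + `|ln (B / (1 - B))|).
have M0 : 0 <= M.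
  have /andP[] : 0 <= g 0 <= M by apply: hg01; rewrite lexx ler01.
  exact: le_trans.
have Q0 : 0 <= Q by rewrite !addr_ge0// mulr_ge0// addr_ge0.
have value0 : (0 <= value P c g Pi)%E by apply: value_ge => tau; exact: expected_cost_ge0.
have main eps : 0 < eps < 1 -> exists J : R,
    [/\ (value P c g Pi <= J%:E)%E & J * (1 - eps) <= Psi_affine p + 2 * eps].
  move=> /andP[eps0 eps1].
  have [C C0 HC] := overshoot_le hg01 hgc gapA gapB eps0.
  (* [n] will be the horizon. The first summand ensures [Q * q <= eps * J], the second makes the
     summed overshoots at most [eps]; [C] depends on [eps], so [n] is chosen last. *)
  pose n := (Num.truncn (Q / (c * eps) + C * C2 / eps)).+1.
  have n0 : (0 : R) < n%:R by rewrite ltr0n.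
  have nQ : Q / (c * eps) + C * C2 / eps <= n%:R by apply/ltW; exact: Num.Theory.truncnS_gt.
  have ce0 : 0 < c * eps by rewrite mulr_gt0.
  have t1 : 0 <= Q / (c * eps) by rewrite divr_ge0// ltW.
  have t2 : 0 <= C * C2 / eps by rewrite divr_ge0 ?mulr_ge0// ltW.
  have Qn : Q <= c * eps * n%:R by rewrite [leRHS]mulrC -ler_pdivrMr// (le_trans _ nQ)// lerDl.
  have Cn : C * C2 <= eps * n%:R by rewrite [leRHS]mulrC -ler_pdivrMr// (le_trans _ nQ)// lerDr.
  (* Then [N * delta = n] is large while [N * delta ^+ 2 = 1 / n] is small. *)
  pose delta : R := (n%:R ^+ 2)^-1; pose N := (n ^ 3)%N.
  have n2 : (0 : R) < n%:R ^+ 2 by rewrite exprn_gt0.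
  have delta0 : 0 < delta by rewrite invr_gt0.
  have delta1 : delta <= 1.
    by rewrite invf_le1// -natrX ler1n expn_gt0.
  have nn0 : n%:R != 0 :> R by rewrite gt_eqF.
  have Nd : N%:R * delta = n%:R by rewrite /N /delta natrX; field.
  have Ndd : N%:R * (C2 * delta ^+ 2) = C2 / n%:R by rewrite /N /delta natrX; field.
  have tauP := exit_time_stopping P Pi A B N delta0.
  have lo := exit_cost_ge hF hW hPi hc hg01 hgc A B N delta0.
  have up := exit_cost_le hsigma hp hF hW hindep hprior hPi hc hk hg01 hgc A0 B1 ApB N
    delta0 delta1 (ltW eps0) C0 HC.
  have J0 := expected_cost_ge0 tauP.
  set q := fine _ in lo up.
  have Jfin : expected_cost P c g Pi (exit_time Pi A B delta N) \is a fin_num.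
    by rewrite ge0_fin_numE// (le_lt_trans up)// ltry.
  exists (fine (expected_cost P c g Pi (exit_time Pi A B delta N))); split.
    by rewrite fineK//; exact: value_le.
  rewrite -(fineK Jfin) in lo up J0; move: lo up J0; rewrite !lee_fin Nd Ndd.
  set J := fine _ => lo up J0.
  have q_le : Q * q <= eps * J.
    have [q0|q0] := leP 0 q; last first.
      by apply: (@le_trans _ _ 0); [rewrite mulr_ge0_le0// ltW|rewrite mulr_ge0// ltW].
    apply: (@le_trans _ _ (c * eps * n%:R * q)); first by rewrite ler_wpM2r.
    by rewrite (_ : _ * q = eps * (c * n%:R * q)) ?ler_wpM2l ?(ltW eps0)//; ring.
  have C_le : C * (C2 / n%:R) <= eps by rewrite mulrA ler_pdivrMr.
  move: up; rewrite -/Q => up; lra.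
have vfin : value P c g Pi \is a fin_num.
  have [J [vJ _]] : exists J : R, [/\ (value P c g Pi <= J%:E)%E &
      J * (1 - 2^-1) <= Psi_affine p + 2 * 2^-1].
    by apply: main; apply/andP; split; lra.
  by rewrite ge0_fin_numE// (le_lt_trans vJ)// ltry.
rewrite -(fineK vfin) lee_fin; set v := fine _.
have v0 : 0 <= v by rewrite fine_ge0.
apply/ler_addgt0Pr => e e0.
(* [main] gives [v <= Psi_affine p + eps * (2 + v)], and the last term is at most [e] by this
   choice. *)
pose eps := Num.min 2^-1 (e / (2 + v)).
have v2 : 0 < 2 + v by lra.
have eps0 : 0 < eps by rewrite lt_min divr_gt0// andbT; lra.
have eps1 : eps <= 2^-1 by rewrite ge_min lexx.
have epse : eps * (2 + v) <= e by rewrite -ler_pdivlMr// ge_min lexx orbT.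
have [|J [vJ HJ]] := main eps; first by rewrite eps0/=; lra.
have vJ' : v <= J by rewrite -lee_fin fineK.
have : v * (1 - eps) <= J * (1 - eps) by rewrite ler_wpM2r//; lra.
by move=> h; lra.
Qed.

End value_upper_bound.

(** * Affine minorants of H *)

Section concave_cost.
Context (R : realType) (g : R -> R).
Hypothesis hG1 : G1 g.

Lemma G1_concave x y t : 0 <= x <= 1 -> 0 <= y <= 1 -> 0 <= t <= 1 ->
  t * g x + (1 - t) * g y <= g (t * x + (1 - t) * y).
Proof.
have [_ cg _] := hG1 => x01 y01 /andP[t0 t1].
have := cg (Itv01 t0 t1) x y.
rewrite !inE/= !in_itv/= => /(_ x01 y01).
rewrite convRE /= => h.
by rewrite -lerN2 opprD -!mulrN; exact: h.
Qed.

(** Concavity between the two zeros gives the sign. For the upper bound, [1 / 2] is a convex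
    combination of [x] and the endpoint on the other side, with weight at least [1 / 2] on [x]. *)
Lemma G1_bounded x : 0 <= x <= 1 -> 0 <= g x <= 2 * g (1 / 2).
Proof.
have [_ _ [g0 g1]] := hG1 => x01; have /andP[x0 x1] := x01.
have z01 : 0 <= (0 : R) <= 1 by rewrite lexx ler01.
have o01 : 0 <= (1 : R) <= 1 by rewrite lexx ler01.
have gx : 0 <= g x.
  have := G1_concave o01 z01 x01.
  by rewrite g0 g1 !mulr0 addr0 mulr1 addr0.
rewrite gx /=; have [xh|hx] := leP x (1 / 2).
  have t01 : 0 <= 1 / (2 * (1 - x)) <= 1.
    by apply/andP; split; [rewrite divr_ge0//; lra|rewrite ler_pdivrMr; lra].
  have := G1_concave x01 o01 t01.
  rewrite g1 mulr0 addr0 mulr1 (_ : _ * x + _ = 1 / 2); last by field; lra.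
  have : 1 / 2 <= 1 / (2 * (1 - x)) by rewrite ler_pdivlMr; lra.
  by nra.
have t01 : 0 <= 1 / (2 * x) <= 1.
  by apply/andP; split; [rewrite divr_ge0//; lra|rewrite ler_pdivrMr; lra].
have := G1_concave x01 z01 t01.
rewrite g0 !mulr0 !addr0 (_ : 1 / (2 * x) * x = 1 / 2); last by field; lra.
have : 1 / 2 <= 1 / (2 * x) by rewrite ler_pdivlMr; lra.
by nra.
Qed.

Lemma G1_continuous (x : R) : 0 < x < 1 -> {for x, continuous g}.
Proof.
move=> x01; have [[dg _ _] _ _] := hG1.
apply: differentiable_continuous; apply/derivable1_diffP; apply: dg.
by rewrite in_itv.
Qed.

End concave_cost.

(** * Tangents and chords from the sign of the second derivative *)

Section second_order.
Context (R : realType) (f df ddf : R -> R).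
Hypothesis hf : forall x : R, 0 < x < 1 -> is_derive x 1 f (df x).
Hypothesis hdf : forall x : R, 0 < x < 1 -> is_derive x 1 df (ddf x).
Implicit Types x y u v : R.

Let mean_value (h dh : R -> R) u v : (forall x, 0 < x < 1 -> is_derive x 1 h (dh x)) ->
  0 < u -> v < 1 -> u < v -> exists2 xi, u < xi < v & h v - h u = dh xi * (v - u).
Proof.
move=> H u0 v1 uv.
have in01 x : u <= x <= v -> 0 < x < 1.
  by move=> /andP[ux xv]; rewrite (lt_le_trans u0 ux) (le_lt_trans xv v1).
have [xi|xi|xi xiuv E] := @MVT R h dh u v uv.
- by rewrite in_itv/= => /andP[ux xv]; apply: H; apply: in01; rewrite !ltW.
- apply: derivable_within_continuous => x; rewrite in_itv/= => /in01 x01.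
  by have [] := H x x01.
- by exists xi => //; move: xiuv; rewrite in_itv.
Qed.

(** The mean value theorem twice. The sign is required only between [x] and [y], since [H] will be
    convex only on two outer pieces. *)
Lemma tangent_le_of_convex x y : 0 < x < 1 -> 0 < y < 1 ->
  (forall z, Num.min x y < z < Num.max x y -> 0 <= ddf z) ->
  f x + df x * (y - x) <= f y.
Proof.
move=> /andP[x0 x1] /andP[y0 y1] H.
have [xy|yx|->] := ltgtP x y; last by rewrite subrr mulr0 addr0.
  have [xi /andP[xxi xiy] E] := mean_value hf x0 y1 xy.
  have [eta /andP[xe exi] E'] := mean_value hdf x0 (lt_trans xiy y1) xxi.
  have e0 : 0 <= ddf eta.
    by apply: H; rewrite min_l ?max_r ?(ltW xy)// xe (lt_trans exi xiy).
  have : 0 <= df xi - df x by rewrite E' mulr_ge0// subr_ge0 ltW.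
  have : f y = f x + df xi * (y - x) by rewrite -E; ring.
  by move=> -> h; nra.
have [xi /andP[yxi xix] E] := mean_value hf y0 x1 yx.
have [eta /andP[xe exi] E'] := mean_value hdf (lt_trans y0 yxi) x1 xix.
have e0 : 0 <= ddf eta.
  by apply: H; rewrite min_r ?max_l ?(ltW yx)// exi (lt_trans yxi xe).
have : 0 <= df x - df xi by rewrite E' mulr_ge0// subr_ge0 ltW.
have : f y = f x + df xi * (y - x) by rewrite -[f x](subrK (f y)) E; ring.
by move=> -> h; nra.
Qed.

Lemma slope_le_of_convex x y : 0 < x < 1 -> 0 < y < 1 -> x <= y ->
  (forall z, x < z < y -> 0 <= ddf z) -> df x <= df y.
Proof.
move=> x01 y01; rewrite le_eqVlt => /predU1P[->//|xy] H.
have E1 : f x + df x * (y - x) <= f y.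
  by apply: tangent_le_of_convex => // z; rewrite min_l ?max_r ?(ltW xy)//; exact: H.
have E2 : f y + df y * (x - y) <= f x.
  by apply: tangent_le_of_convex => // z; rewrite min_r ?max_l ?(ltW xy)//; exact: H.
rewrite -subr_ge0 -(pmulr_lge0 _ (_ : 0 < y - x)) ?subr_gt0//.
by move: E1 E2; nra.
Qed.

End second_order.

Section affine_minorant.
Context (R : realType) (f df ddf : R -> R).
Hypothesis hf : forall x : R, 0 < x < 1 -> is_derive x 1 f (df x).
Hypothesis hdf : forall x : R, 0 < x < 1 -> is_derive x 1 df (ddf x).
Implicit Types x y u v : R.

(** The tangent inequality for [- f] at [x], taken at [u] and [v] and averaged, with denominators
    cleared. *)
Lemma chord_le_of_concave u v x : 0 < u -> v < 1 -> u <= x <= v ->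
  (forall z, u < z < v -> ddf z <= 0) ->
  (v - x) * f u + (x - u) * f v <= (v - u) * f x.
Proof.
move=> u0 v1 /andP[ux xv] H.
have hNf (z : R) : 0 < z < 1 -> is_derive z 1 (- f) (- df z).
  by move=> /hf ?; exact: is_deriveN.
have hNdf (z : R) : 0 < z < 1 -> is_derive z 1 (fun y => - df y) (- ddf z).
  by move=> /hdf ?; exact: is_deriveN.
have x01 : 0 < x < 1 by rewrite (lt_le_trans u0 ux) (le_lt_trans xv v1).
have tx y : u <= y <= v -> f y <= f x + df x * (y - x).
  move=> /andP[uy yv].
  have y01 : 0 < y < 1 by rewrite (lt_le_trans u0 uy) (le_lt_trans yv v1).
  have := tangent_le_of_convex hNf hNdf x01 y01.
  rewrite !fctE => h; suff: - f x + - df x * (y - x) <= - f y by lra.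
  apply: h => z /andP[az zb]; rewrite oppr_ge0 H//; apply/andP; split.
    by apply: le_lt_trans az; rewrite le_min ux.
  by apply: lt_le_trans zb _; rewrite ge_max xv.
have uv := le_trans ux xv.
have := tx u; rewrite lexx uv => /(_ isT) hu.
have := tx v; rewrite lexx uv => /(_ isT) hv.
have hx : (v - x) * f u <= (v - x) * (f x + df x * (u - x)) by rewrite ler_wpM2l// subr_ge0.
have hx' : (x - u) * f v <= (x - u) * (f x + df x * (v - x)) by rewrite ler_wpM2l// subr_ge0.
by lra.
Qed.

Context (A B u v : R).
Hypotheses (A0 : 0 < A) (B1 : B < 1) (Au : A <= u) (uv : u <= v) (vB : v <= B).
Hypothesis convex_l : forall z, 0 < z < u -> 0 <= ddf z.
Hypothesis convex_r : forall z, v < z < 1 -> 0 <= ddf z.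
Hypothesis concave_m : forall z, u < z < v -> ddf z <= 0.
Hypotheses (chord : f B - f A = df A * (B - A)) (slope : df A = df B).

Let u01 : 0 < u < 1.
Proof. by rewrite (lt_le_trans A0 Au) (le_lt_trans uv (le_lt_trans vB B1)). Qed.

Let v01 : 0 < v < 1.
Proof. by rewrite (le_lt_trans vB B1) (lt_le_trans A0 (le_trans Au uv)). Qed.

Let A01 : 0 < A < 1.
Proof. by rewrite A0 (le_lt_trans Au)//; case/andP: u01. Qed.

Let B01 : 0 < B < 1.
Proof. by rewrite B1 (lt_le_trans _ vB)//; case/andP: v01. Qed.

Let tangent_l x y : 0 < x <= u -> 0 < y <= u -> f x + df x * (y - x) <= f y.
Proof.
have /andP[_ u1] := u01; move=> /andP[x0 xu] /andP[y0 yu].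
apply: (tangent_le_of_convex hf hdf).
- by rewrite x0 (le_lt_trans xu).
- by rewrite y0 (le_lt_trans yu).
move=> z /andP[az zb]; apply: convex_l; apply/andP; split.
  by apply: le_lt_trans az; rewrite le_min !ltW.
by apply: lt_le_trans zb _; rewrite ge_max xu.
Qed.

Let tangent_r x y : v <= x < 1 -> v <= y < 1 -> f x + df x * (y - x) <= f y.
Proof.
have /andP[v0 _] := v01; move=> /andP[vx x1] /andP[vy y1].
apply: (tangent_le_of_convex hf hdf).
- by rewrite x1 (lt_le_trans v0).
- by rewrite y1 (lt_le_trans v0).
move=> z /andP[az zb]; apply: convex_r; apply/andP; split.
  by apply: le_lt_trans az; rewrite le_min vx.
by apply: lt_le_trans zb _; rewrite ge_max !ltW.
Qed.

(** Left of [u], convexity puts [f] above its tangent at [A]; right of [v], above its tangent at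
    [B], the same line by [chord] and [slope]. In between, [f] lies above its chord over [[u, v]],
    whose ends are already above the line. *)
Lemma double_tangent_le x : 0 < x < 1 -> f A + df A * (x - A) <= f x.
Proof.
have fB : f B = f A + df A * (B - A) by rewrite -chord; ring.
have left_ y : 0 < y <= u -> f A + df A * (y - A) <= f y.
  by move=> ?; apply: tangent_l; rewrite ?A0.
have right_ y : v <= y < 1 -> f A + df A * (y - A) <= f y.
  move=> y1; have := @tangent_r B y.
  by rewrite vB B1 => /(_ isT y1); rewrite fB -slope; lra.
have /andP[u0 u1] := u01; have /andP[v0 v1] := v01.
move=> /andP[x0 x1].
have [xu|ux] := leP x u; first by apply: left_; rewrite x0.
have [vx|xv] := leP v x; first by apply: right_; rewrite vx.
have uxv : u <= x <= v by rewrite !ltW.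
have ch := chord_le_of_concave u0 v1 uxv concave_m.
have := left_ u; rewrite u0 lexx => /(_ isT) hu.
have := right_ v; rewrite v1 lexx => /(_ isT) hv.
have hu' : (v - x) * (f A + df A * (u - A)) <= (v - x) * f u by rewrite ler_wpM2l// subr_ge0 ltW.
have hv' : (x - u) * (f A + df A * (v - A)) <= (x - u) * f v by rewrite ler_wpM2l// subr_ge0 ltW.
rewrite -(ler_pM2l (_ : 0 < v - u)) ?subr_gt0 ?(lt_trans ux)//.
by lra.
Qed.

(** For [p <= A], convexity settles [x <= A]. Beyond [A], the tangent at [p] is at most [f A] at [A]
    and no steeper than the double tangent, so [double_tangent_le] concludes. The case [B <= p] is
    the mirror image. *)
Lemma outer_tangent_le p x : 0 < p < 1 -> 0 < x < 1 -> ~~ (A < p < B) ->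
  f p + df p * (x - p) <= f x.
Proof.
move=> /andP[p0 p1] x01; have /andP[x0 x1] := x01.
have dx := double_tangent_le x01.
rewrite negb_and -!leNgt => /orP[pA|Bp].
  have pu := le_trans pA Au.
  have [xA|Ax] := leP x A.
    by apply: tangent_l; rewrite ?p0 ?x0 //= (le_trans xA).
  have tA : f p + df p * (A - p) <= f A by apply: tangent_l; rewrite ?p0 ?A0.
  have dd : df p <= df A.
    apply: (slope_le_of_convex hf hdf) => //; first by rewrite p0.
    move=> z /andP[pz zA]; apply: convex_l.
    by rewrite (lt_trans p0 pz) (lt_le_trans zA Au).
  have : df p * (x - A) <= df A * (x - A) by rewrite ler_wpM2r// subr_ge0 ltW.
  by lra.
have vp := le_trans vB Bp.
have [Bx|xB] := leP B x.
  by apply: tangent_r; rewrite ?vp ?p1 ?x1 //= ?andbT (le_trans vB).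
have tB : f p + df p * (B - p) <= f B by apply: tangent_r; rewrite ?vp ?vB.
have dd : df B <= df p.
  apply: (slope_le_of_convex hf hdf) => //; first by rewrite p0.
  move=> z /andP[Bz zp]; apply: convex_r.
  by rewrite (le_lt_trans vB Bz) (lt_trans zp p1).
have : df p * (x - B) <= df B * (x - B).
  by rewrite ler_wnM2r// subr_le0 ltW.
by move: dx; rewrite slope => dx; move: chord; rewrite slope; lra.
Qed.

End affine_minorant.

(** * Where [H] is convex and where it is concave *)

Section convexity_of_H.
Context (R : realType) (g : R -> R) (K : R).
Hypothesis hG1 : G1 g.
Implicit Types x y : R.

Definition dPsi x : R := - (2 * ln (x / (1 - x))) + (1 - 2 * x) / (x * (1 - x)).

(** Thus [genA] of [Psi] is the constant [- 1 / 2] on []0, 1[], which is why convexity of [H]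
    compares [genA g] with [- K^-1]. *)
Definition ddPsi x : R := - ((x ^+ 2) * ((1 - x) ^+ 2))^-1.

Lemma is_derive_ln_odds x : 0 < x < 1 ->
  is_derive x 1 (fun y => ln (y / (1 - y))) (x * (1 - x))^-1.
Proof.
move=> /andP[x0 x1].
have x1' : 1 - x != 0 by lra.
have d1 : is_derive x 1 (fun y : R => 1 - y) (-1).
  by apply: is_derive_eq; ring.
have d2 : is_derive x 1 (fun y : R => (1 - y)^-1) ((1 - x) ^- 2).
  by apply: (is_derive_eq (is_deriveV (f := fun y : R => 1 - y) x1' d1));
    rewrite /GRing.scale/=; field.
have d3 : is_derive x 1 (fun y : R => y / (1 - y)) ((1 - x) ^- 2).
  by apply: (is_derive_eq (is_deriveM (is_derive_id x 1) d2)); rewrite /GRing.scale/=; field.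
have q0 : 0 < x / (1 - x) by rewrite divr_gt0//; lra.
apply: (is_derive_eq (is_derive1_comp (g := fun y : R => y / (1 - y)) (is_derive1_ln q0) d3)).
by field; rewrite x1'/=; lra.
Qed.

Lemma is_derive_Psi x : 0 < x < 1 -> is_derive x 1 (@Psi R) (dPsi x).
Proof.
move=> x01.
have dl := is_derive_ln_odds x01.
have d1 : is_derive x 1 (fun y : R => 1 - 2 * y) (-2).
  by apply: is_derive_eq; rewrite /GRing.scale/=; ring.
apply: (is_derive_eq (is_deriveM d1 dl)).
by rewrite /dPsi /GRing.scale/=; ring.
Qed.

Lemma is_derive_dPsi x : 0 < x < 1 -> is_derive x 1 dPsi (ddPsi x).
Proof.
move=> x01; have /andP[x0 x1] := x01.
have dl := is_derive_ln_odds x01.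
have d1 : is_derive x 1 (fun y : R => 1 - 2 * y) (-2).
  by apply: is_derive_eq; rewrite /GRing.scale/=; ring.
have d2 : is_derive x 1 (fun y : R => y * (1 - y)) (1 - 2 * x).
  by apply: is_derive_eq; rewrite /GRing.scale/=; ring.
have q0 : x * (1 - x) != 0 by rewrite gt_eqF// mulr_gt0//; lra.
have dq := is_deriveM d1 (is_deriveV (f := fun y : R => y * (1 - y)) q0 d2).
apply: (is_derive_eq (is_deriveD (is_deriveN (is_deriveZ 2 dl)) dq)).
by rewrite /ddPsi /GRing.scale/=; field; lra.
Qed.

Definition ddH x := derive1n 2 g x - 2 * K^-1 * ddPsi x.

Lemma is_derive_Hfun x : 0 < x < 1 ->
  is_derive x 1 (Hfun g K) (derive1 (Hfun g K) x).
Proof.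
move=> x01; have [[dg _ _] _ _] := hG1.
rewrite derive1E; apply: derivableP.
apply: derivableB; first by apply: dg; rewrite in_itv.
by apply: derivableZ; have [] := is_derive_Psi x01.
Qed.

Lemma derive1_Hfun x : 0 < x < 1 ->
  derive1 (Hfun g K) x = derive1 g x - 2 * K^-1 * dPsi x.
Proof.
move=> x01; have [[dg _ _] _ _] := hG1.
have ix : x \in `]0, 1[ by rewrite in_itv.
have d1 := is_deriveB (derivableP (dg x ix)) (is_deriveZ (2 * K^-1) (is_derive_Psi x01)).
by rewrite derive1E derive_val derive1E.
Qed.

Lemma is_derive_derive1_Hfun x : 0 < x < 1 ->
  is_derive x 1 (derive1 (Hfun g K)) (ddH x).
Proof.
move=> x01; have [[_ ddg _] _ _] := hG1.
have ix : x \in `]0, 1[ by rewrite in_itv.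
have d1 := is_deriveB (derivableP (ddg x ix)) (is_deriveZ (2 * K^-1) (is_derive_dPsi x01)).
(* The explicit first derivative is known only on []0, 1[], but that is a neighbourhood of [x]. *)
apply: near_eq_is_derive (is_derive_eq d1 _); last by rewrite /ddH/= derive1E.
near=> y; rewrite derive1_Hfun//.
have : y \in `]0, 1[ by near: y; exact: near_in_itvoo.
by rewrite in_itv.
Unshelve. all: by end_near. Qed.

Lemma ddHE x : 0 < x < 1 ->
  ddH x = 2 * (genA g x + K^-1) / (x ^+ 2 * (1 - x) ^+ 2).
Proof.
move=> /andP[x0 x1]; rewrite /ddH /genA /ddPsi; set w := K^-1; set h := derive1n _ _ _.
by field; apply/andP; split; apply/eqP; lra.
Qed.

Lemma ddH_ge0 x : 0 < x < 1 -> (0 <= ddH x) = (- K^-1 <= genA g x).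
Proof.
move=> x01; have /andP[x0 x1] := x01; rewrite ddHE// pmulr_lge0; last first.
  by rewrite invr_gt0 mulr_gt0// exprn_gt0//; lra.
by rewrite pmulr_rge0// -lerBlDr sub0r.
Qed.

Context (pi0 : R).
Hypothesis hG2 : G2 g pi0.

Lemma genA_continuous x : 0 < x < 1 -> {for x, continuous (genA g)}.
Proof.
move=> x01; have [[_ _ cg] _ _] := hG1.
apply: cvgM; last by apply: cg; rewrite in_itv.
apply: cvgM; last first.
  apply: (@continuous_comp _ _ _ (fun y : R => 1 - y) (fun y : R => y ^+ 2)).
    by apply: cvgB; [exact: cvg_cst|exact: cvg_id].
  exact: exprn_continuous.
by apply: cvgM; [exact: cvg_cst|exact: exprn_continuous].
Qed.

(* By continuity, monotonicity on the two open intervals makes [pi0] a minimum. *)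
Lemma genA_min x : 0 < x < 1 -> genA g pi0 <= genA g x.
Proof.
have [pi01 dec inc] := hG2; have /andP[p0 p1] := pi01.
move=> /andP[x0 x1]; rewrite leNgt; apply/negP => lt_x.
have near_gt : \forall y \near pi0, genA g x < genA g y.
  exact: (cvgr_gt _ (genA_continuous pi01)).
have [xp|px|xp] := ltgtP x pi0; last by move: lt_x; rewrite xp ltxx.
- have : \forall y \near pi0^'-, False.
    near=> y; suff : genA g x < genA g y.
      apply/negP; rewrite -leNgt; apply/ltW/dec.
      + by rewrite in_itv/= x0.
      + rewrite in_itv/=; apply/andP; split; near: y; first exact: nbhs_left_gt.
        exact: nbhs_left_lt.
      + by near: y; exact: nbhs_left_gt.
    by near: y; exact: cvg_at_left_filter near_gt.
  by move=> /filter_ex[].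
have : \forall y \near pi0^'+, False.
  near=> y; suff : genA g x < genA g y.
    apply/negP; rewrite -leNgt; apply/ltW/inc.
    + rewrite in_itv/=; apply/andP; split; near: y; first exact: nbhs_right_gt.
      exact: nbhs_right_lt.
    + by rewrite in_itv/= px.
    + by near: y; exact: nbhs_right_lt.
  by near: y; exact: cvg_at_right_filter near_gt.
by move=> /filter_ex[].
Unshelve. all: by end_near. Qed.

Lemma tangent_le_Hfun x y : - K^-1 <= genA g pi0 -> 0 < x < 1 -> 0 < y < 1 ->
  Hfun g K x + derive1 (Hfun g K) x * (y - x) <= Hfun g K y.
Proof.
move=> hpi x01 y01; apply: (tangent_le_of_convex is_derive_Hfun is_derive_derive1_Hfun) => //.
have /andP[x0 x1] := x01; have /andP[y0 y1] := y01 => z /andP[az zb].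
have z01 : 0 < z < 1.
  apply/andP; split; first by apply: lt_trans az; rewrite lt_min x0.
  by apply: lt_trans zb _; rewrite gt_max x1.
by rewrite (ddH_ge0 z01); apply: (le_trans hpi); exact: (genA_min z01).
Qed.

Hypothesis pi0U : genA g pi0 < - K^-1.

Let pi0_Uset : Uset g K pi0.
Proof. by have [] := hG2. Qed.

Let lbU : has_lbound (Uset g K).
Proof. by exists 0 => x /= [/andP[/ltW]]. Qed.

Let ubU : has_ubound (Uset g K).
Proof. by exists 1 => x /= [/andP[_ /ltW]]. Qed.

Lemma inf_Uset_le_sup : inf (Uset g K) <= sup (Uset g K).
Proof.
by apply: (@le_trans _ _ pi0); [exact: ge_inf|exact: ub_le_sup].
Qed.

Lemma ddH_ge0_left x : 0 < x < inf (Uset g K) -> 0 <= ddH x.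
Proof.
move=> /andP[x0 xU].
have x01 : 0 < x < 1.
  rewrite x0 (lt_le_trans xU)//; have [/andP[_ p1] _ _] := hG2.
  by rewrite (le_trans _ (ltW p1))//; exact: ge_inf.
rewrite (ddH_ge0 x01) leNgt; apply/negP => Ux.
by move: xU; rewrite ltNge => /negP; apply; exact: (ge_inf lbU (conj x01 Ux)).
Qed.

Lemma ddH_ge0_right x : sup (Uset g K) < x < 1 -> 0 <= ddH x.
Proof.
move=> /andP[Ux x1].
have x01 : 0 < x < 1.
  rewrite x1 (le_lt_trans _ Ux)//; have [/andP[p0 _] _ _] := hG2.
  by rewrite (le_trans (ltW p0))//; exact: ub_le_sup.
rewrite (ddH_ge0 x01) leNgt; apply/negP => xU.
by move: Ux; rewrite ltNge => /negP; apply; exact: (ub_le_sup ubU (conj x01 xU)).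
Qed.

(** [Uset] has points [y < x < z]. Left of [pi0], [genA g] is smaller at [x] than at [y]; right of
    it, smaller than at [z]. Hence [x] belongs to [Uset]. *)
Lemma ddH_le0_mid x : inf (Uset g K) < x < sup (Uset g K) -> ddH x <= 0.
Proof.
have [/andP[p0 p1] dec inc] := hG2.
have U0 : Uset g K !=set0 by exists pi0.
move=> /andP[ix xs].
have [y [/andP[y0 y1] Uy] yx] := inf_lt U0 ix.
have [z [/andP[z0 z1] Uz] xz] := sup_gt U0 xs.
have x01 : 0 < x < 1 by rewrite (lt_trans y0 yx) (lt_trans xz z1).
suff gx : genA g x < - K^-1.
  by rewrite leNgt; apply/negP => /ltW; rewrite (ddH_ge0 x01) leNgt gx.
have [xp|px|->//] := ltgtP x pi0.
  apply: lt_trans Uy; apply: dec => //; rewrite in_itv/= ?y0 ?(lt_trans yx xp)// xp.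
  by case/andP: x01 => ->.
apply: lt_trans Uz; apply: inc => //; rewrite in_itv/= ?z1 ?(lt_trans px xz)// px.
by case/andP: x01 => _ ->.
Qed.

End convexity_of_H.

Theorem theorem3p1 (R : realType) (g : R -> R) (pi0 alpha sigma c : R)
    (hG1 : G1 g) (hG2 : G2 g pi0)
    (halpha : alpha != 0) (hsigma : 0 < sigma) (hc : 0 < c) :
  let K := alpha ^+ 2 / (c * sigma ^+ 2) in
  forall (p : R) (hp : 0 < p < 1)
    (d : measure_display) (T : measurableType d) (P : probability T R)
    (F : R -> set (set T)) (hF : filtration F)
    (W : R -> T -> R) (hW : brownian_motion P F W)
    (theta : {RV P >-> bool})
    (hindep : independent P (sigma_fun theta) (sigma_process `[0, +oo[ W))
    (hprior : P (theta @^-1` [set true]) = p%:E)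
    (Pi : R -> T -> R)
    (hPi : posterior_process P theta (signal alpha sigma theta W) Pi),
  (- K^-1 <= genA g pi0 -> value P c g Pi = (g p)%:E) /\
  (genA g pi0 < - K^-1 -> forall A B : R, double_tangency g K A B ->
    value P c g Pi = (Vcand g K A B p)%:E).
Proof.
move=> K p hp d T P F hF W hW theta hindep hprior Pi hPi.
have hk : 2 * K^-1 * alpha ^+ 2 = 2 * c * sigma ^+ 2.
  by rewrite /K; field; rewrite halpha/= !gt_eqF.
pose H := Hfun g K; pose dH := derive1 H.
(* Subtracting [2 * K^-1 * Psi] turns this [Psi_affine] into the tangent to [H] at [x], and [g] into
   [H]; so it lies below [g] exactly where the tangent lies below [H]. *)
have lineE x y : Psi_affine (2 * K^-1) (H x - x * dH x) (dH x) y =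
    H x + dH x * (y - x) - H y + g y.
  by rewrite /Psi_affine /H /Hfun; ring.
have lower x : 0 < x < 1 ->
    (forall y, 0 < y < 1 -> H x + dH x * (y - x) <= H y) ->
    ((H x + dH x * (p - x) - H p + g p)%:E <= value P c g Pi)%E.
  move=> x01 tan; rewrite -lineE; apply: value_ge => tau tauP.
  apply: (expected_cost_ge hsigma hp hF hW hindep hprior hPi hc hk
    (G1_bounded hG1) (G1_continuous hG1)) => // y y01.
  by rewrite lineE -lerBrDr subrr subr_le0 tan.
have now := value_le_now hsigma hp hF hW hindep hprior hPi c (G1_continuous hG1).
(* A tangent at [p] that minorises [H] makes immediate stopping optimal; this serves the first claim
   and, in the second, the points outside []A, B[]. *)
have stop : (forall y, 0 < y < 1 -> H p + dH p * (y - p) <= H y) ->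
    value P c g Pi = (g p)%:E.
  move=> tan; apply/eqP; rewrite eq_le; apply/andP; split; first exact: now.
  by have := lower p hp tan; rewrite subrr mulr0 addr0 subrr add0r.
split=> [hpi|hpi A B].
  by apply: stop => y y01; exact: (tangent_le_Hfun hG1 hG2).
move=> [/andP[A0 A1] /andP[B0 B1] [AU UB] chord slope].
have iU := inf_Uset_le_sup hG2 hpi.
rewrite /Vcand; case: ifPn => ApB; last first.
  apply: stop => y y01.
  exact: (outer_tangent_le (is_derive_Hfun K hG1) (is_derive_derive1_Hfun K hG1) A0 B1 AU iU UB
    (ddH_ge0_left hG2 hpi) (ddH_ge0_right hG2 hpi) (ddH_le0_mid hG2 hpi) chord slope hp y01 ApB).
have eqV : 2 * K^-1 * Psi p + dH A * p + H A - A * dH A =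
  Psi_affine (2 * K^-1) (H A - A * dH A) (dH A) p by rewrite /Psi_affine; ring.
rewrite -/H -/dH eqV; apply/eqP; rewrite eq_le; apply/andP; split.
  (* The line meets [H] at [A] by construction and at [B] by [chord], so [Psi_affine] and [g] agree
     at both ends. *)
  apply: (value_le_Psi_affine hsigma hp hF hW hindep hprior hPi hc hk
    (G1_bounded hG1) (G1_continuous hG1) A0 B1 ApB).
    by rewrite lineE; ring.
  have dHA : dH A * (B - A) = H B - H A by rewrite /dH /H.
  by rewrite lineE dHA; ring.
rewrite lineE; apply: lower; first by rewrite A0.
exact: (double_tangent_le (is_derive_Hfun K hG1) (is_derive_derive1_Hfun K hG1) A0 B1 AU iU UB
    (ddH_ge0_left hG2 hpi) (ddH_ge0_right hG2 hpi) (ddH_le0_mid hG2 hpi) chord slope).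
Qed.
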